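(* Let fixed data without frozen variables be given with $d_i=1$ for all $i$, such that $\{\cdot,\cdot\}$ has rank two and the induced non-degenerate skew-symmetric pairing on $N/K$ is unimodular, together with a seed $\mathbf{s}=(e_1,\dots,e_n)$ such that the image of each $e_i$ in $N/K$ is primitive. Let $(Y,D)$ be the general fibre of the associated family $(\mathcal{Y},\mathcal{D})\to T_{K^*}$. Suppose that every irreducible component of $D$ has self-intersection $-2$. Then: (1) $\Gamma(\mathcal{A}_{\mathrm{prin}},\mathcal{O}_{\mathcal{A}_{\mathrm{prin}}})$ is non-Noetherian. (2) For $t\in T_M$ very general (outside a countable union of proper closed subsets), with $\mathcal{A}_t$ the corresponding cluster variety with general coefficients, $\Gamma(\mathcal{A}_t,\mathcal{O}_{\mathcal{A}_t})$ is non-Noetherian.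
   Context: We work over a field $\Bbbk$ of characteristic zero; $z^m$ denotes a character of a torus. The fixed data here amount to: a lattice $N$ of rank $n$ with a skew-symmetric bilinear form $\{\cdot,\cdot\}:N\times N\to\mathbb{Z}$ (with $N^\circ=N=N_{\mathrm{uf}}$, all $d_i=1$), $M=\operatorname{Hom}(N,\mathbb{Z})$, $K=\{n\in N:\{n,\cdot\}=0\}$. A seed is a basis $\mathbf{s}=(e_1,\dots,e_n)$ of $N$. Put $\epsilon_{ij}=\{e_i,e_j\}$, $v_i=\{e_i,\cdot\}\in M$, $[r]_+=\max(0,r)$. The mutation $\mu_k(\mathbf{s})=(e'_i)$ is $e'_k=-e_k$, $e'_i=e_i+[\epsilon_{ik}]_+e_k$ for $i\ne k$. Cluster varieties: to each seed $\mathbf{s}$ attach the torus $\mathcal{A}_{\mathrm{prin},\mathbf{s}}=\operatorname{Spec}\Bbbk[M\oplus N]$, with birational mutation maps $\mu_k:\mathcal{A}_{\mathrm{prin},\mathbf{s}}\dashrightarrow\mathcal{A}_{\mathrm{prin},\mu_k(\mathbf{s})}$, $\mu_k^*z^{(m,n)}=z^{(m,n)}(1+z^{(v_k,e_k)})^{-\langle e_k,m\rangle}$. Let $\mathfrak{T}$ be the oriented rooted tree with $n$ outgoing edges at each vertex labelled by $1,\dots,n$, whose root carries $\mathbf{s}$ and where an edge labelled $k$ from $w$ to $w'$ gives $\mathbf{s}_{w'}=\mu_k(\mathbf{s}_w)$. Composing mutations or their inverses along simple paths gives birational maps between any two of the tori $\mathcal{A}_{\mathrm{prin},\mathbf{s}_w}$;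 $\mathcal{A}_{\mathrm{prin}}$ is obtained by gluing all these tori along the largest open subsets on which these maps are isomorphisms onto open images. The map $n\mapsto(0,n)$ induces $\pi:\mathcal{A}_{\mathrm{prin}}\to T_M=\operatorname{Spec}\Bbbk[N]$, and $\mathcal{A}_t=\pi^{-1}(t)$. The family $(\mathcal{Y},\mathcal{D})$: put $\bar N=N/K$, let $w_i$ be the image of $e_i$, and choose $\bigwedge^2\bar N\cong\mathbb{Z}$ such that the form induced by $\{\cdot,\cdot\}$ on $\bar N$ is $(x,y)\mapsto x\wedge y$. Let $\psi:N\to\bar N$ be the quotient map and $\varphi:\bar N\to M$, $\bar n\mapsto(n\mapsto\psi(n)\wedge\bar n)$. Choose a complete non-singular fan $\bar\Sigma$ in $\bar N$ containing each $\mathbb{R}_{\ge0}w_i$ as a ray, with toric surface $\bar Y$. Regarding $\bar\Sigma$ as a fan $\Sigma$ in $M$ via $\varphi$, there is a map $\bar\lambda:\mathrm{TV}(\Sigma)\cong\bar Y\times T_{K^*}\to T_{K^*}=\operatorname{Spec}\Bbbk[K]$. Let $D_i\subset\mathrm{TV}(\Sigma)$ be the toric divisor of the ray of $\varphi(w_i)$ and $Z_i=D_i\cap\bar V(1+z^{e_i})$, $\bar V$ denoting closure of the zero locus in the torus $\operatorname{Spec}\Bbbk[N]$; it is the image of a section of $\bar\lambda$. $\mathcal{Y}$ is obtained by blowing up $Z_1,\dots,Z_n$ in some order, and $\mathcal{D}$ is the proper transform of the toric boundary. A general fibre $(Y,D)$ is the blow-up of $\bar Y$ at $n$ distinct points of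 the smooth locus of the toric boundary, with $D$ the proper transform of the toric boundary. *)

(* Defs.v *)
From mathcomp Require Export all_boot all_order all_algebra finmap.
From mathcomp Require Export boolp classical_sets cardinality fsbigop.
From mathcomp Require Export mpoly.

Set Implicit Arguments.
Unset Strict Implicit.
Unset Printing Implicit Defensive.

Import Order.TTheory GRing.Theory Num.Theory.

Local Open Scope classical_set_scope.
Local Open Scope ring_scope.

(* An integral scheme X with function field F is represented by the set of its
   local rings O_(X,x), viewed as subrings of F; thus a point x IS its local
   ring, y lies in the closure of x iff O_y is contained in O_x (for separated
   X), and the sections over X are the intersection of the local rings. *)

Section Schemes.
Variable F : fieldType.
Implicit Types (A I P O C : set F) (X Z : set (set F)).

Definition is_subring A : Prop :=
  [/\ A 1, forall x y, A x -> A y -> A (x - y)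
    & forall x y, A x -> A y -> A (x * y)].

Definition is_ideal A I : Prop :=
  [/\ I `<=` A, I 0, forall x y, I x -> I y -> I (x + y)
    & forall a x, A a -> I x -> I (a * x)].

Definition is_prime_ideal A P : Prop :=
  [/\ is_ideal A P, ~ P 1
    & forall a b, A a -> A b -> P (a * b) -> P a \/ P b].

Definition noetherian A : Prop :=
  forall I, is_ideal A I ->
  exists (m : nat) (g : 'I_m -> F), (forall i, I (g i)) /\
    forall f, I f -> exists c : 'I_m -> F,
      (forall i, A (c i)) /\ f = \sum_(i < m) c i * g i.

Definition localization A P : set F :=
  [set f | exists a b, [/\ A a, A b, ~ P b & f = a / b]].

Definition Spec A : set (set F) :=
  [set O | exists P, is_prime_ideal A P /\ O = localization A P].

Definition global_sections X : set F := [set f | forall O, X O -> O f].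

Definition max_ideal O : set F := [set x | O x /\ (x = 0 \/ ~ O x^-1)].

(* O[m/x] *)
Definition blowup_chart O (x : F) : set F :=
  [set f | forall R, is_subring R -> O `<=` R ->
     (forall y, max_ideal O y -> R (y / x)) -> R f].

(* Blow-up of X at a set Z of closed points, each with its reduced structure:
   above O the blow-up of Spec O at its closed point is covered by the
   Spec O[m/x], and the part of these lying off the exceptional divisor
   consists of points of Spec O other than the closed one. *)
Definition blowup X Z : set (set F) :=
  (X `\` Z) `|`
  [set R | exists O x, [/\ Z O, max_ideal O x, x <> 0 & Spec (blowup_chart O x) R]].

(* C is meant to be the local ring of the generic point of a curve. *)
Definition uniformizer C (h : F) : Prop :=
  max_ideal C h /\ forall f, max_ideal C f -> exists2 g, C g & f = h * g.

Definition local_equation C O (g : F) : Prop :=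
  forall f, (O f /\ max_ideal C f) <-> (exists2 q, O q & f = g * q).

Definition closed_points_on X C : set (set F) :=
  [set O | [/\ X O, O `<=` C & O <> C]].

Section Intersection.
Variables (k : fieldType) (iota : k -> F).

(* dim_k O/(g, a) = d *)
Definition colength O (g a : F) (d : nat) : Prop :=
  exists b : 'I_d -> F, (forall i, O (b i)) /\
    forall f, O f -> exists! c : 'rV[k]_d,
      exists q r, [/\ O q, O r &
        f - \sum_(i < d) iota (c 0 i) * b i = g * q + a * r].

(* [kappa(P) : k] times the order at P of the rational section of O(-C)|_C
   given by the class of h in I_C/I_C^2, for P a closed point on C: with g a
   generator of I_C at P, the unit h/g of O_C is written a/b with a, b in O_P,
   and the order of (a/b)|_C is dim O_P/(g, a) - dim O_P/(g, b). *)
Definition conormal_order C (h : F) (P : set F) (m : int) : Prop :=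
  exists g a b, [/\ local_equation C P g,
    [/\ P a, P b, ~ max_ideal C a & ~ max_ideal C b],
    h * b = a * g
    & exists d1 d2 : nat,
        [/\ colength P g a d1, colength P g b d2 & m = d1%:Z - d2%:Z]].

(* C^2 = deg O_X(C)|_C = - deg O_X(-C)|_C, for a curve C on a nonsingular
   complete surface X over k. *)
Definition self_intersection X C (d : int) : Prop :=
  exists h, uniformizer C h /\
  exists ord : set F -> int,
    [/\ forall P, closed_points_on X C P -> conormal_order C h P (ord P),
        finite_set [set P | closed_points_on X C P /\ ord P <> 0]
      & d = - \sum_(P \in closed_points_on X C) ord P].

End Intersection.
End Schemes.

(* Lattices Z^d are row vectors; M = Hom(N, Z) is written in the dual basis. *)

Definition pairing (d : nat) (x m : 'rV[int]_d) : int := (x *m m^T) 0 0.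

Definition monomial (F : fieldType) (d : nat) (x : 'I_d -> F) (a : 'rV[int]_d) : F :=
  \prod_(i < d) x i ^ a 0 i.

Definition ratfun (k : fieldType) (d : nat) : fieldType := {fraction {mpoly k[d]}}.

Definition cst (k : fieldType) (d : nat) (c : k) : ratfun k d := tofrac (c%:MP_[d]).

(* The character z^a of Spec k[Z^d]. *)
Definition zmon (k : fieldType) (d : nat) (a : 'rV[int]_d) : ratfun k d :=
  monomial (fun i => tofrac ('X_i : {mpoly k[d]})) a.

Definition lincomb (k F : fieldType) (G : Type) (iota : k -> F) (chi : G -> F)
  (s : seq (k * G)) : F := \sum_(x <- s) iota x.1 * chi x.2.

(* The k-span of the chi a with a in S. *)
Definition kspan (k F : fieldType) (G : eqType) (iota : k -> F) (chi : G -> F)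
  (S : set G) : set F :=
  [set f | exists s : seq (k * G),
     (forall x, x \in s -> S x.2) /\ f = lincomb iota chi s].

(* Laurent polynomials as formal sums, to be read as functions on the torus
   Spec k[Z^d] or evaluated at its points with values in an extension of k. *)
Definition laurent (k : fieldType) (d : nat) := seq (k * 'rV[int]_d).

Definition laurent_fun (k : fieldType) (d : nat) (p : laurent k d) : ratfun k d :=
  lincomb (@cst k d) (@zmon k d) p.

Definition laurent_eval (k L : fieldType) (d : nat) (iota : k -> L)
  (t : 'I_d -> L) (p : laurent k d) : L := lincomb iota (monomial t) p.

(* The closed subset V(Z) of Spec k[Z^d] is proper iff Z has a nonzero element. *)
Definition proper_closed (k : fieldType) (d : nat) (Z : set (laurent k d)) : Prop :=
  exists2 p, Z p & laurent_fun p <> 0.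

Definition in_closed (k L : fieldType) (d : nat) (iota : k -> L)
  (Z : set (laurent k d)) (t : 'I_d -> L) : Prop :=
  forall p, Z p -> laurent_eval iota t p = 0.

(* B is the Gram matrix of {.,.} on N = Z^n; the rows of s : 'M_n form a seed. *)

Section Cluster.
Variables (n : nat) (B : 'M[int]_n).

Definition skew (x y : 'rV[int]_n) : int := (x *m B *m y^T) 0 0.

Definition radical : set 'rV[int]_n := [set x | forall y, skew x y = 0].

(* Every functional on N/K is represented by an element (injectivity of
   N/K -> (N/K)^* is automatic). *)
Definition unimodular_mod_radical : Prop :=
  forall m : 'rV[int]_n, (forall x, radical x -> pairing x m = 0) ->
  exists y, forall x, pairing x m = skew y x.

Definition mutate (k : 'I_n) (s : 'M[int]_n) : 'M[int]_n :=
  \matrix_(i < n)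
    if i == k then - row k s
    else row i s + Num.max 0 (skew (row i s) (row k s)) *: row k s.

(* The vertices of the rooted tree are the sequences of labels read from the
   root.  The torus at each vertex is embedded in the function field F of the
   root torus by giving the pull-back of each character z^(m, x), where
   chi0 (m, x) is this pull-back at the root. *)
Fixpoint pulled_char (F : fieldType) (chi : 'rV[int]_n * 'rV[int]_n -> F)
  (s : 'M[int]_n) (w : seq 'I_n) : 'rV[int]_n * 'rV[int]_n -> F :=
  if w is k :: w' then
    pulled_char
      (fun mx => chi mx *
         (1 + chi (row k s *m B, row k s)) ^ (- pairing (row k s) mx.1))
      (mutate k s) w'
  else chi.

(* Gluing the tori along the largest open subsets where the birational maps are
   isomorphisms identifies two points iff their local rings agree in F. *)
Definition glued_tori (k F : fieldType) (iota : k -> F)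
  (chi0 : 'rV[int]_n * 'rV[int]_n -> F) (s : 'M[int]_n) : set (set F) :=
  \bigcup_(w in [set: seq 'I_n]) Spec (kspan iota (pulled_char chi0 s w) setT).

Definition Aprin (k : fieldType) (s : 'M[int]_n) : set (set (ratfun k (n + n))) :=
  glued_tori (@cst k (n + n)) (fun mx => zmon k (row_mx mx.1 mx.2)) s.

(* The fibre of pi over a point t of T_M with values in L: the tori
   Spec L[M], on which z^(m, x) restricts to t^x z^m, glued by the restricted
   maps.  Restricting the gluing of A_prin could identify fewer points, but as
   the overlaps are dense in the (integral) tori, the sections are the same. *)
Definition A_at (L : fieldType) (t : 'I_n -> L) (s : 'M[int]_n) :
  set (set (ratfun L n)) :=
  glued_tori (@cst L n) (fun mx => zmon L mx.1 * cst n (monomial t mx.2)) s.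

End Cluster.

Arguments Aprin {n} B k s.

Definition wedge (x y : 'rV[int]_2) : int := x 0 0 * y 0 1 - x 0 1 * y 0 0.

Definition primitive (d : nat) (x : 'rV[int]_d) : Prop :=
  forall (c : int) y, x = c *: y -> c = 1 \/ c = -1.

(* x |-> x *m psi is the quotient map N -> N/K followed by an identification
   N/K = Z^2 taking the induced form to the wedge product. *)
Definition quotient_map (n : nat) (B : 'M[int]_n) (psi : 'M[int]_(n, 2)) : Prop :=
  [/\ forall y, exists x : 'rV[int]_n, x *m psi = y,
      forall x, x *m psi = 0 <-> radical B x
    & forall x y, skew B x y = wedge (x *m psi) (y *m psi)].

(* A cone is given by the set of primitive generators of its rays. *)
Definition in_cone (S : {fset 'rV[int]_2}) (v : 'rV[int]_2) : Prop :=
  exists c : 'rV[int]_2 -> nat, v = \sum_(u <- S) u *+ c u.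

(* For cones generated by parts of bases, faces are generated by subsets, and
   the conditions below on lattice points are those on real points. *)
Definition complete_nonsingular_fan (Sigma : {fset {fset 'rV[int]_2}}) : Prop :=
  [/\ forall S T : {fset 'rV[int]_2}, S \in Sigma -> (T `<=` S)%fset -> T \in Sigma,
      forall S, S \in Sigma -> exists2 b : 'M[int]_2, b \in unitmx
        & forall u, u \in S -> exists i, u = row i b,
      forall S T v, S \in Sigma -> T \in Sigma ->
        in_cone S v -> in_cone T v -> in_cone (S `&` T)%fset v
    & forall v, exists2 S, S \in Sigma & in_cone S v].

Section Surface.
Variables (k : fieldType) (n : nat) (psi : 'M[int]_(n, 2)) (e : 'M[int]_n).
Variable Sigma : {fset {fset 'rV[int]_2}}.

Definition wray (i : 'I_n) : 'rV[int]_2 := row i e *m psi.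

(* The characters of the torus of Ybar are z^u with u in N/K, and by the
   definition of phi such a u pairs with the cocharacter phi(v) as u /\ v. *)
Definition toric_chart (S : {fset 'rV[int]_2}) : set (ratfun k 2) :=
  kspan (@cst k 2) (@zmon k 2) [set u | forall v, v \in S -> 0 <= wedge u v].

Definition toric_surface : set (set (ratfun k 2)) :=
  [set O | exists2 S, S \in Sigma & Spec (toric_chart S) O].

(* The generic point of the toric divisor of the ray of v; blowing up points
   does not change this local ring, which is therefore also that of the proper
   transform. *)
Definition boundary_divisor (v : 'rV[int]_2) : set (ratfun k 2) :=
  localization (toric_chart [fset v]%fset)
    (kspan (@cst k 2) (@zmon k 2) [set u | 0 < wedge u v]).

(* Let t : N -> k^* be a point of Spec k[N], the torus of TV(Sigma).  Translation
   by t identifies Ybar with the fibre of lambdabar over t|_K, and z^x restricts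
   on it to t^x z^(psi x).  The generic point of V(1 + z^(e_i)) in the fibre: *)
Definition center_curve (t : 'I_n -> k) (i : 'I_n) : set (ratfun k 2) :=
  localization (toric_chart fset0)
    [set f | exists2 g, toric_chart fset0 g
       & f = (1 + cst 2 (monomial t (row i e)) * zmon k (wray i)) * g].

(* The intersection of Z_i with the fibre. *)
Definition center (t : 'I_n -> k) (i : 'I_n) : set (set (ratfun k 2)) :=
  [set O | [/\ toric_surface O, O `<=` boundary_divisor (wray i)
             & O `<=` center_curve t i]].

Definition fibre_surface (t : 'I_n -> k) : set (set (ratfun k 2)) :=
  blowup toric_surface (\bigcup_(i in [set: 'I_n]) center t i).

(* A property of the fibres over the points of a nonempty open subset of
   T_(K^* ) = Spec k[K].  Points are lifted to Spec k[N]; every point lifts, as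
   N/K is free. *)
Definition for_general_fibre (B : 'M[int]_n) (Q : ('I_n -> k) -> Prop) : Prop :=
  exists Z : set (laurent k n),
    [/\ forall p, Z p -> forall x, x \in p -> radical B x.2,
        proper_closed Z
      & forall t : 'I_n -> k, (forall i, t i != 0) ->
          ~ in_closed id Z t -> Q t].

Definition boundary_self_intersections (t : 'I_n -> k) (d : int) : Prop :=
  forall v, [fset v]%fset \in Sigma ->
    self_intersection (@cst k 2) (fibre_surface t) (boundary_divisor v) d.

End Surface.

(* A property of very general points t of T_M = Spec k[N].  A point of the
   scheme T_M is given by its values in an extension L of k (for instance its
   residue field). *)
Definition very_general (k : fieldType) (n : nat)
  (Q : forall L : fieldType, ('I_n -> L) -> Prop) : Prop :=
  exists Z : nat -> set (laurent k n),
    (forall j, proper_closed (Z j)) /\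
    forall (L : fieldType) (iota : {rmorphism k -> L}) (t : 'I_n -> L),
      (forall i, t i != 0) -> (forall j, ~ in_closed iota (Z j) t) -> Q L t.

(* Main.v *)
From HB Require Import structures.
From mathcomp Require Import zify ring.
From mathcomp.multinomials Require Import monalg mpoly.
Require Import Defs.
Set Implicit Arguments.
Unset Strict Implicit.
Unset Printing Implicit Defensive.
Import Order.TTheory GRing.Theory Num.Theory.
Local Open Scope classical_set_scope.
Local Open Scope ring_scope.

(** The sections over a variety glued from tori are the functions that are Laurent polynomials on
    each torus. Both parts of the theorem are statements about Laurent polynomials
    [f = \sum_m c_m z^m], [m] in [M], over a ring [C] of constants: for the family [C = k[N]], and
    for a fibre the [t^x] span [C] over the ground field. What is used of the constants [T x = z^x],
    respectively [T x = t^x], is that [T x = 1] holds for [x = 0] only; for the fibres this is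
    what very general means.

    Two mutations of a seed glue tori in codimension one, so a function that is a Laurent polynomial
    on the initial torus and its [n] neighbours is one on all tori ([upper_bound_all]). Hence [f] is
    a section if and only if for all [k] and [r > 0] the part of [f] with exponents [<e_k, m> = - r]
    is divisible by the power [r] of [1 + T e_k z^(v_k)]. Since [v_k = phi (w_k)], this condition
    concerns the values of [c] on each coset of [phi (Z^2)] in [M]: along lines of direction [w_k]
    they are the coefficients of polynomials with a zero of order at least [r] at [- T (- e_k)].

    The geometry of the surface enters through one relation. If [v] is a ray of the fan with
    neighbours [v'] and [v''], and [c_v] of the [w_k] are equal to [v], then the boundary curve of
    [v] has self-intersection -2 only if [v' + v'' = (2 - c_v) v]. To see this from the definition
    of self-intersection by local equations, the closed points of the curve are matched with the
    places of a rational function field ([closed_pointsP]), and the order of a conormal section at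
    each place is computed as the valuation of a rational function plus a local term. The valuations
    have sum zero ([place_sum]), which gives the relation ([degree_relation]).

    Let [deg m = \sum_k <e_k, m>]. By the relation the [w_k] have sum zero, so [deg] is constant on
    the cosets. On a coset of degree at most zero the orders of vanishing along the edges of the
    Newton polygon of a section add up to its whole boundary, which has two consequences: the edge
    polynomials are products of the linear factors at the [- T (- e_k)], and the product of these
    numbers around the polygon is 1. As [T] is injective, the polygon is a point
    ([degree0_support]), and the only sections of degree at most zero are constants
    ([section_degree]). On a coset of degree one, the multiples of the polygon with normals [v]
    contain more lattice points than there are conditions, by a number that tends to infinity; so
    there are sections of degree one whose coefficients vanish on any given finite set
    ([sections_exist], [sections_unbounded]). If the ideal of sections with exponents of positive
    degree were finitely generated, its elements of degree one would have their exponents in a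
    fixed finite set. So the ring is not Noetherian ([sections_not_noetherian]). *)

(** * Complete nonsingular fans in the plane *)

Notation Z2 := 'rV[int]_2.

Lemma ord2P (i : 'I_2) : i = 0 \/ i = 1.
Proof. by case: i => [[|[|i]] h] //; [left|right]; apply: val_inj. Qed.

Lemma Z2P (u v : Z2) : u 0 0 = v 0 0 -> u 0 1 = v 0 1 -> u = v.
Proof.
by move=> h0 h1; apply/rowP => i; case: (ord2P i) => ->. Qed.

Lemma wedgeDl u u' v : wedge (u + u') v = wedge u v + wedge u' v.
Proof. rewrite /wedge !mxE; ring. Qed.
Lemma wedgeDr u v v' : wedge u (v + v') = wedge u v + wedge u v'.
Proof. rewrite /wedge !mxE; ring. Qed.
Lemma wedgeZl c u v : wedge (c *: u) v = c * wedge u v.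
Proof. rewrite /wedge !mxE; ring. Qed.
Lemma wedgeZr c u v : wedge u (c *: v) = c * wedge u v.
Proof. rewrite /wedge !mxE; ring. Qed.
Lemma wedgeNl u v : wedge (- u) v = - wedge u v.
Proof. rewrite /wedge !mxE; ring. Qed.
Lemma wedgeNr u v : wedge u (- v) = - wedge u v.
Proof. rewrite /wedge !mxE; ring. Qed.
Lemma wedgexx u : wedge u u = 0.
Proof. rewrite /wedge; ring. Qed.
Lemma wedgeC u v : wedge u v = - wedge v u.
Proof. rewrite /wedge; ring. Qed.
Lemma wedge0l v : wedge 0 v = 0.
Proof. rewrite /wedge !mxE; ring. Qed.
Lemma wedge0r v : wedge v 0 = 0.
Proof. rewrite /wedge !mxE; ring. Qed.
Definition wedgeE := (wedgeDl, wedgeDr, wedgeZl, wedgeZr, wedgeNl, wedgeNr, wedgexx).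

Lemma wedge_sumr (I : Type) (r : seq I) (P : pred I) (f : I -> Z2) u :
  wedge u (\sum_(i <- r | P i) f i) = \sum_(i <- r | P i) wedge u (f i).
Proof. exact: (big_morph (wedge u) (wedgeDr u) (wedge0r u)). Qed.

Lemma wedge_expand a b x : wedge a b *: x = wedge x b *: a + wedge a x *: b.
Proof. by apply: Z2P; rewrite /wedge !mxE; ring. Qed.

Lemma wedge_basis a b x : wedge a b = 1 -> x = wedge x b *: a + wedge a x *: b.
Proof. by move=> ab; rewrite -wedge_expand ab scale1r. Qed.

Lemma wedge_line v b x : wedge v b = 1 -> wedge x v = 0 -> x = wedge x b *: v.
Proof. by move=> vb xv; rewrite {1}(wedge_basis x vb) (wedgeC v x) xv oppr0 scale0r addr0. Qed.

Lemma in_cone1 (v x : Z2) : in_cone [fset v]%fset x <-> exists c : nat, x = v *+ c.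
Proof.
split=> [[c ->]|[c ->]]; first by exists (c v); rewrite big_seq_fset1.
by exists (fun=> c); rewrite big_seq_fset1.
Qed.

Lemma in_cone2 (v w x : Z2) : v != w ->
  in_cone [fset v; w]%fset x <-> exists c d : nat, x = v *+ c + w *+ d.
Proof.
move=> vw; have nin : v \notin [fset w]%fset by rewrite inE.
split=> [[c ->]|[c [d ->]]].
  by exists (c v), (c w); rewrite big_fsetU1 //= big_seq_fset1.
exists (fun u => if u == v then c else d).
by rewrite big_fsetU1 //= big_seq_fset1 eqxx eq_sym (negbTE vw).
Qed.

Section UnimodularCone.
Variables (S : {fset Z2}) (b : 'M[int]_2).
Hypothesis ub : b \in unitmx.
Hypothesis Sb : forall u, u \in S -> exists i, u = row i b.

Definition coord (x : Z2) i := (x *m invmx b) 0 i.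

Lemma coord_row i j : coord (row j b) i = (i == j)%:R.
Proof. by rewrite /coord -row_mul mulmxV // !mxE eq_sym. Qed.

Lemma coordD x y i : coord (x + y) i = coord x i + coord y i.
Proof. by rewrite /coord mulmxDl mxE. Qed.

Lemma coordMn x c i : coord (x *+ c) i = coord x i *+ c.
Proof. by rewrite /coord -scaler_nat -scalemxAl mxE mulr_natl. Qed.

Lemma coord_expand x : x = \sum_i coord x i *: row i b.
Proof. by rewrite -mulmx_sum_row mulmxKV. Qed.

(** In the coordinates of a basis that contains the generators, membership in the cone is a
    separate condition on each coordinate. *)
Lemma in_coneP x : in_cone S x <->
  forall i, 0 <= coord x i /\ (row i b \notin S -> coord x i = 0).
Proof.
split=> [[c ->] i|h].
  have cs : coord (\sum_(u <- S) u *+ c u) i = \sum_(u <- S) coord u i *+ c u.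
    rewrite (@big_morph _ _ (coord^~ i) 0 +%R 0 +%R).
    - by apply: eq_bigr => u _; rewrite coordMn.
    - by move=> u v; rewrite coordD.
    - by rewrite /coord mul0mx mxE.
  rewrite cs big_seq; split=> [|iS].
    by apply: sumr_ge0 => u /Sb [j ->]; rewrite coord_row mulrn_wge0.
  rewrite big1 // => u uS; have [j ju] := Sb uS; rewrite ju coord_row.
  by case: eqVneq => [ij|]; rewrite ?mul0rn //; move: iS; rewrite ij -ju uS.
exists (fun u => \sum_i (u == row i b) * `|coord x i|)%N.
rewrite {1}(coord_expand x).
transitivity (\sum_(u <- S) \sum_i u *+ ((u == row i b) * `|coord x i|)%N); last first.
  by apply: eq_bigr => u _; rewrite sumrMnr.
rewrite exchange_big; apply: eq_bigr => i _ /=; have [ge0 out] := h i.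
have [iS|iS] := boolP (row i b \in S); last first.
  rewrite out // scale0r big_seq big1 // => u uS.
  by case: eqVneq => [ui|]; rewrite ?mul0n ?mulr0n //; move: iS; rewrite -ui uS.
  rewrite (bigD1_seq (row i b)) ?fset_uniq //=.
  rewrite eqxx mul1n big1 ?addr0; last first.
  by move=> u /negbTE ->; rewrite mul0n mulr0n.
by rewrite -scaler_nat natz gez0_abs.
Qed.
End UnimodularCone.

Lemma wedge_rows (b : 'M[int]_2) : wedge (row 0 b) (row 1 b) = \det b.
Proof.
rewrite (expand_det_row _ 0) !big_ord_recl big_ord0 /cofactor !det_mx11 !mxE /=.
have -> : lift ord0 ord0 = 1 :> 'I_2 by exact: val_inj.
have -> : lift 1 ord0 = 0 :> 'I_2 by exact: val_inj.
by rewrite /wedge !mxE /= addr0 expr0 expr1 mul1r mulN1r mulrN.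
Qed.

Lemma unitmx_int (b : 'M[int]_2) : b \in unitmx -> \det b = 1 \/ \det b = -1.
Proof. by rewrite unitmxE => /orP [/eqP ->|/eqP ->]; [left|right]. Qed.

Section Fan.
Variable Sigma : {fset {fset Z2}}.
Hypothesis fan : complete_nonsingular_fan Sigma.

Lemma fan_face (S T : {fset Z2}) : S \in Sigma -> (T `<=` S)%fset -> T \in Sigma.
Proof. by case: fan => h _ _ _; apply: h. Qed.

Lemma fan_meet (S T : {fset Z2}) v : S \in Sigma -> T \in Sigma ->
  in_cone S v -> in_cone T v -> in_cone (S `&` T)%fset v.
Proof. by case: fan => _ _ h _; apply: h. Qed.

Lemma fan_basis (S : {fset Z2}) : S \in Sigma -> exists2 b : 'M[int]_2, b \in unitmx
        & forall u, u \in S -> exists i, u = row i b.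
Proof. by case: fan => _ h _ _; apply: h. Qed.

Lemma ray_neq0 v : [fset v]%fset \in Sigma -> v != 0.
Proof.
move=> /fan_basis [b ub h]; have [|i ->] := h v; first by rewrite inE.
apply/eqP => i0; move: (coord_row ub i i); rewrite i0 eqxx /coord mul0mx mxE.
by [].
Qed.

Lemma ray_in_cone (S : {fset Z2}) v : S \in Sigma -> [fset v]%fset \in Sigma ->
  in_cone S v -> v \in S.
Proof.
move=> SS vS cv; have := fan_meet SS vS cv; case.
  by apply/in_cone1; exists 1%N.
move=> c vc; apply: contraT => nvS; have := ray_neq0 vS; rewrite vc.
rewrite (_ : (S `&` [fset v])%fset = fset0) ?big_seq_fset0 ?eqxx //.
by apply/fsetP => u; rewrite !inE; case: eqP => [->|]; rewrite ?andbF ?(negbTE nvS).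
Qed.

(** The coordinates with respect to a basis are themselves of the form [wedge u], so a cone
    generated by part of a basis is the dual of its dual. *)
Lemma fan_dual (S : {fset Z2}) v : S \in Sigma -> [fset v]%fset \in Sigma ->
  (forall u, (forall s, s \in S -> 0 <= wedge u s) -> 0 <= wedge u v) -> v \in S.
Proof.
move=> SS vS h; apply: ray_in_cone => //; have [b ub Sb] := fan_basis SS.
pose d i : Z2 := \row_j (if j == 0 then - (invmx b) 1 i else (invmx b) 0 i).
have de i x : wedge (- d i) x = coord b x i.
  rewrite /wedge /coord !mxE !big_ord_recl big_ord0 /=.
  by have -> : lift ord0 ord0 = 1 :> 'I_2 by [exact: val_inj]; rewrite /=; ring.
apply/(in_coneP ub Sb) => i; split.
  rewrite -de; apply: h => s /Sb [j ->]; rewrite de coord_row //.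
move=> iS; apply/eqP; rewrite eq_le; apply/andP; split; last first.
  by rewrite -de; apply: h => s /Sb [j ->]; rewrite de coord_row //; exact: ler0n.
rewrite -oppr_ge0 -de -wedgeNl; apply: h => s sS; have [j sj] := Sb _ sS.
rewrite wedgeNl de sj coord_row //; case: eqVneq => [ij|]; rewrite ?oppr0 //.
by move: iS; rewrite ij -sj sS.
Qed.

Lemma ray_compl v (s : int) : [fset v]%fset \in Sigma -> s = 1 \/ s = -1 ->
  exists y, wedge v y = s.
Proof.
move=> /fan_basis [b ub h] hs; have [|i ->] := h v; first by rewrite inE.
have [d|d] := unitmx_int ub; have := wedge_rows b; rewrite d => w.
- case: (ord2P i) => ->; case: hs => ->.
  + by exists (row 1 b).
  + by exists (- row 1 b); rewrite wedgeNr w.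
  + by exists (- row 0 b); rewrite wedgeNr wedgeC w opprK.
  + by exists (row 0 b); rewrite wedgeC w.
- case: (ord2P i) => ->; case: hs => ->.
  + by exists (- row 1 b); rewrite wedgeNr w opprK.
  + by exists (row 1 b).
  + by exists (row 0 b); rewrite wedgeC w opprK.
  + by exists (- row 0 b); rewrite wedgeNr wedgeC w opprK.
Qed.

(** The points [v *+ N + y] with [wedge v y = s] lie in finitely many cones, so one cone contains
    infinitely many of them. It has [v] as a ray, since the direction of these points tends to
    that of [v], and a second ray on the side of [y]. *)
Lemma fan_neighbour v (s : int) : [fset v]%fset \in Sigma -> s = 1 \/ s = -1 ->
  exists w, [fset v; w]%fset \in Sigma /\ wedge v w = s.
Proof.
move=> vS hs; have [y vy] := ray_compl vS hs.
have [S SS infS] : exists2 S, S \in Sigma &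
    forall N : nat, exists2 N', (N <= N')%N & in_cone S (v *+ N' + y).
  apply: contrapT => noS.
  have hb (S : {fset Z2}) : exists N : nat, S \in Sigma ->
      forall N', (N <= N')%N -> ~ in_cone S (v *+ N' + y).
    have [SS|] := boolP (S \in Sigma); last by exists 0%N.
    apply: contrapT => hN; apply: noS; exists S => // N.
    apply: contrapT => hN'; apply: hN; exists N => _ N' NN' c.
    by apply: hN'; exists N'.
  have [bd bdP] := boolp.choice hb.
  have [_ _ _ /(_ (v *+ (\max_(S <- Sigma) bd S) + y)) [S SS]] := fan.
  by apply: bdP; rewrite ?leq_bigmax_seq.
have [b ub Sb] := fan_basis SS.
have vinS : v \in S.
  apply: ray_in_cone => //; apply/(in_coneP ub Sb) => i; split.
    rewrite leNgt; apply/negP => neg.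
    have [N' NN'] := infS (`|coord b y i| + 1)%N.
    move=> /(in_coneP ub Sb)/(_ i) [+ _]; rewrite coordD coordMn.
    move: (coord b v i) (coord b y i) NN' neg => p q NN' neg.
    have : 0 <= (-1 - p) * N'%:Z by apply: mulr_ge0; lia.
    by rewrite -(mulr_natr p) natz mulrBl mulN1r => ? ?; lia.
  move=> iS; have [N0 _ /(in_coneP ub Sb)/(_ i) [_ /(_ iS)]] := infS 0%N.
  have [N1 NN /(in_coneP ub Sb)/(_ i) [_ /(_ iS)]] := infS N0.+1.
  rewrite !coordD !coordMn -!(mulr_natr (coord b v i)) !natz => e1 e0.
  have /eqP : (N1%:Z - N0%:Z) * coord b v i = 0 by rewrite mulrBl !(mulrC _ (coord b v i)); lia.
  by rewrite mulf_eq0 => /orP [|/eqP //]; lia.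
have [N _ hN] := infS 0%N.
have [w wS wv] : exists2 w, w \in S & w != v.
  apply: contrapT => noW.
  have Sv : S = [fset v]%fset.
    apply/fsetP => u; rewrite inE; apply/idP/eqP => [uS|->//].
    by apply/eqP; apply: contraT => uv; case: noW; exists u.
  move: hN; rewrite Sv => /in_cone1 [c e].
  have := congr1 (wedge v) e.
  rewrite wedgeDr -!scaler_nat !wedgeZr wedgexx vy; lia.
have SE : S = [fset v; w]%fset.
  apply/fsetP => u; rewrite !inE; apply/idP/orP => [uS|[/eqP->|/eqP->]] //.
  have [i ui] := Sb _ uS; have [j vj] := Sb _ vinS; have [l wl] := Sb _ wS.
  have [ji|ij] := eqVneq j i; first by left; rewrite ui vj ji.
  have [li|il] := eqVneq l i; first by right; rewrite ui wl li.
  have jl : j = l.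
    by move: ij il; case: (ord2P i) => ->; case: (ord2P j) => ->; case: (ord2P l) => ->.
  by move: wv; rewrite wl vj jl eqxx.
exists w; rewrite -SE; split=> //.
move: hN; rewrite SE; case/(in_cone2 _ ltac:(by rewrite eq_sym; exact: wv)) => c [d e].
have := congr1 (wedge v) e.
rewrite !wedgeDr -!scaler_nat !wedgeZr wedgexx vy !mulr0 add0r add0r.
have w1 : wedge v w = 1 \/ wedge v w = -1.
  have [j vj] := Sb _ vinS; have [l wl] := Sb _ wS.
  have := wedge_rows b; have := unitmx_int ub.
  have : j != l by apply: contraNneq wv => jl; rewrite vj wl jl.
  rewrite vj wl; case: (ord2P j) => ->; case: (ord2P l) => -> // _ h.
    by move=> ->.
  by move=> dt; rewrite wedgeC dt; lia.
by rewrite natz; case: hs; case: w1 => -> ->; lia.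
Qed.

Lemma fan_pair_wedge v w : [fset v; w]%fset \in Sigma -> v != w ->
  wedge v w = 1 \/ wedge v w = -1.
Proof.
move=> /fan_basis [b ub h] vw; have dt := unitmx_int ub; have := wedge_rows b.
have [|i vi] := h v; first by rewrite !inE eqxx.
have [|j wj] := h w; first by rewrite !inE eqxx orbT.
have ij : i != j by apply: contraNneq vw => ij; rewrite vi wj ij.
rewrite vi wj; case: (ord2P i) ij => ->; case: (ord2P j) => -> // _.
  by move=> ->.
by move=> e; rewrite wedgeC e; lia.
Qed.

Lemma fan_pair_rays v w : [fset v; w]%fset \in Sigma ->
  [fset v]%fset \in Sigma /\ [fset w]%fset \in Sigma.
Proof.
by move=> h; split; apply: fan_face h _; apply/fsubsetP => u; rewrite !inE => ->; rewrite ?orbT.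
Qed.

(** A ray strictly between [v] and [w] would lie in the cone that they span, hence be one of its
    rays. *)
Lemma fan_separate v w v' s : [fset v; w]%fset \in Sigma -> wedge v w = s ->
  s = 1 \/ s = -1 -> [fset v']%fset \in Sigma -> 0 < s * wedge v v' ->
  v' = w \/ 0 < s * wedge w v'.
Proof.
move=> vwS vws hs v'S pos; have ss : s * s = 1 by case: hs => ->.
have ev : v' = (s * wedge v' w) *: v + (s * wedge v v') *: w.
  by rewrite -!scalerA -scalerDr -wedge_expand vws scalerA ss scale1r.
have vw : v != w by apply/eqP => vw; move: vws; rewrite vw wedgexx; case: hs; lia.
have [ge0|lt0] := leP 0 (s * wedge v' w); last first.
  by right; rewrite wedgeC; lia.
left; have : v' \in [fset v; w]%fset.
  apply: ray_in_cone => //; apply/in_cone2 => //.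
  exists (absz (s * wedge v' w)), (absz (s * wedge v v')).
  by rewrite -!scaler_nat !natz !gez0_abs ?(ltW pos).
by rewrite !inE => /orP [/eqP e|/eqP //]; move: pos; rewrite e wedgexx mulr0.
Qed.

Lemma fan_neighbour_uniq v w w' s : [fset v; w]%fset \in Sigma ->
  [fset v; w']%fset \in Sigma -> s = 1 \/ s = -1 ->
  wedge v w = s -> wedge v w' = s -> w = w'.
Proof.
move=> wS w'S hs ws w's; have ss : s * s = 1 by case: hs => ->.
have [_ rw] := fan_pair_rays wS; have [_ rw'] := fan_pair_rays w'S.
have [|//|p1] := fan_separate wS ws hs rw'; first by rewrite w's ss.
have [|//|p2] := fan_separate w'S w's hs rw; first by rewrite ws ss.
by move: p2; rewrite wedgeC; lia.
Qed.

Lemma rays_collinear v v' : [fset v]%fset \in Sigma -> [fset v']%fset \in Sigma ->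
  wedge v v' = 0 -> v' = v \/ v' = - v.
Proof.
move=> vS v'S vv'.
have [w [_ vw]] := fan_neighbour vS (or_introl erefl).
have [w' [_ v'w']] := fan_neighbour v'S (or_introl erefl).
have e : v' = wedge v' w *: v by apply: wedge_line => //; rewrite wedgeC vv' oppr0.
move: v'w'; rewrite e wedgeZl => /eqP; move: (wedge v' w) (wedge v w') => a b ab.
have : a \is a GRing.unit by apply/unitrP; exists b; rewrite mulrC; split; apply/eqP.
by move=> /orP [/eqP ->|/eqP ->]; [left; rewrite scale1r|right; rewrite scaleN1r].
Qed.

(** The next ray counterclockwise for [s = 1], clockwise for [s = -1]. *)
Definition next (s : int) (v : Z2) : Z2 :=
  xget 0 [set w | [fset v; w]%fset \in Sigma /\ wedge v w = s].

Lemma nextP s v : [fset v]%fset \in Sigma -> s = 1 \/ s = -1 ->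
  [fset v; next s v]%fset \in Sigma /\ wedge v (next s v) = s.
Proof.
move=> vS hs; have [w [wS vw]] := fan_neighbour vS hs.
exact: (@xgetPex _ _ [set w | [fset v; w]%fset \in Sigma /\ wedge v w = s]
          (ex_intro _ w (conj wS vw))).
Qed.

Lemma next_ray s v : [fset v]%fset \in Sigma -> s = 1 \/ s = -1 ->
  [fset next s v]%fset \in Sigma.
Proof. by move=> vS hs; have [/fan_pair_rays []] := nextP vS hs. Qed.

Lemma nextK s v : [fset v]%fset \in Sigma -> s = 1 \/ s = -1 ->
  next (- s) (next s v) = v.
Proof.
move=> vS hs; have [pS pw] := nextP vS hs.
have hs' : - s = 1 \/ - s = -1 by case: hs => ->; [right|left].
have [qS qw] := nextP (next_ray vS hs) hs'.
apply: (fan_neighbour_uniq (s := - s)) qS _ hs' qw _.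
  by rewrite fsetUC.
by rewrite wedgeC pw.
Qed.

(** Every other ray of a cone containing [v] spans a cone with [v], so it is one of the two
    neighbours; both do not occur, as the cone is generated by part of a basis. *)
Lemma cone_of_ray (S : {fset Z2}) v : S \in Sigma -> v \in S ->
  [\/ S = [fset v]%fset, S = [fset v; next 1 v]%fset | S = [fset v; next (-1) v]%fset].
Proof.
move=> SS vS.
have rv : [fset v]%fset \in Sigma by apply: fan_face SS _; rewrite fsub1set.
have [[pS pw] [qS qw]] := (nextP rv (or_introl erefl), nextP rv (or_intror erefl)).
have sub u : u \in S -> u != v -> u = next 1 v \/ u = next (-1) v.
  move=> uS uv; have vuS : [fset v; u]%fset \in Sigma.
    by apply: fan_face SS _; apply/fsubsetP => z; rewrite !inE => /orP [/eqP->|/eqP->].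
  have [|e|e] := fan_pair_wedge vuS; first by rewrite eq_sym.
    by left; apply: (fan_neighbour_uniq vuS pS (or_introl erefl)).
  by right; apply: (fan_neighbour_uniq vuS qS (or_intror erefl)).
have nb : ~ (next 1 v \in S /\ next (-1) v \in S).
  move=> [p q]; have [b ub Sb] := fan_basis SS.
  have [[i vi] [[j pj] [l ql]]] := (Sb _ vS, (Sb _ p, Sb _ q)).
  move: pw qw; rewrite {1 3}vi pj ql.
  by case: (ord2P i) => ->; case: (ord2P j) => ->; case: (ord2P l) => ->; rewrite ?wedgexx // => ->.
have [p|p] := boolP (next 1 v \in S); [constructor 2|have [q|q] := boolP (next (-1) v \in S); [constructor 3|constructor 1]];
  apply/fsetP => u; rewrite !inE; apply/idP/idP.
- move=> uS; have [//|uv /=] := eqVneq u v; have [->//|e] := sub _ uS uv.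
  by case: nb; rewrite -e.
- by move=> /orP [/eqP ->|/eqP ->].
- move=> uS; have [//|uv /=] := eqVneq u v; have [e|-> //] := sub _ uS uv.
  by case: nb; rewrite -e.
- by move=> /orP [/eqP ->|/eqP ->].
- move=> uS; have [//|uv /=] := eqVneq u v.
  by have [e|e] := sub _ uS uv; move: p q; rewrite -?e uS.
- by move=> /eqP ->.
Qed.

Definition rays : seq Z2 :=
  undup [seq v <- flatten [seq enum_fset T | T <- enum_fset Sigma] | [fset v]%fset \in Sigma].

Lemma rays_uniq : uniq rays. Proof. exact: undup_uniq. Qed.

Lemma mem_rays v : (v \in rays) = ([fset v]%fset \in Sigma).
Proof.
rewrite mem_undup mem_filter andb_idr // => vS.
apply/flattenP; exists (enum_fset [fset v]%fset); last by rewrite inE.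
by apply: (map_f (fun T : {fset Z2} => enum_fset T)).
Qed.

End Fan.

(** * Coefficient functions of degree at most zero *)

Lemma seq_argmin (T : eqType) (f : T -> int) (s : seq T) x0 : x0 \in s ->
  exists2 m, m \in s & forall x, x \in s -> f m <= f x.
Proof.
elim: s x0 => // y s IH x0 _; case: s IH => [_|z s IH].
  by exists y; rewrite ?inE // => x; rewrite inE => /eqP ->.
have [|m ms mP] := IH z; first by rewrite inE eqxx.
have [le|/ltW le] := leP (f y) (f m).
  exists y; first by rewrite inE eqxx.
  by move=> x; rewrite inE => /orP [/eqP -> //|/mP]; exact: le_trans.
exists m; first by rewrite inE ms orbT.
by move=> x; rewrite inE => /orP [/eqP -> //|/mP].
Qed.

(** The rays of a complete nonsingular fan in cyclic order, together with the rays [w k] of the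
    divisors on which a point is blown up. On the toric surface [nx v + pv v] is [- d *: v] for
    the self-intersection [d] of the divisor of [v], and each blown-up point lowers this number
    by one; so [rc_rel] says that all proper transforms have self-intersection -2. By [rc_snx]
    and [rc_spv] there are no rays between neighbours. *)
Record ray_cycle (n : nat) (w : 'I_n -> Z2) (V : seq Z2) (nx pv : Z2 -> Z2) := RayCycle {
  rc_uniq : uniq V;
  rc_w : forall k, w k \in V;
  rc_nx : forall v, v \in V -> nx v \in V;
  rc_pv : forall v, v \in V -> pv v \in V;
  rc_nxK : forall v, v \in V -> pv (nx v) = v;
  rc_pvK : forall v, v \in V -> nx (pv v) = v;
  rc_wnx : forall v, v \in V -> wedge v (nx v) = 1;
  rc_rel : forall v, v \in V -> nx v + pv v = (2 - (\sum_(k < n) (w k == v))%:Z) *: v;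
  rc_snx : forall v v', v \in V -> v' \in V -> 0 < wedge v v' ->
             v' = nx v \/ 0 < wedge (nx v) v';
  rc_spv : forall v v', v \in V -> v' \in V -> 0 < wedge v' v ->
             v' = pv v \/ 0 < wedge v' (pv v);
  rc_line : forall v v', v \in V -> v' \in V -> wedge v v' = 0 -> v' = v \/ v' = - v }.

Section Cycle.
Variables (n : nat) (w : 'I_n -> Z2) (V : seq Z2) (nx pv : Z2 -> Z2).
Hypothesis cyc : ray_cycle w V nx pv.
Local Notation mult v := (\sum_(k < n) (w k == v))%N.

Lemma wedge_pv v : v \in V -> wedge v (pv v) = -1.
Proof.
move=> vV; rewrite wedgeC -{2}(rc_pvK cyc vV) (rc_wnx cyc) //; exact: rc_pv cyc _ vV.
Qed.

Lemma sum_nx (R : nmodType) (f : Z2 -> R) : \sum_(v <- V) f (nx v) = \sum_(v <- V) f v.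
Proof.
rewrite -(big_map nx predT f) /=; apply: perm_big; apply: uniq_perm.
- rewrite map_inj_in_uniq ?(rc_uniq cyc) // => u v uV vV /(congr1 pv).
  by rewrite !(rc_nxK cyc).
- exact: rc_uniq cyc.
- move=> v; apply/mapP/idP => [[u uV ->]|vV]; first exact: rc_nx cyc _ uV.
  by exists (pv v); rewrite ?(rc_pv cyc) ?(rc_pvK cyc).
Qed.

Lemma sum_pv (R : nmodType) (f : Z2 -> R) : \sum_(v <- V) f (pv v) = \sum_(v <- V) f v.
Proof.
rewrite -(sum_nx (fun v => f (pv v))); rewrite big_seq [RHS]big_seq.
by apply: eq_bigr => v vV; rewrite (rc_nxK cyc).
Qed.

Lemma prod_pv (R : comNzRingType) (f : Z2 -> R) : \prod_(v <- V) f (pv v) = \prod_(v <- V) f v.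
Proof.
rewrite -[LHS](big_map pv predT f) /=; apply: perm_big; apply: uniq_perm.
- rewrite map_inj_in_uniq ?(rc_uniq cyc) // => u v uV vV /(congr1 nx).
  by rewrite !(rc_pvK cyc).
- exact: rc_uniq cyc.
- move=> v; apply/mapP/idP => [[u uV ->]|vV]; first exact: rc_pv cyc _ uV.
  by exists (nx v); rewrite ?(rc_nx cyc) ?(rc_nxK cyc).
Qed.

Lemma sum_by_ray (R : nmodType) (f : 'I_n -> R) :
  \sum_(v <- V) \sum_(k < n | w k == v) f k = \sum_(k < n) f k.
Proof.
under eq_bigr => v _ do rewrite big_mkcond.
rewrite exchange_big; apply: eq_bigr => k _ /=.
rewrite (bigD1_seq (w k)) ?(rc_w cyc) ?(rc_uniq cyc) //= eqxx big1 ?addr0 //.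
by move=> v; rewrite eq_sym => /negbTE ->.
Qed.

Lemma prod_by_ray (R : comNzRingType) (f : 'I_n -> R) :
  \prod_(v <- V) \prod_(k < n | w k == v) f k = \prod_(k < n) f k.
Proof.
under eq_bigr => v _ do rewrite big_mkcond.
rewrite exchange_big; apply: eq_bigr => k _ /=.
rewrite (bigD1_seq (w k)) ?(rc_w cyc) ?(rc_uniq cyc) //= eqxx big1 ?mulr1 //.
by move=> v; rewrite eq_sym => /negbTE ->.
Qed.

(** Going once around the cycle, [nx v], [pv v] and [v] have the same sum, so [rc_rel] leaves
    [\sum_v mult v *: v = 0]. *)
Lemma sum_w : \sum_(k < n) w k = 0.
Proof.
rewrite -(sum_by_ray w).
have e v : v \in V -> \sum_(k < n | w k == v) w k = 2%:Z *: v - (nx v + pv v).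
  move=> vV; rewrite (rc_rel cyc) // scalerBl opprB addrC subrK.
  rewrite (eq_bigr (fun=> v)) => [|k /eqP //].
  by rewrite sumr_const -sum1_card -big_mkcond /= -scaler_nat natz.
rewrite big_seq (eq_bigr _ e) -big_seq sumrB big_split /= (sum_nx (fun v => v)) (sum_pv (fun v => v)).
by rewrite -scaler_sumr -[2%:Z]/(1 + 1 : int) scalerDl scale1r subrr.
Qed.

(** ** The part of degree at most zero *)
Section Degree0.
Variables (F : fieldType) (xi : 'I_n -> F) (a : 'I_n -> int) (g : Z2 -> F) (supp : seq Z2).
Hypothesis gsupp : forall u, g u != 0 -> u \in supp.
Hypothesis xi_inj : forall k l, w k = w l -> xi k = xi l -> k = l.
Hypothesis xi_gen : forall r : 'I_n -> nat,
  \prod_(k < n) (- xi k) ^+ r k = 1 -> forall k, r k = 0%N.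

(** A Laurent polynomial that stays regular after a mutation is divisible, in level [j] of the
    mutation direction, by the power [order_at j] of the binomial of the mutation. *)
Definition order_at (j : int) : nat := absz (Num.max 0 (- j)).

(** The window [0 <= i < N] contains the support on the line through [u] in direction [w k], so
    that the values on this line are the coefficients of one polynomial. *)
Definition line_divisible k := forall (u : Z2) N,
  (forall i : int, g (u + i *: w k) != 0 -> 0 <= i < N%:Z) ->
  ('X - (xi k)%:P) ^+ order_at (a k + wedge u (w k)) %| \poly_(i < N) g (u + i%:Z *: w k).

Hypothesis gdiv : forall k, line_divisible k.

(** The part of the support of [g] where [wedge u v] is least lies on a segment of direction [v]
    with end points [s] and [s + l v], both in the support. *)
Definition is_face (s : Z2) (l : nat) v :=
  [/\ g s != 0, g (s + l%:Z *: v) != 0,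
      forall u, g u != 0 -> wedge s v <= wedge u v
    & forall u, g u != 0 -> wedge u v = wedge s v ->
        exists2 i : int, 0 <= i <= l%:Z & u = s + i *: v].

Lemma face_exists v u0 : v \in V -> g u0 != 0 -> exists sl : Z2 * nat, is_face sl.1 sl.2 v.
Proof.
move=> vV gu0.
pose S := [seq u <- supp | g u != 0].
have Sm u : (u \in S) = (g u != 0).
  by rewrite mem_filter; case: eqVneq => //= /gsupp.
have [m mS mP] := @seq_argmin _ (wedge^~ v) S u0 ltac:(by rewrite Sm).
pose S' := [seq u <- S | wedge u v == wedge m v].
have mS' : m \in S' by rewrite mem_filter eqxx.
have [s sS sP] := @seq_argmin _ (wedge^~ (nx v)) S' m mS'.
have [e eS eP] := @seq_argmin _ (wedge^~ (pv v)) S' m mS'.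
move: sS eS; rewrite !mem_filter => /and3P [/eqP sm gs _] /and3P [/eqP em ge _].
have line u : wedge u v = wedge m v -> u = s + wedge (u - s) (nx v) *: v.
  move=> um; rewrite -(wedge_line (rc_wnx cyc vV)); first by rewrite addrC subrK.
  by rewrite wedgeDl wedgeNl um sm subrr.
have pos u : g u != 0 -> wedge u v = wedge m v -> 0 <= wedge (u - s) (nx v).
  move=> gu um; rewrite wedgeDl wedgeNl subr_ge0; apply: sP.
  by rewrite mem_filter um eqxx Sm.
have lpos := pos _ ge em.
exists (s, absz (wedge (e - s) (nx v))); split=> //=.
- by rewrite gez0_abs // -line.
- by move=> u; rewrite sm -Sm; exact: mP.
move=> u gu; rewrite sm => um; exists (wedge (u - s) (nx v)); last exact: line.
rewrite pos // gez0_abs //.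
have : wedge e (pv v) <= wedge u (pv v) by apply: eP; rewrite mem_filter um eqxx Sm.
have linew x : wedge x v = wedge m v -> wedge x (pv v) = wedge s (pv v) - wedge (x - s) (nx v).
  by move=> xm; rewrite {1}(line _ xm) wedgeDl wedgeZl wedge_pv // mulrN1.
by rewrite (linew _ um) (linew _ em) lerD2l lerN2.
Qed.

Variable k0 : 'I_n.
Hypothesis asum : \sum_(k < n) a k <= 0.

(** The factors for different [k] on the same ray are coprime by [xi_inj]. *)
Lemma prod_XsubC_exp_dvd (r : 'I_n -> nat) (P : pred 'I_n) (p : {poly F}) v :
  (forall k, P k -> w k = v) ->
  (forall k, P k -> ('X - (xi k)%:P) ^+ r k %| p) ->
  \prod_(k < n | P k) ('X - (xi k)%:P) ^+ r k %| p.
Proof.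
move=> Pv hP; rewrite -big_filter.
have: {subset [seq k <- index_enum 'I_n | P k] <= P} by move=> k; rewrite mem_filter => /andP [].
have: uniq [seq k <- index_enum 'I_n | P k] by rewrite filter_uniq ?index_enum_uniq.
elim: [seq k <- _ | _] => [|k s IH] /=; first by rewrite big_nil dvd1p.
move=> /andP [ks us] sP; have Pk : P k by apply: sP; rewrite inE eqxx.
rewrite big_cons Gauss_dvdp ?hP //=.
  by apply: IH => // x xs; apply: sP; rewrite inE xs orbT.
rewrite big_seq; apply: (big_ind (coprimep _)); first exact: coprimep1.
  by move=> p1 p2 h1 h2; rewrite coprimepMr h1 h2.
move=> l ls; apply/coprimep_expl/coprimep_expr.
have Pl : P l by apply: sP; rewrite inE ls orbT.
rewrite coprimep_XsubC root_XsubC eq_sym; apply: contra ks => /eqP xkl.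
by rewrite (_ : k = l) //; apply: xi_inj; rewrite ?Pv.
Qed.

Lemma size_prod_XsubC_exp (r : 'I_n -> nat) (P : pred 'I_n) :
  size (\prod_(k < n | P k) ('X - (xi k)%:P) ^+ r k) = (\sum_(k < n | P k) r k).+1.
Proof.
elim/big_rec2: _ => [|k m p _ IH]; first by rewrite size_polyC oner_neq0.
by rewrite size_monicM ?monic_exp ?monicXsubC // -?size_poly_gt0 ?IH // size_exp_XsubC addnS.
Qed.

Lemma monic_prod_XsubC_exp (r : 'I_n -> nat) (P : pred 'I_n) :
  \prod_(k < n | P k) ('X - (xi k)%:P) ^+ r k \is monic.
Proof. by apply: monic_prod => k _; rewrite monic_exp ?monicXsubC. Qed.

(** Let [mu v] be the minimum of [wedge u v] over the support. The length [l v] of the face of [v]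
    is at least the sum of the orders [r k] with [w k = v], by divisibility, and it is bounded
    above in terms of [mu (nx v)], [mu v] and [mu (pv v)], by [rc_rel]. Summed over the cycle, the
    upper bounds exceed the lower ones by at most [\sum_k a k <= 0], so equality holds everywhere.
    Hence each face polynomial is a constant times the product of the ['X - xi k] to the powers
    [r k]. The faces form a closed polygon, so the ratios of first and last coefficients multiply
    to 1; this is a relation [\prod_k (- xi k) ^+ r k = 1], which forces [r = 0]. Then all faces
    are points, and [rc_rel] shows that they are the same point. *)
Theorem degree0_support u0 : g u0 != 0 ->
  (forall k, a k + wedge u0 (w k) = 0) /\ forall u, g u != 0 -> u = u0.
Proof.
move=> gu0.
have ch v : exists sl : Z2 * nat, v \in V -> is_face sl.1 sl.2 v.
  have [vV|] := boolP (v \in V); last by exists (0, 0%N).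
  by have [sl h] := face_exists vV gu0; exists sl.
have [f fP] := boolp.choice ch.
pose s v := (f v).1; pose l v := (f v).2; pose e v := s v + (l v)%:Z *: v.
pose mu v := wedge (s v) v.
pose r k := order_at (a k + mu (w k)).
have muP v u : v \in V -> g u != 0 -> mu v <= wedge u v by move=> /fP [_ _ h _]; exact: h.
have gs v : v \in V -> g (s v) != 0 by move=> /fP [].
have ge v : v \in V -> g (e v) != 0 by move=> /fP [].
have relw u v : v \in V -> wedge u (nx v) + wedge u (pv v) = (2 - (mult v)%:Z) * wedge u v.
  by move=> vV; rewrite -wedgeDr (rc_rel cyc) // wedgeZr.
pose p v := \poly_(i < (l v).+1) g (s v + i%:Z *: v).
have sp v : v \in V -> size (p v) = (l v).+1.
  by move=> vV; rewrite size_poly_eq //=; exact: ge.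
have dp v : v \in V -> \prod_(k < n | w k == v) ('X - (xi k)%:P) ^+ r k %| p v.
  move=> vV; apply: (@prod_XsubC_exp_dvd _ _ _ v) => k /eqP //= wk.
  have := @gdiv k (s v) (l v).+1; rewrite wk /r /mu wk; apply => i gi.
  have [_ _ _ /(_ _ gi)] := fP _ vV; case=> [|j hj].
    by rewrite wedgeDl wedgeZl wedgexx mulr0 addr0.
  move=> /addrI /(congr1 (wedge^~ (nx v))); rewrite /= !wedgeZl (rc_wnx cyc) // !mulr1 => ->.
  by move: hj; rewrite /l; lia.
have b1 v : v \in V -> (\sum_(k < n | w k == v) r k <= l v)%N.
  move=> vV; have := dvdp_leq _ (dp v vV); rewrite size_prod_XsubC_exp sp //.
  by apply; rewrite -size_poly_gt0 sp.
have rge k : - (a k + mu (w k)) <= (r k)%:Z by rewrite /r /order_at; lia.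
pose D v := \sum_(k < n | w k == v) ((r k)%:Z + (a k + mu v)).
pose A v := \sum_(k < n | w k == v) a k.
have D0 k : 0 <= (r k)%:Z + (a k + mu (w k)) by move: (rge k); lia.
have Dge v : 0 <= D v by apply: sumr_ge0 => k /eqP <-.
have DE v : D v = (\sum_(k < n | w k == v) r k)%N%:Z + A v + (mult v)%:Z * mu v.
  rewrite /D /A big_split /= big_split /= addrA; congr (_ + _ + _).
    by rewrite (big_morph Posz PoszD (erefl (Posz 0))).
  rewrite sumr_const -big_mkcond /= sum1_card; move: #|_| => m.
  by rewrite -mulr_natl natz.
have b3 v : v \in V -> mu (nx v) <= wedge (s v) (nx v) by move=> vV; apply: muP; rewrite ?gs ?(rc_nx cyc).
have b4 v : v \in V -> mu (pv v) <= wedge (e v) (pv v) by move=> vV; apply: muP; rewrite ?ge ?(rc_pv cyc).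
have ev v : v \in V -> wedge (e v) (pv v) = wedge (s v) (pv v) - (l v)%:Z.
  by move=> vV; rewrite wedgeDl wedgeZl wedge_pv // mulrN1.
have relx v : v \in V -> wedge (s v) (nx v) + wedge (s v) (pv v)
    = 2 * mu v - (mult v)%:Z * mu v by move=> vV; rewrite relw // mulrBl.
pose E v := A v + (2 * mu v - mu (nx v) - mu (pv v)).
have DlE v : v \in V -> D v <= E v.
  move=> vV; have [[[[h1 h2] h3] h4] h5] := (b1 v vV, b3 v vV, b4 v vV, ev v vV, relx v vV).
  by rewrite DE /E; move: h1; rewrite -lez_nat; lia.
(* The contributions of [mu] cancel around the cycle. *)
have sumE : \sum_(v <- V) E v <= 0.
  have -> : \sum_(v <- V) E v = \sum_(k < n) a k + (2 * (\sum_(v <- V) mu v)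
      - \sum_(v <- V) mu (nx v) - \sum_(v <- V) mu (pv v)).
    by rewrite -[in RHS]sum_by_ray mulr_sumr -!sumrB -big_split.
  by rewrite (sum_nx mu) (sum_pv mu) mulr_natl mulr2n addrK subrr addr0.
have E0 v : v \in V -> E v = 0.
  move=> vV; apply/eqP; rewrite eq_le (le_trans (Dge v) (DlE v vV)) andbT.
  apply: le_trans sumE; rewrite (bigD1_seq v) ?(rc_uniq cyc) //= lerDl.
  rewrite big_seq_cond; apply: sumr_ge0 => x /andP [xV _].
  exact: le_trans (Dge x) (DlE x xV).
have Dv0 v : v \in V -> D v = 0.
  by move=> vV; apply/eqP; rewrite eq_le Dge -(E0 v vV) DlE.
have rE k : (r k)%:Z = - (a k + mu (w k)).
  have := Dv0 _ (rc_w cyc k); rewrite /D (bigD1 k) //= => /eqP.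
  rewrite paddr_eq0 ?D0 //.
    by move=> /andP [/eqP h _]; move: h; lia.
  by apply: sumr_ge0 => j /andP [/eqP <- _].
have facts v : v \in V -> [/\ (\sum_(k < n | w k == v) r k = l v)%N,
     wedge (s v) (nx v) = mu (nx v) & wedge (e v) (pv v) = mu (pv v)].
  move=> vV; have [[[[h1 h2] h3] h4] h5] := (b1 v vV, b3 v vV, b4 v vV, ev v vV, relx v vV).
  have := E0 v vV; have := Dv0 v vV; rewrite DE /E => q1 q2.
  move: h1; rewrite -lez_nat => h1.
  split; [|lia|lia].
  by apply/eqP; rewrite -eqz_nat; lia.
(* The face of [pv v] starts where the face of [v] ends. *)
have send v : v \in V -> s (pv v) = e v.
  move=> vV; have pV := rc_pv cyc vV; have [_ _ h] := facts v vV.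
  have [_ _ _ /(_ _ (ge _ vV) h)] := fP _ pV; case=> i hi es.
  have := congr1 (wedge^~ v) es; rewrite !wedgeE mulr0 addr0 (wedgeC (pv v) v) wedge_pv //.
  have := muP v _ vV (gs _ pV); rewrite -/(mu v) -/(s (pv v)) opprK mulr1 => h1 h2.
  have i0 : i = 0 by move: hi h1 h2; rewrite /mu; lia.
  by rewrite es i0 scale0r addr0.
(* The first coefficient of a face polynomial is its value at 0. *)
have prodv v : v \in V -> g (s v) = g (e v) * \prod_(k < n | w k == v) (- xi k) ^+ r k.
  move=> vV; set q := \prod_(k < n | w k == v) ('X - (xi k)%:P) ^+ r k.
  have lq : lead_coef (p v) = g (e v) by rewrite lead_coefE sp //= coef_poly ltnSn.
  have pq : p v = g (e v) *: q.
    have /eqpP [[c1 c2] /= /andP [c1n c2n] cc] : q %= p v.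
      rewrite -dvdp_size_eqp ?dp // size_prod_XsubC_exp sp //.
      by have [-> _ _] := facts v vV.
    have lc := congr1 lead_coef cc; rewrite !lead_coefZ lq (monicP (monic_prod_XsubC_exp _ _)) mulr1 in lc.
    by apply: (scalerI c2n); rewrite -cc scalerA lc.
  have : (p v).[0] = g (s v) by rewrite horner_coef0 coef_poly /= scale0r addr0.
  rewrite pq hornerZ horner_prod => <-; congr (_ * _); apply: eq_bigr => k _.
  by rewrite horner_exp hornerXsubC sub0r.
have r0 k : r k = 0%N.
  have prodse : \prod_(v <- V) g (s v) = \prod_(v <- V) g (e v).
    rewrite -(prod_pv (fun v => g (s v))) big_seq [RHS]big_seq.
    by apply: eq_bigr => v vV; rewrite send.
  apply: xi_gen k; apply: (@mulfI _ (\prod_(v <- V) g (e v))).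
    by rewrite -prodse prodf_seq_neq0; apply/allP => v vV /=; exact: gs.
  rewrite mulr1 -[RHS]prodse -prod_by_ray -big_split /= big_seq [RHS]big_seq.
  by apply: eq_bigr => v vV; rewrite prodv.
have l0 v : v \in V -> l v = 0%N.
  by move=> vV; have [<- _ _] := facts v vV; rewrite big1.
have pos u v : v \in V -> g u != 0 -> 0 <= wedge u v - mu v.
  by move=> vV gu; rewrite subr_ge0 muP.
have mu_rel v : v \in V -> mu (nx v) + mu (pv v) = (2 - (mult v)%:Z) * mu v.
  move=> vV; have [_ h1 h2] := facts v vV.
  by rewrite -h1 -h2 /e l0 // scale0r addr0 relw.
have delta u v : g u != 0 -> v \in V ->
    (mult v)%:Z * (wedge u v - mu v) = 2 * (wedge u v - mu v)
      - (wedge u (nx v) - mu (nx v)) - (wedge u (pv v) - mu (pv v)).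
  by move=> gu vV; move: (relw u v vV) (mu_rel v vV); rewrite !mulrBl !mulrBr; lia.
(* The terms are nonnegative, and by [delta] their sum over the cycle is 0. *)
have delta0 u v : g u != 0 -> v \in V -> (mult v)%:Z * (wedge u v - mu v) = 0.
  move=> gu vV; apply/eqP; rewrite eq_le mulr_ge0 ?pos // andbT.
  have <- : \sum_(v <- V) (mult v)%:Z * (wedge u v - mu v) = 0.
    rewrite big_seq (eq_bigr _ (fun v => delta u v gu)) -big_seq.
    pose d x := wedge u x - mu x.
    transitivity (2 * (\sum_(v <- V) d v) - \sum_(v <- V) d (nx v) - \sum_(v <- V) d (pv v)).
      by rewrite mulr_sumr -!sumrB.
    by rewrite (sum_nx d) (sum_pv d) mulr_natl mulr2n addrK subrr.
  rewrite [leRHS](bigD1_seq v) ?(rc_uniq cyc) //= lerDl.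
  by rewrite big_seq_cond; apply: sumr_ge0 => x /andP [xV _]; rewrite mulr_ge0 ?pos.
have wk0 u k : g u != 0 -> wedge u (w k) = mu (w k).
  move=> gu; have := delta0 u (w k) gu (rc_w cyc k); have := pos u (w k) (rc_w cyc k) gu.
  rewrite (bigD1 k) //= eqxx; move: (\sum_(i < n | _) _)%N => m h /eqP.
  by rewrite mulf_eq0 => /orP [/eqP|/eqP]; lia.
split=> [k|u gu]; first by rewrite wk0 //; move: (rE k); rewrite r0; lia.
have wV := rc_w cyc k0.
have nx0 u' : g u' != 0 -> wedge u' (nx (w k0)) = mu (nx (w k0)).
  move=> gu'; have := delta u' (w k0) gu' wV; rewrite delta0 // (wk0 u') // subrr mulr0.
  by move: (pos u' _ (rc_nx cyc wV) gu') (pos u' _ (rc_pv cyc wV) gu'); lia.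
rewrite (wedge_basis u (rc_wnx cyc wV)) (wedge_basis u0 (rc_wnx cyc wV)).
by rewrite !(wedgeC (w k0)) !wk0 // !nx0.
Qed.
End Degree0.
End Cycle.

(** * Coefficient functions of degree one *)

Section Subring.
Variables (F : fieldType) (C : set F).
Hypothesis ringC : is_subring C.

Lemma subring1 : C 1. Proof. by case: ringC. Qed.
Lemma subringB x y : C x -> C y -> C (x - y). Proof. by case: ringC => _ h _; exact: h. Qed.
Lemma subringM x y : C x -> C y -> C (x * y). Proof. by case: ringC => _ _ h; exact: h. Qed.
Lemma subring0 : C 0.
Proof. by rewrite -(subrr 1); apply: subringB; exact: subring1. Qed.
Lemma subringN x : C x -> C (- x).
Proof. by move=> Cx; rewrite -sub0r; apply: subringB => //; exact: subring0. Qed.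
Lemma subringD x y : C x -> C y -> C (x + y).
Proof. by move=> Cx Cy; rewrite -[y]opprK; apply: subringB => //; exact: subringN. Qed.
Lemma subringX x n : C x -> C (x ^+ n).
Proof. by move=> Cx; elim: n => [|n IH]; rewrite ?expr0 ?exprS; [exact: subring1|exact: subringM]. Qed.
Lemma subring_nat n : C n%:R.
Proof. by elim: n => [|n IH]; [exact: subring0|rewrite -natr1; apply: subringD => //; exact: subring1]. Qed.
Lemma subring_sum (I : Type) (r : seq I) (P : pred I) (f : I -> F) :
  (forall i, P i -> C (f i)) -> C (\sum_(i <- r | P i) f i).
Proof. by move=> h; apply: (big_ind C) => //; [exact: subring0|exact: subringD]. Qed.

(** Elimination without division: when [L y p0] is not zero, the equation [y] multiplied by
    [L z p0] is subtracted from [L y p0] times the equation [z], so all coefficients stay in the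
    subring. *)
Lemma linear_solution (T E : eqType) (L : E -> T -> F) (e : seq E) (pts : seq T) :
  uniq pts -> (size e < size pts)%N -> (forall y p, y \in e -> C (L y p)) ->
  exists x : T -> F, [/\ forall p, C (x p), exists2 p, p \in pts & x p != 0,
    forall p, p \notin pts -> x p = 0
    & forall y, y \in e -> \sum_(p <- pts) x p * L y p = 0].
Proof.
elim: e pts L => [|y e IH] pts L up /= sz CL.
  case: pts up sz => [//|p0 pts] _ _.
  exists (fun p => (p == p0)%:R); split=> //.
  - by move=> p; exact: subring_nat.
  - by exists p0; rewrite ?inE eqxx ?oner_neq0.
  - by move=> p; rewrite inE negb_or => /andP [/negbTE -> _].
have CLe z p : z \in e -> C (L z p) by move=> ze; apply: CL; rewrite inE ze orbT.
have CLy p : C (L y p) by apply: CL; rewrite inE eqxx.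
have [/hasP [p0 p0s ne]|/hasPn zero] := boolP (has (fun p => L y p != 0) pts); last first.
  have [x [x1 x2 x3 x4]] := IH pts L up (ltnW sz) CLe; exists x; split=> // z.
  rewrite inE => /orP [/eqP ->|]; last exact: x4.
  rewrite big_seq big1 // => p ps; have /negPn/eqP -> := zero p ps.
  by rewrite mulr0.
have [|||x [x1 x2 x3 x4]] := IH (rem p0 pts) (fun z p => L y p0 * L z p - L z p0 * L y p).
- exact: rem_uniq.
- by rewrite size_rem //; case: (pts) sz p0s.
- by move=> z p ze; apply: subringB; apply: subringM; auto.
have nrem : p0 \notin rem p0 pts by rewrite mem_rem_uniqF.
pose x' p := if p == p0 then - \sum_(q <- rem p0 pts) x q * L y q else L y p0 * x p.
have sumx z : \sum_(p <- pts) x' p * L z p =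
    \sum_(q <- rem p0 pts) x q * (L y p0 * L z q - L z p0 * L y q).
  rewrite (perm_big _ (perm_to_rem p0s)) big_cons {1}/x' eqxx /=.
  rewrite mulNr mulr_suml addrC -sumrB; apply: eq_big_seq => q qs.
  rewrite /x' (_ : (q == p0) = false); first by ring.
  by apply/negP => /eqP qp; move: nrem; rewrite -{1}qp qs.
exists x'; split.
- move=> p; rewrite /x'; case: ifP => _; last exact: subringM.
  by apply: subringN; apply: subring_sum => q _; exact: subringM.
- case: x2 => p ps px; exists p; first exact: mem_rem ps.
  rewrite /x' (_ : (p == p0) = false) ?mulf_neq0 //.
  by apply/negP => /eqP pp; move: nrem; rewrite -{1}pp ps.
- move=> p ps; rewrite /x' x3 ?mulr0; last by apply: contra ps; exact: mem_rem.
  by case: eqP => // pp; move: ps; rewrite pp p0s.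
- move=> z; rewrite inE sumx => /orP [/eqP ->|]; last exact: x4.
  by rewrite big1 // => q _; rewrite subrr mulr0.
Qed.

Lemma subring_coef_shift xi i l : C xi -> C (('X + xi%:P) ^+ i)`_l.
Proof.
move=> Cx; elim: i l => [|i IH] l; first by rewrite expr0 coef1; exact: subring_nat.
rewrite exprSr mulrDr coefD coefMX coefMC; apply: subringD; last exact: subringM.
by case: ifP => _; [exact: subring0|exact: IH].
Qed.

End Subring.

Lemma dvdp_XsubC_exp (F : fieldType) (xi : F) (r : nat) (p : {poly F}) :
  (forall l, (l < r)%N -> (p \Po ('X + xi%:P))`_l = 0) -> ('X - xi%:P) ^+ r %| p.
Proof.
move=> h; set q := p \Po _ in h.
have -> : p = q \Po ('X - xi%:P).
  by rewrite -comp_polyA comp_polyD comp_polyX comp_polyC subrK comp_polyXr.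
rewrite -(poly_take_drop r q) (_ : take_poly r q = 0); last first.
  by apply/polyP => i; rewrite coef_take_poly coef0; case: ifP => // /h.
by rewrite add0r comp_polyM comp_Xn_poly dvdp_mull.
Qed.

Section Points.
Variables (n : nat) (w : 'I_n -> Z2) (V : seq Z2) (nx pv : Z2 -> Z2).
Hypothesis cyc : ray_cycle w V nx pv.
Local Notation mult v := (\sum_(k < n) (w k == v))%N.

Lemma nx_rel u v : v \in V ->
  wedge u (nx v) + wedge u (pv v) = (2 - (mult v)%:Z) * wedge u v.
Proof. by move=> vV; rewrite -wedgeDr (rc_rel cyc) // wedgeZr. Qed.

(** Where [wedge u] is negative it is convex along the cycle, as [rc_rel] gives second differences
    [- mult v * wedge u v >= 0]. So once it does not decrease it goes on like this until [v'].
    The induction is on the number of rays between [v] and [v']. *)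
Lemma climb u v v' : v \in V -> v' \in V -> 0 < wedge v v' ->
  wedge u v < 0 -> wedge u v' < 0 -> wedge u v <= wedge u (nx v) ->
  wedge u v <= wedge u v' /\ wedge u (pv v') <= wedge u v'.
Proof.
have [N] := ubnP (count (fun x => (0 < wedge v x) && (0 < wedge x v')) V).
elim: N v => // N IH v cN vV v'V vv' uv uv' unx.
have [e|pos] := rc_snx cyc vV v'V vv'; first by rewrite e (rc_nxK cyc).
have nV := rc_nx cyc vV; have wn := rc_wnx cyc vV.
have neg : wedge u (nx v) < 0.
  have := congr1 (wedge u) (wedge_expand v v' (nx v)).
  rewrite wn scale1r wedgeDr !wedgeZr => e; rewrite -(pmulr_rlt0 _ vv') e.
  have : wedge (nx v) v' * wedge u v < 0 by rewrite pmulr_rlt0.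
  by move: uv'; lia.
have conv : wedge u (nx v) <= wedge u (nx (nx v)).
  have := nx_rel u nV; rewrite (rc_nxK cyc) // mulrBl.
  have : (mult (nx v))%:Z * wedge u (nx v) <= 0 by rewrite nmulr_lle0.
  by move: unx; lia.
have [|h1 h2] := IH (nx v) _ nV v'V pos neg uv' conv; last by split=> //; exact: le_trans h1.
rewrite ltnS in cN; apply: leq_trans cN.
pose P' x := (0 < wedge (nx v) x) && (0 < wedge x v').
apply: (@leq_trans (count P' V + count (pred1 (nx v)) V)).
  by rewrite count_uniq_mem ?(rc_uniq cyc) // nV addn1.
rewrite -count_predUI [X in (_ + X <= _)%N](_ : _ = 0%N) ?addn0; last first.
  apply: (etrans _ (count_pred0 V)); apply: eq_count => x /=.
  by apply/negP => /andP [/andP [h _] /eqP e]; move: h; rewrite e wedgexx.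
apply: sub_count => x /orP [/andP [h1 h2]|/eqP ->]; last by rewrite wn pos.
rewrite h2 andbT; have := congr1 (wedge v) (wedge_expand (nx v) v' x).
rewrite wedgeDr !wedgeZr wn mulr1 => e.
have : 0 < wedge (nx v) v' * wedge v x by rewrite e ltr_pwDl // mulr_ge0 // ltW.
by rewrite pmulr_rgt0.
Qed.

Definition local_min u v := [/\ wedge u v < 0, wedge u v <= wedge u (nx v)
  & wedge u v < wedge u (pv v)].

(** Compare with a ray where [wedge u] is least, going around the cycle in the direction in
    which the two rays are less than half a turn apart. *)
Lemma local_min_global u v v' : v \in V -> v' \in V -> local_min u v ->
  wedge u v <= wedge u v'.
Proof.
move=> vV v'V [uv unx upv].
have [m mV mP] := @seq_argmin _ (wedge u) V v vV.
apply: le_trans (mP _ v'V).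
have um : wedge u m < 0 by exact: le_lt_trans (mP _ vV) uv.
have [e|vm] := eqVneq (wedge v m) 0.
  by have [->|mN] := rc_line cyc vV mV e => //; move: um; rewrite mN wedgeNr; lia.
have [pos|neg] := ltP 0 (wedge v m).
  by have [] := climb vV mV pos uv um unx.
have pos : 0 < wedge m v by rewrite wedgeC; lia.
have [_] := climb mV vV pos um uv (mP _ (rc_nx cyc mV)).
by move: upv; lia.
Qed.

Lemma local_min_uniq u v v' : v \in V -> v' \in V -> local_min u v -> local_min u v' -> v = v'.
Proof.
move=> vV v'V [uv unx upv] [uv' unx' upv'].
have [e|vm] := eqVneq (wedge v v') 0.
  by have [->|mN] := rc_line cyc vV v'V e => //; move: uv'; rewrite mN wedgeNr; lia.
have [pos|neg] := ltP 0 (wedge v v').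
  by have [_] := climb vV v'V pos uv uv' unx; move: upv'; lia.
have pos : 0 < wedge v' v by rewrite wedgeC; lia.
by have [_] := climb v'V vV pos uv' uv unx'; move: upv; lia.
Qed.

(** The lattice points on the boundary of the [j]-th multiple of the anticanonical polygon,
    on the edge dual to [v]. *)
Definition bpoint (j : nat) (v : Z2) (i : nat) : Z2 := j%:Z *: (nx v - v) + i%:Z *: v.

Lemma bpoint_wedge j v i : v \in V ->
  [/\ wedge (bpoint j v i) v = - j%:Z, wedge (bpoint j v i) (nx v) = i%:Z - j%:Z
    & wedge (bpoint j v i) (pv v) = (j * mult v)%N%:Z - i%:Z - j%:Z].
Proof.
move=> vV; have wn := rc_wnx cyc vV.
have w1 : wedge (bpoint j v i) v = - j%:Z.
  by rewrite /bpoint !wedgeE (wedgeC _ v) wn; ring.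
have w2 : wedge (bpoint j v i) (nx v) = i%:Z - j%:Z.
  by rewrite /bpoint !wedgeE wn; ring.
split=> //; have := nx_rel (bpoint j v i) vV; rewrite w1 w2 PoszM mulrBl mulrN.
lia.
Qed.

Lemma bpoint_local_min j v i : v \in V -> (0 < j)%N -> (i < j * mult v)%N ->
  local_min (bpoint j v i) v.
Proof. by move=> vV j0 ij; have [w1 w2 w3] := bpoint_wedge j i vV; split; lia. Qed.

Definition bindices (m : nat) : seq (nat * Z2 * nat) :=
  [seq (jv, i) | jv <- [seq (j, v) | j <- iota 1 m, v <- V], i <- iota 0 (jv.1 * mult jv.2)].

Definition bpoints (m : nat) : seq Z2 :=
  0 :: [seq bpoint p.1.1 p.1.2 p.2 | p <- bindices m].

Lemma mem_bindices m j v i : (j, v, i) \in bindices m ->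
  [/\ (0 < j <= m)%N, v \in V & (i < j * mult v)%N].
Proof.
move=> /allpairsPdep [[j' v'] [i' [jvP iP [-> -> ->]]]].
move: jvP iP => /allpairsP [[j1 v1] [/= jP vV [-> ->]]]; rewrite !mem_iota in jP * => iP.
by split=> //; lia.
Qed.

Lemma bpointP m u : u \in bpoints m -> u != 0 -> exists j v i,
  [/\ (0 < j <= m)%N, v \in V, (i < j * mult v)%N & u = bpoint j v i].
Proof.
rewrite inE => /orP [/eqP -> /eqP //|/mapP [[[j v] i] /mem_bindices [jm vV ij] ->]] _.
by exists j, v, i.
Qed.

Lemma bpoints_ge m u v : u \in bpoints m -> v \in V -> - m%:Z <= wedge u v.
Proof.
have [->|u0] := eqVneq u 0; first by rewrite wedge0l; lia.
move=> /bpointP /(_ u0) [j [x [i [jm xV ij e]]]] vV.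
have j0 : (0 < j)%N by lia.
have := local_min_global xV vV (bpoint_local_min xV j0 ij).
by have [-> _ _] := bpoint_wedge j i xV; rewrite -e; lia.
Qed.

Lemma size_bpoints m : size (bpoints m) = (\sum_(1 <= j < m.+1) j * n).+1.
Proof.
rewrite /bpoints /= size_map size_allpairs_dep; congr S.
rewrite sumnE big_map big_allpairs /index_iota subSS subn0; apply: eq_bigr => j _ /=.
under eq_bigr => v _ do rewrite size_iota.
rewrite -big_distrr /=; congr (_ * _)%N.
rewrite exchange_big /= -[RHS](card_ord n) -sum1_card; apply: eq_bigr => k _.
rewrite (bigD1_seq (w k)) ?(rc_w cyc) ?(rc_uniq cyc) //= eqxx big1 // => v.
by rewrite eq_sym => /negbTE ->.
Qed.

Lemma bindices_uniq m : uniq (bindices m).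
Proof.
apply: allpairs_uniq_dep.
- by apply: allpairs_uniq; [exact: iota_uniq|exact: rc_uniq cyc|move=> [? ?] [? ?] _ _ [-> ->]].
- by move=> *; exact: iota_uniq.
- by move=> [a b] [c d] _ _ [-> ->].
Qed.

(** From a boundary point [u] one recovers [v] as the only local minimum of [wedge u] on the
    cycle, and [j] as minus the value there. *)
Lemma bpoints_uniq m : uniq (bpoints m).
Proof.
rewrite /bpoints /=; apply/andP; split.
  apply/negP => /mapP [[[j v] i] /mem_bindices [jm vV ij] /= e].
  by have [] := bpoint_wedge j i vV; rewrite -e wedge0l; lia.
rewrite map_inj_in_uniq ?bindices_uniq // => -[[j v] i] [[j' v'] i'].
move=> /mem_bindices [jm vV ij] /mem_bindices [jm' vV' ij'] /= e.
have [j0 j0'] : (0 < j)%N /\ (0 < j')%N by lia.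
have := bpoint_local_min vV' j0' ij'; rewrite -e => l'.
have l := bpoint_local_min vV j0 ij.
have vv := local_min_uniq vV vV' l l'; rewrite -vv in e *.
have [w1 w2 _] := bpoint_wedge j i vV; have [w1' w2' _] := bpoint_wedge j' i' vV.
have jj : j = j' by move: w1 w1'; rewrite e; lia.
by move: w2 w2'; rewrite e -jj => h h'; congr (_, _, _); lia.
Qed.

(** ** Linear systems of sections *)
Section Sections.
Variables (F : fieldType) (C : set F) (xi : 'I_n -> F) (k0 : 'I_n).
Hypothesis ringC : is_subring C.
Hypothesis Cxi : forall k, C (xi k).

(** The shift by [K] makes the index on the line nonnegative. *)
Definition line_index (K : nat) (k : 'I_n) (u : Z2) : nat := absz (wedge u (nx (w k)) + K%:Z).

Definition level_poly (pts : seq Z2) (g : Z2 -> F) K k (j : int) : {poly F} :=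
  \sum_(u <- pts | wedge u (w k) == j) g u *: 'X^(line_index K k u).

(** The left hand sum counts conditions: [j] at level [- j] for each index, but one less for [k0].
    So there are [m] fewer than boundary points of the first [m] multiples of the polygon. *)
Lemma sum_nat_delta (d : 'I_n -> nat) m : (forall k, d k = (k == k0) :> nat) ->
  (\sum_(k < n) \sum_(1 <= j < m.+1) (j - d k) + m = \sum_(1 <= j < m.+1) j * n)%N.
Proof.
move=> hd; rewrite (bigD1 k0) //= hd eqxx addnAC -[nat_of_bool true]/1%N.
have -> : (\sum_(1 <= j < m.+1) (j - 1) + m = \sum_(1 <= j < m.+1) j)%N.
  elim: m => [|m IH]; first by rewrite !big_geq.
  by rewrite big_nat_recr //= [RHS]big_nat_recr //= -IH; lia.
rewrite (eq_bigr (fun _ : 'I_n => \sum_(1 <= j < m.+1) j)%N); last first.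
  by move=> k /negbTE kk; rewrite hd kk; apply: eq_bigr => j _; rewrite subn0.
rewrite sum_nat_const cardC1 card_ord -big_distrl /= mulnC -mulnS prednK //.
by case: (n) k0 => [[]|].
Qed.

(** Even after the vanishing on [S] is added, the conditions are fewer than the [size_bpoints]
    unknowns, because the shift by [k == k0] lowers one order at each of the levels [-1, .., -m]. *)
Lemma sections_exist (K m : nat) (S : seq Z2) : (size S <= m)%N -> exists g : Z2 -> F,
  [/\ forall u, C (g u), exists2 u, u \in bpoints m & g u != 0,
      forall u, u \in S -> g u = 0, forall u, u \notin bpoints m -> g u = 0
    & forall k j, ('X - (xi k)%:P) ^+ order_at ((k == k0)%:Z + j)
        %| level_poly (bpoints m) g K k j].
Proof.
move=> Sm.
pose d k : nat := (k == k0).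
pose e1 : seq ('I_n * nat * nat) :=
  [seq (kj, l) | kj <- [seq (k, j) | k <- enum 'I_n, j <- iota 1 m], l <- iota 0 (kj.2 - d kj.1)].
pose e : seq ('I_n * nat * nat + Z2) := map inl e1 ++ map inr S.
(* [inl (k, j, l)]: the coefficient of ['X^l] in the polynomial of level [- j], after moving its
   root [xi k] to 0, vanishes; [inr s]: the value at [s] vanishes. *)
pose L (y : 'I_n * nat * nat + Z2) (u : Z2) : F := match y with
  | inl kjl => if wedge u (w kjl.1.1) == - kjl.1.2%:Z
               then (('X + (xi kjl.1.1)%:P) ^+ line_index K kjl.1.1 u)`_kjl.2 else 0
  | inr s => (u == s)%:R end.
have se : (size e < size (bpoints m))%N.
  rewrite size_cat !size_map size_bpoints ltnS size_allpairs_dep sumnE big_map big_allpairs.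
  rewrite big_enum /= -(@sum_nat_delta d m) // leq_add //.
  by rewrite leq_eqVlt; apply/orP; left; apply/eqP; apply: eq_bigr => k _;
    rewrite /index_iota subSS subn0; apply: eq_bigr => j _; rewrite size_iota.
have [|x [x1 [u ub xu] x3 x4]] := linear_solution ringC (L := L) (bpoints_uniq m) se.
  move=> [[[k j] l]|s] u _ /=; last exact: subring_nat.
  by case: ifP => _; [exact: subring_coef_shift|exact: subring0].
exists x; split=> //; first by exists u.
  move=> s sS; have [sp|] := boolP (s \in bpoints m); last exact: x3.
  have /x4 : inr s \in e by rewrite mem_cat map_f ?orbT.
  rewrite (bigD1_seq s) ?bpoints_uniq //= eqxx mulr1 big1 ?addr0 // => z /negbTE ->.
  by rewrite mulr0.
move=> k j.
have [jm|jm] := ltP j (- m%:Z).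
  rewrite /level_poly big_seq_cond big1 ?dvdp0 // => z /andP [zb /eqP zj].
  by have := bpoints_ge zb (rc_w cyc k); rewrite zj; lia.
have [j0|j0] := leP 0 j.
  by rewrite (_ : order_at _ = 0%N) ?expr0 ?dvd1p //; rewrite /order_at; case: (k == k0); lia.
apply: dvdp_XsubC_exp => l lo.
have : inl (k, absz j, l) \in e.
  rewrite mem_cat map_f //; apply/allpairsPdep; exists (k, absz j), l; split=> //.
    by apply/allpairsP; exists (k, absz j); rewrite mem_enum mem_iota; split=> //=; lia.
  by move: lo; rewrite mem_iota /order_at /d /=; case: (k == k0); lia.
move=> /x4 xe; apply: (etrans _ xe); rewrite /level_poly.
rewrite (big_morph (fun p => p \Po ('X + (xi k)%:P)) (fun p q => comp_polyD p q _) (comp_poly0 _)).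
rewrite coef_sum big_mkcond /=.
apply: eq_bigr => z _; rewrite (_ : - `|j|%N%:Z = j); last by lia.
case: ifP => _; last by rewrite mulr0.
by rewrite comp_polyZ comp_Xn_poly coefZ.
Qed.
End Sections.
End Points.

(** * Laurent polynomials in a field *)

Notation malg := monalg.malg.

Section Coefficients.
Variables (F : fieldType) (M : zmodType).
Implicit Types (g h : malg M F) (m : M).

Definition mcoef g m : F := monalg.mcoeff m g.
Definition mono (c : F) m : malg M F := monalg.mkmalgU m c.

Lemma mcoefD g h m : mcoef (g + h) m = mcoef g m + mcoef h m.
Proof. exact: monalg.mcoeffD. Qed.
Lemma mcoefB g h m : mcoef (g - h) m = mcoef g m - mcoef h m.
Proof. exact: monalg.mcoeffB. Qed.
Lemma mcoef0 m : mcoef 0 m = 0.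
Proof. exact: monalg.mcoeff0. Qed.
Lemma mcoefU c x m : mcoef (mono c x) m = c *+ (x == m).
Proof. exact: monalg.mcoeffU. Qed.
Lemma mcoefU_neq0 c x m : mcoef (mono c x) m != 0 -> m = x.
Proof.
have [-> //|mx] := eqVneq m x.
by rewrite mcoefU (eq_sym x) (negbTE mx) mulr0n eqxx.
Qed.
Lemma mcoef_neq0 g m : (m \in monalg.msupp g) = (mcoef g m != 0).
Proof. exact/esym/monalg.mcoeff_neq0. Qed.
Lemma mcoef_sum (I : Type) (r : seq I) (P : pred I) (f : I -> malg M F) m :
  mcoef (\sum_(i <- r | P i) f i) m = \sum_(i <- r | P i) mcoef (f i) m.
Proof. exact: (raddf_sum (monalg.mcoeff m)). Qed.
Lemma mcoefP g h : (forall m, mcoef g m = mcoef h m) -> g = h.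
Proof. by move=> e; apply/monalg.malgP. Qed.
End Coefficients.

Opaque mcoef mono.

Section Laurent.
Variables (F : fieldType) (C : set F) (M : zmodType).
Hypothesis ringC : is_subring C.
Implicit Types (chi : M -> F) (g h p : malg M F) (m v : M).

Definition is_char chi := chi 0 = 1 /\ forall a b, chi (a + b) = chi a * chi b.

Lemma char_neq0 chi m : is_char chi -> chi m != 0.
Proof.
case=> c0 cD; apply/eqP => m0; have := oner_neq0 F.
by rewrite -c0 -(subrr m) cD m0 mul0r eqxx.
Qed.

Lemma charN chi m : is_char chi -> chi (- m) = (chi m)^-1.
Proof.
move=> hc; have [c0 cD] := hc; apply: (mulfI (char_neq0 m hc)).
by rewrite -cD subrr c0 divff ?char_neq0.
Qed.

Lemma charMn chi m i : is_char chi -> chi (m *+ i) = chi m ^+ i.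
Proof.
by move=> [c0 cD]; elim: i => [|i IH]; rewrite ?mulr0n ?expr0 // mulrS exprS cD IH.
Qed.

Lemma charZ chi m (i : int) : is_char chi -> chi (m *~ i) = chi m ^ i.
Proof.
move=> hc; case: i => i; first by rewrite -pmulrn charMn.
by rewrite NegzE mulrNz charN // -pmulrn charMn // -exprnN.
Qed.

Definition ev chi g : F := monalg.mmap idfun chi g.

Lemma ev_is_additive chi : {morph ev chi : x y / x + y}.
Proof. by move=> x y; rewrite /ev monalg.mmapD. Qed.
Lemma ev0 chi : ev chi 0 = 0. Proof. exact: monalg.mmap0. Qed.
Lemma evB chi : {morph ev chi : x y / x - y}.
Proof. by move=> x y; rewrite /ev monalg.mmapB. Qed.
Lemma ev_sum chi (I : Type) (r : seq I) (P : pred I) (f : I -> malg M F) :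
  ev chi (\sum_(i <- r | P i) f i) = \sum_(i <- r | P i) ev chi (f i).
Proof. exact: (big_morph (ev chi) (ev_is_additive chi) (ev0 chi)). Qed.
Lemma evU chi c m : ev chi (mono c m) = c * chi m.
Proof. exact: monalg.mmapU. Qed.
Lemma evE chi g : ev chi g = \sum_(m <- monalg.msupp g) mcoef g m * chi m.
Proof. by []. Qed.

Lemma sum_msupp g (f : M -> F) m : (mcoef g m = 0 -> f m = 0) ->
  \sum_(x <- monalg.msupp g) f x *+ (x == m) = f m.
Proof.
move=> h; have [ms|ms] := boolP (m \in monalg.msupp g).
  rewrite (bigD1_seq m) ?fset_uniq //= eqxx mulr1n big1 ?addr0 // => x /negbTE ->.
  by rewrite mulr0n.
rewrite h; last by apply/eqP; rewrite -[_ == _]negbK -mcoef_neq0.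
rewrite big_seq big1 // => x xs; case: eqP => [e|]; rewrite ?mulr0n //.
by move: ms; rewrite -e xs.
Qed.

(** Multiplication by [c z^v]. *)
Definition shift v (c : F) g : malg M F :=
  \sum_(m <- monalg.msupp g) mono (c * mcoef g m) (m + v).

Lemma mcoef_shift v c g m : mcoef (shift v c g) m = c * mcoef g (m - v).
Proof.
rewrite mcoef_sum -(@sum_msupp g (fun x => c * mcoef g x)); last by move=> ->; rewrite mulr0.
apply: eq_bigr => x _; rewrite mcoefU; congr (_ *+ nat_of_bool _).
by rewrite [RHS]eq_sym subr_eq eq_sym.
Qed.

Lemma ev_shift chi v c g : is_char chi -> ev chi (shift v c g) = c * chi v * ev chi g.
Proof.
move=> [_ cD]; rewrite ev_sum evE mulr_sumr; apply: eq_bigr => m _.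
rewrite evU cD; ring.
Qed.

Definition restrict (P : pred M) g : malg M F :=
  \sum_(m <- monalg.msupp g | P m) mono (mcoef g m) m.

Lemma mcoef_restrict P g m : mcoef (restrict P g) m = if P m then mcoef g m else 0.
Proof.
rewrite mcoef_sum big_mkcond -(@sum_msupp g (fun x => if P x then mcoef g x else 0)).
  by apply: eq_bigr => x _; rewrite mcoefU; case: ifP => _; rewrite ?mul0rn.
by move=> ->; case: ifP.
Qed.

Lemma ev_restrict chi P g :
  ev chi (restrict P g) = \sum_(m <- monalg.msupp g | P m) mcoef g m * chi m.
Proof. by rewrite ev_sum; apply: eq_bigr => m _; rewrite evU. Qed.

Definition conv p h : malg M F := \sum_(v <- monalg.msupp p) shift v (mcoef p v) h.

Lemma mcoef_conv p h m :
  mcoef (conv p h) m = \sum_(v <- monalg.msupp p) mcoef p v * mcoef h (m - v).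
Proof. by rewrite mcoef_sum; apply: eq_bigr => v _; rewrite mcoef_shift. Qed.

Lemma ev_conv chi p h : is_char chi -> ev chi (conv p h) = ev chi p * ev chi h.
Proof.
by move=> hc; rewrite ev_sum evE mulr_suml; apply: eq_bigr => v _; rewrite ev_shift.
Qed.

Opaque shift restrict conv ev.

Definition Cval g := forall m, C (mcoef g m).

Lemma CvalD g h : Cval g -> Cval h -> Cval (g + h).
Proof. by move=> hg hh m; rewrite mcoefD; exact: subringD. Qed.
Lemma CvalB g h : Cval g -> Cval h -> Cval (g - h).
Proof. by move=> hg hh m; rewrite mcoefB; exact: subringB. Qed.
Lemma Cval_shift v c g : C c -> Cval g -> Cval (shift v c g).
Proof. by move=> hc hg m; rewrite mcoef_shift; exact: subringM. Qed.
Lemma Cval_conv p h : Cval p -> Cval h -> Cval (conv p h).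
Proof.
by move=> hp hh m; rewrite mcoef_conv; apply: subring_sum => // v _; exact: subringM.
Qed.
Lemma Cval_restrict P g : Cval g -> Cval (restrict P g).
Proof. by move=> hg m; rewrite mcoef_restrict; case: ifP => // _; exact: subring0. Qed.
Lemma Cval_mono c m : C c -> Cval (mono c m).
Proof.
by move=> hc x; rewrite mcoefU; case: eqP => _; rewrite ?mulr1n ?mulr0n //; exact: subring0.
Qed.
Lemma Cval_sum (I : Type) (r : seq I) (P : pred I) (f : I -> malg M F) :
  (forall i, P i -> Cval (f i)) -> Cval (\sum_(i <- r | P i) f i).
Proof. by move=> h m; rewrite mcoef_sum; apply: subring_sum => // i Pi; exact: h. Qed.

(** The Laurent polynomials in the characters [chi] with coefficients in [C]. *)
Definition span chi : set F := [set f | exists2 g, Cval g & f = ev chi g].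

Definition lin_indep chi := forall g, Cval g -> ev chi g = 0 -> g = 0.

Lemma span_char chi m : is_char chi -> span chi (chi m).
Proof.
move=> hc; exists (mono 1 m); last by rewrite evU mul1r.
by apply: Cval_mono; exact: subring1.
Qed.

Lemma span_ring chi : is_char chi -> is_subring (span chi).
Proof.
move=> hc; split.
- by have [<- _] := hc; exact: span_char.
- by move=> x y [g Cg ->] [h Ch ->]; exists (g - h); [exact: CvalB|rewrite evB].
- by move=> x y [g Cg ->] [h Ch ->]; exists (conv g h); [exact: Cval_conv|rewrite ev_conv].
Qed.

Lemma span_scalar chi c : is_char chi -> C c -> span chi c.
Proof.
by move=> [c0 _] hc; exists (mono c 0); [exact: Cval_mono|rewrite evU c0 mulr1].
Qed.

Lemma span_ind (S : set F) chi : S 0 -> (forall x y, S x -> S y -> S (x + y)) ->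
  (forall c m, C c -> S (c * chi m)) -> forall f, span chi f -> S f.
Proof.
move=> S0 SD Sc f [g Cg ->]; rewrite evE; apply: (big_ind S) => // m _.
exact: Sc.
Qed.

Section Independent.
Variable chi : M -> F.
Hypothesis hc : is_char chi.
Hypothesis li : lin_indep chi.

Lemma ev_inj g h : Cval g -> Cval h -> ev chi g = ev chi h -> g = h.
Proof.
move=> Cg Ch e; apply/eqP; rewrite -subr_eq0; apply/eqP; apply: li; first exact: CvalB.
by rewrite evB e subrr.
Qed.

Lemma one_plus_neq0 c v : C c -> v != 0 -> 1 + c * chi v != 0.
Proof.
move=> Cc v0; apply/eqP => e.
have : mono 1 0 + mono c v = 0 :> malg M F.
  apply: li; first by apply: CvalD; apply: Cval_mono => //; exact: subring1.
  rewrite ev_is_additive.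
  rewrite evU.
  rewrite evU.
  by rewrite mul1r (proj1 hc).
move=> /(congr1 (fun g => mcoef g 0)).
rewrite mcoefD !mcoefU eqxx (negbTE v0) mulr1n mulr0n addr0 mcoef0.
by move/eqP; rewrite oner_eq0.
Qed.

(** ** Regularity *)

Lemma level_sum (l : M -> int) g : exists N : nat, forall K : nat, (N <= K)%N ->
  g = \sum_(i < K + K + 1) restrict (fun m => l m == i%:Z - K%:Z) g.
Proof.
exists (\max_(m <- monalg.msupp g) absz (l m)) => K NK; apply: mcoefP => m.
rewrite mcoef_sum; under eq_bigr => i _ do rewrite mcoef_restrict.
have [ms|ms] := boolP (m \in monalg.msupp g); last first.
  have -> : mcoef g m = 0 by apply/eqP; rewrite -[_ == _]negbK -mcoef_neq0.
  rewrite big1 // => i _; by case: ifP.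
have b : (absz (l m) <= K)%N.
  apply: leq_trans NK.
  refine (@leq_bigmax_seq _ _ xpredT (fun m => absz (l m)) m ms isT).
have ltK : (absz (l m + K%:Z)%R < K + K + 1)%N by lia.
rewrite (bigD1 (Ordinal ltK)) //= big1 ?addr0; first by case: eqP => //; lia.
move=> i; rewrite -val_eqE /= => iK; case: eqP => // e; move: iK => /eqP; lia.
Qed.

(** In the grading by [l] the polynomial [p] is homogeneous of degree 0, and [chi v] has nonzero
    degree. So the components of [f] are divisible by [p] one after the other, beginning with
    the component of lowest degree. *)
Lemma regular_sequence (l : M -> int) c v (p : malg M F) (f h : F) :
  (forall a b, l (a + b) = l a + l b) -> C c -> l v != 0 ->
  Cval p -> (forall m, mcoef p m != 0 -> l m = 0) ->
  span chi f -> span chi h -> (1 + c * chi v) * f = ev chi p * h ->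
  exists2 f', span chi f' & f = ev chi p * f'.
Proof.
wlog lv : l / 0 < l v => [wl|].
  move=> lD Cc lv Cp lp; have [pos|neg] := ltP 0 (l v); first exact: (wl l).
  apply: (wl (fun m => - l m)) => //.
  - by rewrite oppr_gt0 lt_neqAle lv.
  - by move=> a b; rewrite lD opprD.
  - by rewrite oppr_eq0.
  - by move=> m /lp ->.
move=> lD Cc _ Cp lp [g Cg ->] [k Ck ->] e.
have lB a b : l (a - b) = l a - l b by apply/eqP; rewrite eq_sym subr_eq -lD subrK.
have ge : g + shift v c g = conv p k.
  apply: ev_inj; [by apply: CvalD => //; exact: Cval_shift|exact: Cval_conv|].
  by rewrite ev_is_additive ev_shift // ev_conv // -e mulrDl mul1r.
pose rs j := restrict (fun m => l m == j).
have lev j : rs j g + shift v c (rs (j - l v) g) = conv p (rs j k).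
  apply: mcoefP => m; have := congr1 (fun x => mcoef x m) ge.
  rewrite !mcoefD !mcoef_shift !mcoef_conv !mcoef_restrict lB.
  rewrite (inj_eq (addIr _)); case: eqP => lm; last first.
    move=> _; rewrite mulr0 addr0 big_seq big1 // => x; rewrite mcoef_neq0 => /lp lx.
    by rewrite mcoef_restrict lB lx subr0; case: eqP => //; rewrite mulr0.
  move=> ->; apply: eq_big_seq => x; rewrite mcoef_neq0 => /lp lx.
  by rewrite mcoef_restrict lB lx subr0 lm eqxx.
have [N gN] := level_sum l g.
have low j : j < - N%:Z -> rs j g = 0.
  move=> jN; apply: mcoefP => m; rewrite mcoef_restrict mcoef0.
  case: eqP => // lm; rewrite (gN N (leqnn N)) mcoef_sum big1 // => i _.
  by rewrite mcoef_restrict; case: eqP => //; lia.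
have ind (t : nat) j : j < t%:Z - N%:Z -> exists2 f', span chi f' & ev chi (rs j g) = ev chi p * f'.
  elim: t j => [|t IH] j jt.
    exists 0; first by apply: subring0; exact: span_ring.
    by rewrite low ?ev0 ?mulr0 //; lia.
  have [|f' sf' e'] := IH (j - l v); first by lia.
  exists (ev chi (rs j k) - c * chi v * f').
    apply: (subringB (span_ring hc)); first by exists (rs j k) => //; exact: Cval_restrict.
    apply: (subringM (span_ring hc)) => //.
    by apply: (subringM (span_ring hc)); [exact: span_scalar|exact: span_char].
  have := congr1 (ev chi) (lev j); rewrite ev_is_additive ev_shift // ev_conv // e'.
  by move=> h0; rewrite mulrBr -h0; ring.
rewrite (gN N (leqnn N)) ev_sum.
apply: (big_ind (fun x => exists2 f', span chi f' & x = ev chi p * f')).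
- by exists 0; rewrite ?mulr0 //; apply: subring0; exact: span_ring.
- move=> x y [x' sx ->] [y' sy ->]; exists (x' + y'); rewrite ?mulrDr //.
  by apply: subringD => //; exact: span_ring.
- by move=> i _; apply: (ind (N + N + 1)%N); have := ltn_ord i; lia.
Qed.

End Independent.

(** ** Mutation of the characters *)
Section Mutation.
Variables (chi : M -> F) (a : M -> int) (y : M) (c : F).
Hypothesis hc : is_char chi.
Hypothesis aD : forall u v, a (u + v) = a u + a v.
Hypothesis ay : a y = 0.
Hypothesis Cc : C c.
Let U := 1 + c * chi y.
Hypothesis U0 : U != 0.

(** The pull-back of [z^m] under the mutation with binomial [1 + c z^y]. *)
Definition mutated m : F := chi m * U ^ (- a m).

Lemma linB u v : a (u - v) = a u - a v.
Proof. by apply/eqP; rewrite eq_sym subr_eq -aD subrK. Qed.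

Lemma lin0 : a 0 = 0.
Proof. by rewrite -(subrr 0) linB subrr. Qed.

Lemma mutated_char : is_char mutated.
Proof.
have [c0 cD] := hc; split; first by rewrite /mutated c0 lin0 oppr0 expr0z mulr1.
by move=> u v; rewrite /mutated cD aD opprD expfzDr //; ring.
Qed.

Hypothesis li : lin_indep chi.

Definition mulU g := g + shift y c g.

Lemma ev_mulU g : ev chi (mulU g) = U * ev chi g.
Proof. by rewrite /mulU ev_is_additive ev_shift // mulrDl mul1r. Qed.

Lemma Cval_mulU g : Cval g -> Cval (mulU g).
Proof. by move=> Cg; apply: CvalD => //; exact: Cval_shift. Qed.

Lemma Cval_iterU k g : Cval g -> Cval (iter k mulU g).
Proof. by move=> Cg; elim: k => //= k; exact: Cval_mulU. Qed.

Lemma ev_iterU k g : ev chi (iter k mulU g) = U ^+ k * ev chi g.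
Proof. by elim: k => [|k IH]; rewrite ?expr0 ?mul1r //= ev_mulU IH exprS mulrA. Qed.

Lemma iterU_inj k g h : Cval g -> Cval h -> iter k mulU g = iter k mulU h -> g = h.
Proof.
move=> Cg Ch /(congr1 (ev chi)); rewrite !ev_iterU => /(mulfI (expf_neq0 k U0)).
exact: ev_inj.
Qed.

Definition level j g := restrict (fun m => a m == j) g.

Lemma mcoef_level j g m : mcoef (level j g) m = if a m == j then mcoef g m else 0.
Proof. exact: mcoef_restrict. Qed.

Lemma level_mulU j g : level j (mulU g) = mulU (level j g).
Proof.
apply: mcoefP => m; rewrite /mulU mcoef_level !mcoefD !mcoef_shift !mcoef_level linB ay subr0.
by case: ifP; rewrite ?mulr0 ?addr0.
Qed.

Lemma level_iterU j k g : level j (iter k mulU g) = iter k mulU (level j g).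
Proof. by elim: k => //= k IH; rewrite level_mulU IH. Qed.

Lemma ev_mutated_level j g : ev mutated (level j g) = U ^ (- j) * ev chi (level j g).
Proof.
rewrite /level !ev_restrict mulr_sumr; apply: eq_bigr => m /eqP <-.
by rewrite /mutated; ring.
Qed.

(** Level [j] of a Laurent polynomial is multiplied by the power [- j] of [U] under the mutation,
    so [U ^+ K] clears the denominators of all levels at most [K]. *)
Lemma clear_mutated g : Cval g -> exists N : nat, forall K : nat, (N <= K)%N ->
  exists G, [/\ Cval G, ev chi G = U ^+ K * ev mutated g
    & forall j, (absz j <= K)%N -> level j G = iter (absz (K%:Z - j)) mulU (level j g)].
Proof.
move=> Cg; have [N gN] := level_sum a g; exists N => K NK.
exists (\sum_(i < K + K + 1) iter (K + K - i) mulU (level (i%:Z - K%:Z) g)); split.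
- by apply: Cval_sum => i _; apply: Cval_iterU; exact: Cval_restrict.
- rewrite {2}(gN K NK) !ev_sum mulr_sumr; apply: eq_bigr => i _.
  rewrite ev_iterU ev_mutated_level mulrA; congr (_ * _).
  rewrite !exprnP -expfzDr //.
  by congr (_ ^ _); have := ltn_ord i; lia.
move=> j jK; apply: mcoefP => m; rewrite mcoef_level mcoef_sum.
have ltK : (absz (j + K%:Z)%R < K + K + 1)%N by lia.
have lvE k (j' : int) : mcoef (iter k mulU (level j' g)) m =
    if a m == j' then mcoef (iter k mulU g) m else 0.
  by rewrite -level_iterU mcoef_level.
rewrite lvE; case: eqP => // am.
rewrite (bigD1 (Ordinal ltK)) //= big1 ?addr0.
  rewrite lvE ifT; last by rewrite am; apply/eqP; lia.
  by congr (mcoef (iter _ _ _) _); lia.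
move=> i; rewrite -val_eqE /= lvE => iK; case: eqP => // e; move: iK => /eqP; lia.
Qed.

Lemma lin_indep_mutated : lin_indep mutated.
Proof.
move=> g Cg g0; have [N HN] := clear_mutated Cg.
have [G [CG eG lG]] := HN N (leqnn N).
have {eG} G0 : G = 0 by apply: li => //; rewrite eG g0 mulr0.
have [N1 gN1] := level_sum a g.
have [N2 HN2] := clear_mutated Cg.
have [G' [CG' eG' lG']] := HN2 _ (leq_maxr N1 N2).
have {eG'} G'0 : G' = 0 by apply: li => //; rewrite eG' g0 mulr0.
have z j : (absz j <= maxn N1 N2)%N -> level j g = 0.
  move=> jK; apply: (@iterU_inj (absz ((maxn N1 N2)%:Z - j))); first exact: Cval_restrict.
    by move=> m; rewrite mcoef0; exact: subring0.
  rewrite -lG' // G'0; apply: (@ev_inj chi) => //.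
  - by apply: Cval_restrict => m; rewrite mcoef0; exact: subring0.
  - by apply: Cval_iterU => m; rewrite mcoef0; exact: subring0.
  rewrite ev_iterU ev0 mulr0 -(ev0 chi); congr ev.
  by apply: mcoefP => m; rewrite mcoef_level mcoef0; case: ifP.
rewrite (gN1 _ (leq_maxl N1 N2)) big1 // => i _.
by apply: z; have := ltn_ord i; lia.
Qed.

(** Level [- r] of a Laurent polynomial in the mutated characters is [U ^+ r] times the same
    expression in the old characters. *)
Lemma mutated_divisible g : Cval g -> span mutated (ev chi g) ->
  forall r : nat, exists2 h, Cval h & level (- r%:Z) g = iter r mulU (level (- r%:Z) h).
Proof.
move=> Cg [h Ch e] r; exists h => //.
have [N HN] := clear_mutated Ch; pose K := maxn N r.
have [G [CG eG lG]] := HN K (leq_maxl N r).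
have rK : (r <= K)%N by exact: leq_maxr.
have GE : iter K mulU g = G.
  apply: (@ev_inj chi) => //; first exact: Cval_iterU.
  by rewrite ev_iterU eG e.
apply: (@iterU_inj K); first exact: Cval_restrict.
  by apply: Cval_iterU; exact: Cval_restrict.
rewrite -level_iterU GE lG; last by lia.
by rewrite -iterD; congr (iter _ _ _); lia.
Qed.

End Mutation.

(** Hartogs' principle: where [P] is invertible the torus of [chi] agrees with that of [chi1],
    where [G] and [H] are invertible with that of [chi2], and as [G] and [H] are regular modulo
    [P] the complement of these two open sets has codimension two. *)
Lemma extension (chi chi1 chi2 : M -> F) (P G H f : F) : is_char chi ->
  span chi P -> span chi G -> span chi H -> P != 0 -> G != 0 -> H != 0 ->
  (forall m, exists i : int, chi1 m = chi m * P ^ i) ->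
  (forall m, exists (u : F) m' (i j : int), C u /\ chi2 m = u * chi m' * G ^ i * H ^ j) ->
  (forall g h : F, span chi g -> span chi h -> G * g = P * h -> exists2 h', span chi h' & g = P * h') ->
  (forall g h : F, span chi g -> span chi h -> H * g = P * h -> exists2 h', span chi h' & g = P * h') ->
  span chi1 f -> span chi2 f -> span chi f.
Proof.
move=> hc sP sG sH P0 G0 H0 h1 h2 rG rH s1 s2.
have sR := span_ring hc.
have absX (x : F) (N : nat) (i : int) : x != 0 -> span chi x -> (absz i <= N)%N -> span chi (x ^+ N * x ^ i).
  move=> x0 sx iN; rewrite -[x ^+ N]/(x ^ N%:Z) -expfzDr //.
  have -> : N%:Z + i = (absz (N%:Z + i)) by lia.
  exact: subringX.
have [N sN] : exists N, span chi (P ^+ N * f).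
  move: f s1 {s2}; apply: span_ind.
  - by exists 0%N; rewrite mulr0; exact: subring0.
  - move=> x z [N1 n1] [N2 n2]; exists (N1 + N2)%N; rewrite mulrDr; apply: subringD => //.
      by rewrite exprD mulrAC mulrC; apply: subringM => //; exact: subringX.
    by rewrite exprD -mulrA; apply: subringM => //; exact: subringX.
  - move=> u m Cu; have [i ->] := h1 m; exists (absz i).
    rewrite (_ : _ * _ = u * chi m * (P ^+ absz i * P ^ i)); last by ring.
    apply: subringM => //; last exact: absX.
    by apply: subringM => //; [exact: span_scalar|exact: span_char].
have [K sK] : exists K, span chi ((G * H) ^+ K * f).
  move: f s2 {s1 sN}; apply: span_ind.
  - by exists 0%N; rewrite mulr0; exact: subring0.
  - move=> x z [N1 n1] [N2 n2]; exists (N1 + N2)%N; rewrite mulrDr; apply: subringD => //.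
      rewrite exprD mulrAC mulrC; apply: subringM => //; apply: subringX => //; exact: subringM.
    rewrite exprD -mulrA; apply: subringM => //; apply: subringX => //; exact: subringM.
  - move=> u m Cu; have [u' [m' [i [j [Cu' ->]]]]] := h2 m; exists (absz i + absz j)%N.
    rewrite exprMn (_ : _ * _ = u * u' * chi m' * (G ^+ (absz i + absz j) * G ^ i) * (H ^+ (absz i + absz j) * H ^ j)); last by ring.
    apply: subringM => //; last by apply: absX => //; lia.
    apply: subringM => //; last by apply: absX => //; lia.
    by apply: subringM => //; [apply: span_scalar => //; exact: subringM|exact: span_char].
have rD k (g h : F) : span chi g -> span chi h -> (G * H) ^+ k * g = P * h ->
    exists2 h', span chi h' & g = P * h'.
  elim: k g h => [|k IH] g h sg sh; first by rewrite expr0 mul1r => ->; exists h.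
  rewrite exprSr -!mulrA => /IH [||g1 sg1 e1] //.
    by apply: subringM => //; exact: subringM.
  have [|g2 sg2 e2] := rG _ _ _ sg1 e1; first exact: subringM.
  exact: (rH g g2).
elim: N sN => [|N IH] sN; first by move: sN; rewrite expr0 mul1r.
apply: IH; have [||h' sh' e] := rD K (P ^+ N.+1 * f) (P ^+ N * ((G * H) ^+ K * f)) sN.
- by apply: subringM => //; exact: subringX.
- by rewrite exprS; ring.
by rewrite (_ : _ * f = h') //; apply: (mulfI P0); rewrite -e exprS mulrA.
Qed.
End Laurent.

(** * Two mutations *)

Section Rank2.
Variables (F : fieldType) (C : set F) (M : zmodType).
Hypothesis ringC : is_subring C.
Implicit Types (chi : M -> F).
Local Notation additive l := (forall u v, l (u + v) = l u + l v).
Local Notation span := (span C).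

Definition regular_mod chi (G P : F) := forall g h : F, span chi g -> span chi h ->
  G * g = P * h -> exists2 h', span chi h' & g = P * h'.

(** For [l] the second binomial is homogeneous of degree 0, the first one is not. *)
Lemma regular_binomials chi (l : M -> int) c v t z : is_char chi -> lin_indep C chi ->
  additive l -> C c -> C t -> l v != 0 -> l z = 0 ->
  regular_mod chi (1 + c * chi v) (1 + t * chi z).
Proof.
move=> hc li lD Cc Ct lv lz g h sg sh.
have l0 : l 0 = 0 by apply: (addrI (l 0)); rewrite -lD !addr0.
have e : ev chi (mono 1 0 + mono t z) = 1 + t * chi z.
  by rewrite ev_is_additive !evU mul1r (proj1 hc).
rewrite -e; apply: (regular_sequence ringC hc li lD Cc lv) => //.
  by apply: CvalD => //; apply: Cval_mono => //; exact: subring1.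
move=> m; have [->|m0] := eqVneq m 0; first by rewrite l0.
have [->|mz] := eqVneq m z; first by rewrite lz.
by rewrite mcoefD !mcoefU (eq_sym 0) (eq_sym z) (negbTE m0) (negbTE mz) !mulr0n addr0 eqxx.
Qed.

Lemma regular_one_plus chi (P R : F) : is_char chi -> span chi R -> regular_mod chi (1 + P * R) P.
Proof.
move=> hc sR g h sg sh e; exists (h - R * g).
  by apply: (subringB (span_ring ringC hc)) => //; exact: (subringM (span_ring ringC hc)).
by rewrite mulrBr -e; ring.
Qed.

Variables (chi : M -> F) (a : M -> int) (s t : F) (b : nat).
Hypotheses (hc : is_char chi) (li : lin_indep C chi).
Hypotheses (aD : additive a) (Cs : C s) (Ct : C t).

Section NonPositive.
Variables (c : M -> int) (y z : M).
Hypotheses (cD : additive c) (ay : a y = 0) (cz : c z = 0) (az : a z = - b%:Z) (cy : c y = b).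
Let chi1 := mutated chi a y s.
Let chi2 := mutated chi1 c z t.
Let P := 1 + t * chi1 z.
Hypotheses (U0 : 1 + s * chi y != 0) (V0 : 1 + t * chi z != 0) (P0 : P != 0).
Hypothesis reg : b = 0%N -> regular_mod chi2 (1 + s * chi2 y) P.

(** Let [G = 1 + s * chi y] and [P] be the binomials of the two consecutive mutations. The binomial
    of the second direction before the first mutation satisfies
    [G ^+ b * (1 + t * chi z) = P * H] with [H] congruent to 1 or to a binomial modulo [P]. So the torus of [chi2] agrees with that of
    [chi1] away from [P = 0], and with that of the direct mutation in the second direction away
    from [G H = 0]; the element extends by [extension]. *)
Lemma rank2_nonpositive f : span chi1 f -> span (mutated chi c z t) f -> span chi2 f.
Proof.
have hc1 : is_char chi1 by exact: mutated_char.
have li1 : lin_indep C chi1 by exact: (lin_indep_mutated ringC hc aD ay Cs U0).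
have hc2 : is_char chi2 by exact: mutated_char.
have li2 : lin_indep C chi2 by exact: (lin_indep_mutated ringC hc1 cD cz Ct P0).
have sR := span_ring ringC hc2.
have z2 : chi2 z = chi1 z by rewrite /chi2 /mutated cz oppr0 expr0z mulr1.
have y2 : chi y = chi2 y * P ^+ b.
  rewrite /chi2 /mutated cy /chi1 /mutated ay oppr0 expr0z mulr1 -mulrA.
  by rewrite exprnP -expfzDr // addNr expr0z mulr1.
have PE : P = 1 + t * chi2 z by rewrite z2.
have sP : span chi2 P.
  rewrite PE; apply: subringD => //; first exact: subring1.
  by apply: subringM => //; [exact: span_scalar|exact: span_char].
pose Y := s * chi2 y.
have sY : span chi2 Y by apply: subringM => //; [exact: span_scalar|exact: span_char].
pose G := 1 + Y * P ^+ b.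
have GE : G = 1 + s * chi y by rewrite /G y2 mulrA.
have sG : span chi2 G.
  by apply: subringD => //; [exact: subring1|apply: subringM => //; exact: subringX].
(* As [G] is [1 + Y P^b], dividing [G ^+ b - 1] by [P] gives this [H]; modulo [P] it is 1, except
   for [b = 1], where it is [1 + Y]. *)
pose H := if b is b'.+1 then 1 + Y * P ^+ b' * \sum_(i < b) G ^+ i else 1.
have sH : span chi2 H.
  rewrite /H; case: (b) => [|b']; first exact: subring1.
  apply: subringD => //; first exact: subring1.
  apply: subringM => //; first by apply: subringM => //; exact: subringX.
  by apply: subring_sum => // i _; exact: subringX.
have tz : t * chi1 z = t * chi z * G ^+ b.
  by rewrite /chi1 /mutated az opprK -GE exprnP; ring.
have VE : G ^+ b * (1 + t * chi z) = P * H.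
  rewrite mulrDr mulr1 [_ * (t * _)]mulrC -tz.
  have -> : t * chi1 z = P - 1 by rewrite /P addrC addKr.
  rewrite /H; case eb: (b) => [|b']; first by rewrite expr0 mulr1 addrC subrK.
  have GB : G - 1 = Y * P ^+ b'.+1 by rewrite /G eb addrC addKr.
  rewrite -{1}(subrK 1 (G ^+ b'.+1)) subrX1 GB exprS; ring.
have G0 : G != 0 by rewrite GE.
have H0 : H != 0.
  apply: contraTneq (mulf_neq0 (expf_neq0 b G0) V0) => H0.
  by rewrite VE H0 mulr0 eqxx.
apply: (extension ringC hc2 sP sG sH) => //.
- move=> m; exists (c m); rewrite /chi2 /mutated -mulrA -expfzDr // addNr expr0z mulr1 //.
- move=> m; exists 1, m, (a m + b%:Z * c m), (- c m); split; first exact: subring1.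
  have VV : 1 + t * chi z = P * H * G ^ (- b%:Z).
    by rewrite -VE exprnP mulrAC -expfzDr // subrr expr0z mul1r.
  have chi2E : chi2 m = chi m * G ^ (- a m) * P ^ (- c m) by rewrite GE.
  rewrite mul1r /mutated VV !expfzMl exprz_exp chi2E.
  have -> : - b%:Z * - c m = b%:Z * c m by ring.
  rewrite expfzDr //.
  have := divff (expfz_neq0 (a m) G0); rewrite invr_expz => e.
  by rewrite -[LHS]mulr1 -e; ring.
- rewrite /G; case eb: (b) => [|b'].
    by rewrite expr0 mulr1; exact: reg.
  rewrite exprS mulrCA; apply: regular_one_plus => //.
  by apply: subringM => //; exact: subringX.
- rewrite /H; case eb: (b) => [|[|b']].
  + by move=> g h sg sh; rewrite mul1r => ->; exists h.
  + rewrite expr0 mulr1 big_ord1 expr0 mulr1 PE.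
    by apply: (@regular_binomials _ c) => //; rewrite cy eb.
  + rewrite (_ : Y * P ^+ b'.+1 * _ = P * (Y * P ^+ b' * \sum_(i < b'.+2) G ^+ i)); last first.
      by rewrite exprS; ring.
    apply: regular_one_plus => //; apply: subringM => //.
      by apply: subringM => //; exact: subringX.
    by apply: subring_sum => // i _; exact: subringX.
Qed.
End NonPositive.

Section Positive.
Variables (c : M -> int) (x z : M).
Hypotheses (cD : additive c) (ax : a x = 0) (cz : c z = 0) (az : a z = b) (cx : c x = - b%:Z).
Hypotheses (b0 : (0 < b)%N) (s0 : s != 0) (Csi : C s^-1).
Let chi1 := mutated chi a x s.
Let z' := z + x *+ b.
Let t' := t * s ^+ b.
Let c' m := c m + b%:Z * a m.
Let P := 1 + t' * chi1 z'.
Let chi2 := mutated chi1 c' z' t'.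
Hypotheses (U0 : 1 + s * chi x != 0) (V0 : 1 + t * chi z != 0) (P0 : P != 0).

(** The second direction changes to [z' = z + b x] under the first mutation. Here
    [1 + s * chi x = s * chi x * G] with [G] congruent to 1 modulo [P], the unit [s * chi x] is
    absorbed by a change of characters, and [1 + t * chi z = P * H]. *)
Lemma rank2_positive f : span chi1 f -> span (mutated chi c z t) f -> span chi2 f.
Proof.
have aMn m i : a (m *+ i) = a m *+ i.
  by elim: i => [|i IH]; rewrite ?mulr0n ?(lin0 aD) // !mulrS aD IH.
have cMn m i : c (m *+ i) = c m *+ i.
  by elim: i => [|i IH]; rewrite ?mulr0n ?(lin0 cD) // !mulrS cD IH.
have c'D : additive c' by move=> u v; rewrite /c' aD cD; ring.
have c'z : c' z' = 0.
  rewrite /c' /z' cD aD cz az cMn aMn cx ax mul0rn addr0 add0r.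
  by rewrite -mulr_natr natz mulNr addNr.
have c'x : c' x = - b%:Z by rewrite /c' cx ax mulr0 addr0.
have hc1 : is_char chi1 by exact: mutated_char.
have li1 : lin_indep C chi1 by exact: (lin_indep_mutated ringC hc aD ax Cs U0).
have Ct' : C t' by apply: subringM => //; exact: subringX.
have hc2 : is_char chi2 by exact: mutated_char.
have li2 : lin_indep C chi2 by exact: (lin_indep_mutated ringC hc1 c'D c'z Ct' P0).
have sR := span_ring ringC hc2.
have z2 : chi2 z' = chi1 z' by rewrite /chi2 /mutated c'z oppr0 expr0z mulr1.
have x2 : chi x = chi2 x * P ^ (- b%:Z).
  rewrite /chi2 /mutated c'x /chi1 /mutated ax oppr0 expr0z mulr1 -mulrA.
  by rewrite -expfzDr // addNr expr0z mulr1.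
have PE : P = 1 + t' * chi2 z' by rewrite z2.
have sP : span chi2 P.
  rewrite PE; apply: subringD => //; first exact: subring1.
  by apply: subringM => //; [exact: span_scalar|exact: span_char].
pose Y := s^-1 * chi2 (- x).
have sY : span chi2 Y by apply: subringM => //; [exact: span_scalar|exact: span_char].
have XY : (s * chi2 x) * Y = 1.
  rewrite /Y charN //; have := char_neq0 x hc2 => x0.
  by rewrite mulrACA divff // divff // mulr1.
pose X := s * chi x.
have XE : X = s * chi2 x * P ^ (- b%:Z) by rewrite /X x2 mulrA.
have X0 : X != 0 by rewrite mulf_neq0 ?char_neq0.
pose G := 1 + Y * P ^+ b.
have PbP : P ^ (- b%:Z) * P ^+ b = 1 by rewrite exprnP -expfzDr // addNr.
have GX : 1 + s * chi x = X * G.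
  rewrite /G mulrDr mulr1 {2}XE (_ : _ * _ * (_ * _) = (s * chi2 x * Y) * (P ^ (- b%:Z) * P ^+ b)); last by ring.
  by rewrite XY PbP mulr1 addrC.
have sG : span chi2 G.
  by apply: subringD => //; [exact: subring1|apply: subringM => //; exact: subringX].
have G0 : G != 0 by apply: contraNneq U0 => G0; rewrite GX G0 mulr0.
pose H := 1 + t' * chi2 z' * Y * P ^+ b.-1 * \sum_(i < b) G ^+ i.
have sZ : span chi2 (t' * chi2 z') by apply: subringM => //; [exact: span_scalar|exact: span_char].
have sH : span chi2 H.
  apply: subringD => //; first exact: subring1.
  apply: subringM => //; last by apply: subring_sum => // i _; exact: subringX.
  by apply: subringM => //; [apply: subringM|exact: subringX].
have tz : t * chi z = t' * chi2 z' * G ^+ b.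
  rewrite z2 /chi1 /mutated /z' aD az aMn ax mul0rn addr0 (proj2 hc) charMn // GX /t'.
  rewrite expfzMl (_ : _ * _ * _ = t * chi z * ((X ^+ b) * X ^ (- b%:Z)) * (G ^ (- b%:Z) * G ^+ b)); last first.
    by rewrite /X exprMn; ring.
  by rewrite !exprnP -!expfzDr // subrr addNr !expr0z !mulr1.
have VE : 1 + t * chi z = P * H.
  have GB : G - 1 = Y * P ^+ b by rewrite /G addrC addKr.
  have Pb : P ^+ b = P * P ^+ b.-1 by rewrite -exprS prednK.
  rewrite tz -{1}(subrK 1 (G ^+ b)) subrX1 GB Pb /H; set W := t' * chi2 z' in PE *.
  set S := \sum_(i < b) _; transitivity (1 + W + W * Y * (P * P ^+ b.-1) * S); first by ring.
  by rewrite -PE; ring.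
have H0 : H != 0 by apply: contraNneq V0 => H0; rewrite VE H0 mulr0.
apply: (extension ringC hc2 sP sG sH) => //.
- move=> m; exists (c' m); rewrite /chi2 /mutated -mulrA -expfzDr // addNr expr0z mulr1 //.
- move=> m; exists ((s ^ a m)), (m + x *~ a m), (a m), (- c m); split.
    case: (a m) => i; first by exact: subringX.
    by rewrite NegzE -exprnN -exprVn; exact: subringX.
  rewrite /mutated VE expfzMl (proj2 hc2) (charZ _ _ hc2).
  have -> : s ^ a m * (chi2 m * chi2 x ^ a m) = chi2 m * (s * chi2 x) ^ a m.
    by rewrite expfzMl; ring.
  have -> : s * chi2 x = X * P ^+ b by rewrite XE -mulrA PbP mulr1.
  have chi2E : chi2 m = chi m * (X ^ (- a m) * G ^ (- a m)) * (P ^ (- c m) * P ^ (- (b%:Z * a m))).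
    by rewrite -expfzMl -GX -expfzDr // -opprD.
  rewrite chi2E expfzMl exprnP exprz_exp.
  have e1 := divff (expfz_neq0 (a m) X0); rewrite invr_expz in e1.
  have e2 := divff (expfz_neq0 (a m) G0); rewrite invr_expz in e2.
  have e3 := divff (expfz_neq0 (b%:Z * a m) P0); rewrite invr_expz in e3.
  rewrite [RHS](_ : _ = chi m * P ^ (- c m) * H ^ (- c m) * (X ^ a m * X ^ (- a m))
     * (G ^ a m * G ^ (- a m)) * (P ^ (b%:Z * a m) * P ^ (- (b%:Z * a m)))); last by ring.
  by rewrite e1 e2 e3; ring.
- rewrite /G -(prednK b0) exprS mulrCA; apply: regular_one_plus => //.
  by apply: subringM => //; exact: subringX.
- rewrite /H; case eb: (b) b0 => [//|[|b']] _ /=.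
    rewrite expr0 mulr1 big_ord1 expr0 mulr1.
    have -> : t' * chi2 z' * Y = t' * s^-1 * chi2 (z' - x) by rewrite (proj2 hc2) /Y; ring.
    have c'zx : c' (z' - x) != 0.
      rewrite (_ : c' (z' - x) = b) ?eb //.
      by rewrite (linB c'D) c'z c'x sub0r opprK eb.
    have := regular_binomials hc2 li2 c'D (subringM ringC Ct' Csi) Ct' c'zx c'z.
    by rewrite -PE.
  rewrite exprS (_ : _ * _ * _ * _ * _ = P * (t' * chi2 z' * Y * P ^+ b' * \sum_(i < b'.+2) G ^+ i)); last by ring.
  apply: regular_one_plus => //.
  apply: subringM => //; last by apply: subring_sum => // i _; exact: subringX.
  by apply: subringM => //; [apply: subringM|exact: subringX].
Qed.
End Positive.
End Rank2.

(** * From a seed and its neighbours to all seeds *)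

Section Pairing.
Variable n : nat.
Implicit Types (x y m : 'rV[int]_n).

Lemma pairingE x m : pairing x m = \sum_i x 0 i * m 0 i.
Proof. by rewrite /pairing mxE; apply: eq_bigr => i _; rewrite mxE. Qed.
Lemma pairingDr x u v : pairing x (u + v) = pairing x u + pairing x v.
Proof. by rewrite !pairingE -big_split; apply: eq_bigr => i _; rewrite mxE mulrDr. Qed.
Lemma pairingDl x y m : pairing (x + y) m = pairing x m + pairing y m.
Proof. by rewrite !pairingE -big_split; apply: eq_bigr => i _; rewrite mxE mulrDl. Qed.
Lemma pairingZl c x m : pairing (c *: x) m = c * pairing x m.
Proof. by rewrite !pairingE mulr_sumr; apply: eq_bigr => i _; rewrite mxE mulrA. Qed.
Lemma pairingZr c x m : pairing x (c *: m) = c * pairing x m.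
Proof. by rewrite !pairingE mulr_sumr; apply: eq_bigr => i _; rewrite mxE mulrCA. Qed.
Lemma pairingNl x m : pairing (- x) m = - pairing x m.
Proof. by rewrite -scaleN1r pairingZl mulN1r. Qed.
Lemma pairing_neq0 m : m != 0 -> pairing m m != 0.
Proof.
apply: contra => /eqP; rewrite pairingE => /eqP.
rewrite psumr_eq0 => [/allP h|i _]; last by rewrite -expr2 sqr_ge0.
apply/eqP/rowP => i; rewrite mxE; have := h i (mem_index_enum i).
by rewrite /= mulf_eq0 orbb => /eqP.
Qed.
Lemma pairing_mulmx (B : 'M[int]_n) x y : pairing x (y *m B) = skew B y x.
Proof.
have tr (A : 'M[int]_1) : A 0 0 = A^T 0 0 by rewrite mxE.
by rewrite /pairing /skew [LHS]tr trmx_mul trmxK.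
Qed.
End Pairing.

Section Seeds.
Variables (F : fieldType) (C : set F) (n : nat) (B : 'M[int]_n) (T : 'rV[int]_n -> F).
Hypothesis ringC : is_subring C.
Hypotheses (Tchar : is_char T) (CT : forall x, C (T x)) (Tinj : forall x, T x = 1 -> x = 0).
Hypothesis Bskew : B^T = - B.
Hypothesis parallel : forall x y, skew B x y = 0 ->
  exists c d : int, (c != 0) || (d != 0) /\ d *: (x *m B) = c *: (y *m B).
Local Notation M := 'rV[int]_n.
Local Notation span := (span C).
Implicit Types (chi : M -> F) (s : 'M[int]_n).

Lemma skewC x y : skew B x y = - skew B y x.
Proof.
have tr (A : 'M[int]_1) : A 0 0 = A^T 0 0 by rewrite mxE.
by rewrite /skew [LHS]tr !trmx_mul trmxK Bskew mulNmx mulmxN mxE mulmxA.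
Qed.

Definition mut (chi : M -> F) (s : 'M[int]_n) k : M -> F :=
  mutated chi (pairing (row k s)) (row k s *m B) (T (row k s)).

Definition good_seed (chi : M -> F) (s : 'M[int]_n) :=
  [/\ is_char chi, lin_indep C chi, forall r : M, r *m s = 0 -> r = 0
    & forall k, row k s *m B != 0].

Lemma skew_self x : skew B x x = 0.
Proof. by have := skewC x x; lia. Qed.

Lemma row_mutate_eq k s : row k (mutate B k s) = - row k s.
Proof. by rewrite rowK eqxx. Qed.

Lemma row_mutate_neq k i s : i != k ->
  row i (mutate B k s) = row i s + Num.max 0 (skew B (row i s) (row k s)) *: row k s.
Proof. by move=> /negbTE ik; rewrite rowK ik. Qed.

(** Modulo [1 + X], the unit [X] is [-1]. *)
Lemma char_pow_sub chi (X : F) (d : int) : is_char chi -> X != 0 -> span chi X -> span chi X^-1 ->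
  exists2 u, span chi u & X ^ d = (-1) ^ d + (1 + X) * u.
Proof.
move=> hc X0 sX sX'; have sR := span_ring ringC hc.
have nat_case (Y : F) (i : nat) : span chi Y -> exists2 u, span chi u & Y ^+ i = (-1) ^+ i + (1 + Y) * u.
  move=> sY; elim: i => [|i [u su e]].
    by exists 0; rewrite ?mulr0 ?addr0 ?expr0 //; exact: subring0.
  exists ((-1) ^+ i + Y * u).
    by apply: subringD => //; [apply: subringX => //; apply: subringN => //; exact: subring1|exact: subringM].
  by rewrite !exprS e; ring.
case: d => i; first exact: nat_case.
have [u su e] := nat_case X^-1 i.+1 sX'.
exists (X^-1 * u); first exact: subringM.
rewrite NegzE -!exprnN -!exprVn e invrN1 mulrA; congr (_ + _ * _).
by rewrite mulrDl mul1r divff // addrC.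
Qed.

(** As [d v = c z], the powers of [T x * chi v] and [T x' * chi z] with exponents [d] and [c] are
    characters that differ by a constant only. Modulo both binomials the powers are signs, so the difference
    [(-1)^d T (c x') - (-1)^c T (d x)] of constants is 0 there. It is not 0 itself, because
    [d x <> c x'] and [T] is injective; this is where the coefficients have to be general. So a
    nonzero constant multiple of [g], and then [g], is divisible by the second binomial. *)
Lemma regular_parallel chi v z x x' (c d : int) : is_char chi -> lin_indep C chi -> z != 0 ->
  d *: v = c *: z -> d *: x - c *: x' != 0 ->
  regular_mod C chi (1 + T x * chi v) (1 + T x' * chi z).
Proof.
move=> hc li z0 dv ne g h sg sh e; have sR := span_ring ringC hc.
have su y m : span chi (T y * chi m).
  by apply: subringM => //; [exact: span_scalar|exact: span_char].
have inv y m : (T y * chi m)^-1 = T (- y) * chi (- m) by rewrite !charN // invfM.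
have n0 y m : T y * chi m != 0 by rewrite mulf_neq0 ?char_neq0.
have pw y m (i : int) : (T y * chi m) ^ i = T (i *: y) * chi (i *: m).
  by rewrite expfzMl -!charZ // -!scaler_int !intz.
have [|u sU eu] := char_pow_sub d hc (n0 x v) (su x v); first by rewrite inv; exact: su.
have [|u' sU' eu'] := char_pow_sub c hc (n0 x' z) (su x' z); first by rewrite inv; exact: su.
pose k := (-1) ^ d * T (c *: x') - (-1) ^ c * T (d *: x).
have sgn (i : int) : C ((-1) ^ i).
  case: i => i; first by apply: subringX => //; apply: subringN => //; exact: subring1.
  rewrite NegzE -exprnN -exprVn invrN1.
  by apply: subringX => //; apply: subringN => //; exact: subring1.
have sq (i : int) : (-1 : F) ^ i * (-1) ^ i = 1.
  by rewrite -expfzMl mulrNN mulr1 exp1rz.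
have Ck : C k by apply: subringB => //; exact: subringM.
have k0 : k != 0.
  apply: contra ne => /eqP k0.
  have e1 : T (d *: x - c *: x') ^+ 2 = 1.
    have [_ TD] := Tchar; rewrite TD charN //.
    have e2 : (-1) ^ d * T (c *: x') = (-1) ^ c * T (d *: x) by apply/eqP; rewrite -subr_eq0; apply/eqP.
    have t0 := char_neq0 (c *: x') Tchar.
    have : T (d *: x) ^+ 2 = T (c *: x') ^+ 2.
      by have := congr1 (fun w => w ^+ 2) e2; rewrite /= !exprMn !(expr2 (_ ^ _)) !sq !mul1r.
    by rewrite exprMn exprVn => ->; rewrite divff // expf_neq0.
  have := Tinj (x := (d *: x - c *: x') *+ 2); rewrite charMn // => /(_ e1).
  rewrite mulr2n => h0; apply/eqP/rowP => i; have := congr1 (fun m : M => m 0 i) h0.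
  by rewrite !mxE; lia.
have key : (1 + T x' * chi z) * (T (d *: x) * u' * g - T (c *: x') * u * h) = ev chi (mono k 0) * g.
  rewrite evU (proj1 hc) mulr1 /k.
  have r : (T x * chi v) ^ d * T (c *: x') = (T x' * chi z) ^ c * T (d *: x).
    by rewrite !pw dv; ring.
  move: r; rewrite eu eu' => r.
  transitivity ((-1) ^ d * T (c *: x') * g - (-1) ^ c * T (d *: x) * g
     - ((((-1) ^ d + (1 + T x * chi v) * u) * T (c *: x')) - (((-1) ^ c + (1 + T x' * chi z) * u') * T (d *: x))) * g
     + T (c *: x') * u * ((1 + T x * chi v) * g - (1 + T x' * chi z) * h)); first by ring.
  by rewrite r e !subrr mul0r mulr0 subr0 addr0; ring.
have Cp : Cval C (mono k (0 : M)) by exact: (Cval_mono ringC).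
have lp m : mcoef (mono k (0 : M)) m != 0 -> pairing z m = 0.
  by move=> /mcoefU_neq0 ->; rewrite pairingE big1 // => i _; rewrite mxE mulr0.
have sf : span chi (T (d *: x) * u' * g - T (c *: x') * u * h).
  by apply: subringB => //; apply: subringM => //; apply: subringM => //; exact: span_scalar.
have [q sq' qe] := regular_sequence ringC hc li (pairingDr z) (CT x') (pairing_neq0 z0) Cp lp sf sg key.
exists q => //; apply: (mulfI k0).
by move: key; rewrite qe evU (proj1 hc) mulr1 => <-; ring.
Qed.

(** ** Mutation of good seeds *)

Lemma mut_char chi s k : good_seed chi s -> is_char (mut chi s k).
Proof.
case=> hc li _ sB; apply: mutated_char; rewrite ?pairing_mulmx ?skew_self //.
  exact: pairingDr.
exact: (one_plus_neq0 ringC hc li).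
Qed.

Lemma mut_lin_indep chi s k : good_seed chi s -> lin_indep C (mut chi s k).
Proof.
case=> hc li _ sB; apply: lin_indep_mutated => //.
- exact: pairingDr.
- by rewrite pairing_mulmx skew_self.
- exact: (one_plus_neq0 ringC hc li).
Qed.

Lemma mutate_good chi s k : good_seed chi s -> good_seed (mut chi s k) (mutate B k s).
Proof.
move=> gs; have [hc li free sB] := gs; split; first exact: mut_char.
- exact: mut_lin_indep.
- move=> r; rewrite mulmx_sum_row => r0.
  pose e i := Num.max 0 (skew B (row i s) (row k s)).
  pose r' : M := \row_j (if j == k then \sum_(i | i != k) r 0 i * e i - r 0 k else r 0 j).
  have r's : r' *m s = 0.
    rewrite -[RHS]r0 mulmx_sum_row (bigD1 k) //= [RHS](bigD1 k) //= row_mutate_eq mxE eqxx.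
    rewrite scalerBl scalerN addrAC addrC; congr (_ + _).
    rewrite scaler_suml -big_split /=; apply: eq_bigr => i ik.
    by rewrite row_mutate_neq // mxE (negbTE ik) scalerDr scalerA addrC.
  have r'0 := free _ r's; have rj j : j != k -> r 0 j = 0.
    by move=> jk; have := congr1 (fun m : M => m 0 j) r'0; rewrite !mxE (negbTE jk).
  apply/rowP => j; rewrite mxE; have [->|/rj //] := eqVneq j k.
  have := congr1 (fun m : M => m 0 k) r'0; rewrite !mxE eqxx big1.
    by rewrite sub0r => /eqP; rewrite oppr_eq0 => /eqP.
  by move=> i /rj ->; rewrite mul0r.
move=> i; have [->|ik] := eqVneq i k; first by rewrite row_mutate_eq mulNmx oppr_eq0.
rewrite row_mutate_neq // mulmxDl -scalemxAl.
have [le|gt] := leP (skew B (row i s) (row k s)) 0; first by rewrite scale0r addr0.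
apply/eqP => /(congr1 (pairing (row k s))).
rewrite pairingDr pairingZr !pairing_mulmx skew_self mulr0 addr0 pairingE big1 => [|j _].
  by lia.
by rewrite !mxE mulr0.
Qed.

Lemma rows_independent s i j (d c : int) : (forall r : M, r *m s = 0 -> r = 0) -> i != j ->
  (c != 0) || (d != 0) -> d *: row i s - c *: row j s != 0.
Proof.
move=> free ij cd; apply/eqP => e.
have r0 : (d *: delta_mx 0 i - c *: delta_mx 0 j : M) *m s = 0.
  by rewrite mulmxBl -!scalemxAl -!rowE.
have := free _ r0 => /rowP h; have := h i; have := h j; rewrite !mxE !eqxx (eq_sym j) (negbTE ij) /=.
by move: cd; lia.
Qed.

Definition upper_bound chi s : set F :=
  [set f | span chi f /\ forall k, span (mut chi s k) f].

Lemma expz_cancel (x u w : F) (i : int) : u != 0 ->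
  x * u ^ (- i) * (w^-1 * u) ^ i = x * w ^ (- i).
Proof.
by move=> u0; rewrite expfzMl exprz_inv -mulrA (mulrCA (u ^ _)) -expfzDr // addNr expr0z mulr1.
Qed.

(** Two mutations at [k] compose to the change of characters [m |-> m - <e_k, m> v_k], up to
    coefficients, which does not change the torus. *)
Lemma upper_bound_back chi s k f : good_seed chi s -> span chi f ->
  span (mut (mut chi s k) (mutate B k s) k) f.
Proof.
move=> gs sf; have [hc li _ sB] := gs.
have gs' := mutate_good k gs; have hc2 := mut_char k gs'.
set chi2 := mut _ _ _ in hc2 *; pose a := pairing (row k s); pose v := row k s *m B.
have av : a v = 0 by rewrite /a pairing_mulmx skew_self.
have U0 := one_plus_neq0 ringC hc li (CT (row k s)) (sB k).
have aD u w : a (u + w) = a u + a w by exact: pairingDr.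
have aN u : a (- u) = - a u by rewrite -sub0r (linB aD) (lin0 aD) sub0r.
pose W := T (row k s) * chi v.
have W0 : W != 0 by rewrite mulf_neq0 ?char_neq0.
have zs (x : M) (i : int) : i *: x = x *~ i by rewrite -scaler_int intz.
have chi2E m : chi2 m = T (- a m *: row k s) * chi (m - a m *: v).
  rewrite /chi2 /mut /mutated row_mutate_eq pairingNl opprK -/a mulNmx -/v.
  rewrite aN av !oppr0 expr0z mulr1 (charN v hc) (charN (row k s) Tchar).
  have -> : 1 + (T (row k s))^-1 * (chi v)^-1 = W^-1 * (1 + W).
    by rewrite mulrDr mulr1 mulVf // -invfM addrC.
  rewrite -/v -/W in U0 *; rewrite expz_cancel //.
  by rewrite (proj2 hc) -scaleNr !zs !charZ // expfzMl mulrCA.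
move: f sf; apply: span_ind.
- by apply: (subring0 (span_ring ringC hc2)).
- by move=> x y; exact: (subringD (span_ring ringC hc2)).
move=> u m Cu.
have -> : chi m = T (a m *: row k s) * chi2 (m + a m *: v).
  have aZ i x : a (i *: x) = i * a x by exact: pairingZr.
  rewrite chi2E aD aZ av mulr0 addr0 addrK mulrA scaleNr (charN _ Tchar).
  by rewrite divff ?mul1r // char_neq0.
rewrite mulrA; apply: (subringM (span_ring ringC hc2)); last exact: span_char.
by apply: span_scalar => //; exact: subringM.
Qed.

(** For a second mutation at [j <> i] the sign of [{e_j, e_i}] decides between [rank2_nonpositive]
    and [rank2_positive]. When it is 0 the exponents of the two binomials are parallel, by the
    assumption [parallel], and [regular_parallel] supplies the regularity. *)
Lemma upper_bound_mut chi s i f : good_seed chi s -> upper_bound chi s f ->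
  upper_bound (mut chi s i) (mutate B i s) f.
Proof.
move=> gs [sf sfm]; split; first exact: sfm.
move=> j; have [->|ji] := eqVneq j i; first exact: upper_bound_back.
have [hc li free sB] := gs; have gs1 := mutate_good i gs.
have [hc1 li1 free1 sB1] := gs1.
have U0 := one_plus_neq0 ringC hc li (CT (row i s)) (sB i).
have V0 := one_plus_neq0 ringC hc li (CT (row j s)) (sB j).
have P0 := one_plus_neq0 ringC hc1 li1 (CT (row j (mutate B i s))) (sB1 j).
pose x := row i s; pose y := row j s.
have aD (l u w : M) : pairing l (u + w) = pairing l u + pairing l w by exact: pairingDr.
have self u : pairing u (u *m B) = 0 by rewrite pairing_mulmx skew_self.
have [le|gt] := leP (skew B y x) 0.
  have rj : row j (mutate B i s) = y.
    by rewrite row_mutate_neq // -/x -/y max_l // scale0r addr0.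
  rewrite /mut rj; rewrite rj in P0.
  have R := (@rank2_nonpositive _ C _ ringC chi (pairing x) (T x) (T y) (absz (skew B y x)) hc li
    (aD x) (CT x) (CT y) (pairing y) (x *m B) (y *m B) (aD y) (self x) (self y)).
  apply: R => //.
  - by rewrite pairing_mulmx; lia.
  - by rewrite pairing_mulmx skewC; lia.
  - move=> b0; have yx : skew B x y = 0 by rewrite skewC; lia.
    have [c [d [cd dv]]] := parallel yx.
    have gs2 := mutate_good j gs1.
    have [hc2 li2 _ _] := gs2.
    have z2 : mut (mut chi s i) (mutate B i s) j (y *m B) = mut chi s i (y *m B).
      by rewrite {1}/mut /mutated rj self oppr0 expr0z mulr1.
    have := @regular_parallel _ (x *m B) (y *m B) x y c d hc2 li2 (sB j) dv
      (rows_independent free (_ : i != j) cd).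
    by rewrite z2 /mut rj; apply; rewrite eq_sym.
  - exact: sfm.
  - exact: sfm.
pose b := absz (skew B y x).
have bE : skew B y x = b by rewrite /b; lia.
have rj : row j (mutate B i s) = y + b%:Z *: x.
  by rewrite row_mutate_neq // -/x -/y bE max_r.
have zb (u : M) : b%:Z *: u = u *+ b by rewrite -scaler_nat natz.
have rjB : row j (mutate B i s) *m B = y *m B + (x *m B) *+ b.
  by rewrite rj mulmxDl -scalemxAl zb.
have Trj : T (row j (mutate B i s)) = T y * T x ^+ b.
  by rewrite rj zb (proj2 Tchar) charMn.
have pj : pairing (row j (mutate B i s)) = (fun m => pairing y m + b%:Z * pairing x m).
  by apply: funext => m; rewrite rj pairingDl pairingZl.
rewrite /mut pj rjB Trj; rewrite rjB Trj in P0.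
apply: (@rank2_positive _ C _ ringC chi (pairing x) (T x) (T y) b hc li
    (aD x) (CT x) (CT y) (pairing y) (x *m B) (y *m B) (aD y) (self x) (self y)) => //.
- by rewrite pairing_mulmx.
- by rewrite pairing_mulmx skewC bE.
- by move: gt; rewrite bE; lia.
- exact: char_neq0.
- by rewrite -charN.
- exact: sfm.
- exact: sfm.
Qed.

Fixpoint word_char chi s (w : seq 'I_n) : M -> F :=
  if w is k :: w' then word_char (mut chi s k) (mutate B k s) w' else chi.

(** The upper bound of a seed is contained in that of each neighbour, by [upper_bound_mut]. *)
Theorem upper_bound_all chi s w f : good_seed chi s -> upper_bound chi s f ->
  span (word_char chi s w) f.
Proof.
elim: w chi s => [|k w IH] chi s gs ub /=; first by case: ub.
by apply: IH; [exact: mutate_good|exact: upper_bound_mut].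
Qed.

Lemma word_char_char chi s w : good_seed chi s -> is_char (word_char chi s w).
Proof.
by elim: w chi s => [|k w IH] chi s gs /=; [case: gs|apply: IH; exact: mutate_good].
Qed.
End Seeds.

(** * The ring of sections is not Noetherian *)

(** Synthetic division by a monic linear polynomial stays in the subring. *)
Lemma dvd_XsubC_over (F : fieldType) (C : set F) (xi : F) (p q : {poly F}) :
  is_subring C -> C xi -> (forall i, C p`_i) -> p = ('X - xi%:P) * q -> forall i, C q`_i.
Proof.
move=> ringC Cxi Cp e.
have qE i : q`_i = p`_i.+1 + xi * q`_i.+1.
  by rewrite e mulrBl coefB coefXM coefCM /= subrK.
have H (k : nat) : forall i, (size q <= i + k)%N -> C q`_i.
  elim: k => [|k IH] i ik; first by rewrite addn0 in ik; rewrite nth_default //; exact: subring0.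
  rewrite qE; apply: subringD => //; apply: subringM => //.
  by apply: IH; rewrite addSnnS.
by move=> i; apply: (H (size q)); rewrite leq_addl.
Qed.

Lemma dvd_XsubC_exp_over (F : fieldType) (C : set F) (xi : F) r (p : {poly F}) :
  is_subring C -> C xi -> (forall i, C p`_i) -> ('X - xi%:P) ^+ r %| p ->
  exists2 q : {poly F}, p = ('X - xi%:P) ^+ r * q & forall i, C q`_i.
Proof.
move=> ringC Cxi; elim: r p => [|r IH] p Cp; first by exists p; rewrite ?mul1r.
rewrite exprS => dv; have /dvdpP [p1 e1] : 'X - xi%:P %| p.
  exact: dvdp_trans (dvdp_mulr _ (dvdpp _)) dv.
rewrite mulrC in e1.
have Cp1 := dvd_XsubC_over ringC Cxi Cp e1.
have [|q e2 Cq] := IH p1 Cp1.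
  by move: dv; rewrite e1 dvdp_mul2l ?polyXsubC_eq0.
by exists q; rewrite // e1 e2 mulrA.
Qed.

Lemma horner_subring (F : fieldType) (S : set F) (q : {poly F}) x :
  is_subring S -> (forall i, S q`_i) -> S x -> S q.[x].
Proof.
move=> ringS Sq Sx; rewrite horner_coef; apply: subring_sum => // i _.
by apply: subringM => //; exact: subringX.
Qed.

Section Phi.
Variables (n : nat) (B : 'M[int]_n) (psi : 'M[int]_(n, 2)).
Hypothesis psi_surj : forall y, exists x : 'rV[int]_n, x *m psi = y.
Hypothesis psi_skew : forall x y, skew B x y = wedge (x *m psi) (y *m psi).
Local Notation M := 'rV[int]_n.

(** The embedding of [N/K] into [M] dual to the quotient map. *)
Definition phi (u : Z2) : M := \row_i wedge u (row i psi).

Lemma pairing_phi x u : pairing x (phi u) = wedge u (x *m psi).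
Proof.
rewrite pairingE mulmx_sum_row wedge_sumr; apply: eq_bigr => i _.
by rewrite wedgeZr mxE.
Qed.

Lemma phiD u v : phi (u + v) = phi u + phi v.
Proof. by apply/rowP => i; rewrite !mxE wedgeDl. Qed.

Lemma phiZ (c : int) u : phi (c *: u) = c *: phi u.
Proof. by apply/rowP => i; rewrite !mxE wedgeZl. Qed.

Lemma phi_inj u v : phi u = phi v -> u = v.
Proof.
move=> e; have h y : wedge u y = wedge v y.
  by have [x <-] := psi_surj y; rewrite -!pairing_phi e.
have := h (\row_j (if j == 0 then 1 else 0)); have := h (\row_j (if j == 0 then 0 else 1)).
by rewrite /wedge !mxE /= !mulr1 !mulr0 !subr0 !sub0r => h0 /oppr_inj h1; exact: Z2P.
Qed.

Lemma pairing_sep (m m' : M) : (forall x, pairing x m = pairing x m') -> m = m'.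
Proof.
move=> h; apply/eqP; rewrite -subr_eq0; apply: contraT => /pairing_neq0.
by rewrite -scaleN1r pairingDr pairingZr -h mulN1r subrr eqxx.
Qed.

Lemma phi_psi x : phi (x *m psi) = x *m B.
Proof. by apply: pairing_sep => z; rewrite pairing_phi pairing_mulmx psi_skew. Qed.

(** Both vectors come from the plane, where two vectors with wedge product 0 are proportional. *)
Lemma phi_parallel x y : skew B x y = 0 ->
  exists c d : int, (c != 0) || (d != 0) /\ d *: (x *m B) = c *: (y *m B).
Proof.
rewrite psi_skew -!phi_psi; set p := x *m psi; set q := y *m psi => pq.
have pqE : p 0 0 * q 0 1 = p 0 1 * q 0 0 by apply/eqP; rewrite -subr_eq0; apply/eqP; exact: pq.
have [nz|] := boolP ((p 0 0 != 0) || (q 0 0 != 0)).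
  exists (p 0 0), (q 0 0); split=> //; rewrite -!phiZ; congr phi.
  by apply: Z2P; rewrite mxE [RHS]mxE ?pqE mulrC.
rewrite negb_or !negbK => /andP [/eqP p0 /eqP q0].
have [nz|] := boolP ((p 0 1 != 0) || (q 0 1 != 0)).
  exists (p 0 1), (q 0 1); split=> //; rewrite -!phiZ; congr phi.
  by apply: Z2P; rewrite mxE [RHS]mxE mulrC ?pqE.
rewrite negb_or !negbK => /andP [/eqP p1 /eqP q1].
exists 1, 1; split=> //; rewrite -!phiZ; congr phi.
by apply: Z2P; rewrite mxE [RHS]mxE ?p0 ?q0 ?p1 ?q1.
Qed.
End Phi.

Section Core.
Variables (F : fieldType) (C : set F) (n : nat) (B e : 'M[int]_n) (psi : 'M[int]_(n, 2)).
Variables (T chi : 'rV[int]_n -> F) (V : seq Z2) (nx pv : Z2 -> Z2) (k0 : 'I_n).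
Hypothesis ringC : is_subring C.
Hypotheses (Tchar : is_char T) (CT : forall x, C (T x)) (Tinj : forall x, T x = 1 -> x = 0).
Hypothesis Bskew : B^T = - B.
Hypothesis psi_surj : forall y, exists x : 'rV[int]_n, x *m psi = y.
Hypothesis psi_skew : forall x y, skew B x y = wedge (x *m psi) (y *m psi).
Hypothesis e_unit : e \in unitmx.
Hypothesis cyc : ray_cycle (wray psi e) V nx pv.
Hypotheses (hc : is_char chi) (li : lin_indep C chi).
Local Notation M := 'rV[int]_n.
Local Notation w := (wray psi e).
Local Notation phi := (phi psi).
Local Notation span := (span C).

Let parallel := phi_parallel psi_skew.

Lemma w_neq0 k : w k != 0.
Proof.
apply/eqP => w0; have := rc_wnx cyc (rc_w cyc k).
by rewrite w0 wedge0l.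
Qed.

Lemma phi0 : phi 0 = 0.
Proof. by apply/rowP => i; rewrite !mxE wedge0l. Qed.

Lemma vE k : row k e *m B = phi (w k).
Proof. by rewrite -(phi_psi psi_skew). Qed.

Lemma v_neq0 k : row k e *m B != 0.
Proof.
rewrite vE; apply: contra (w_neq0 k) => /eqP h; apply/eqP.
by apply: (phi_inj psi_surj); rewrite h phi0.
Qed.

Lemma initial_good : good_seed C B chi e.
Proof.
split=> //; last exact: v_neq0.
by move=> r /(congr1 (fun m => m *m invmx e)); rewrite mulmxK // mul0mx.
Qed.

Let free := let: And4 _ _ h _ := initial_good in h.

Definition sections : set F := [set f | forall w, span (word_char B T chi e w) f].

Lemma sectionsP f : sections f <-> upper_bound C B T chi e f.
Proof.
split=> [h|ub wd]; last exact: (upper_bound_all ringC Tchar CT Tinj Bskew parallel wd initial_good ub).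
by split=> [|k]; [exact: (h [::])|exact: (h [:: k])].
Qed.

Lemma sections_ring : is_subring sections.
Proof.
have sw wd := span_ring ringC (word_char_char ringC CT Bskew wd initial_good).
split=> [wd|x y hx hy wd|x y hx hy wd]; first exact: subring1 (sw wd).
  exact: (subringB (sw wd) (hx wd) (hy wd)).
exact: (subringM (sw wd) (hx wd) (hy wd)).
Qed.

Definition deg (m : M) : int := \sum_k pairing (row k e) m.

Lemma degD m m' : deg (m + m') = deg m + deg m'.
Proof. by rewrite -big_split; apply: eq_bigr => k _; rewrite pairingDr. Qed.

(** The root of the binomial [1 + T (row k e) 'X]. *)
Definition xi k := - T (- row k e).

Lemma T_neq0 x : T x != 0. Proof. exact: char_neq0. Qed.

Lemma xi_neq0 k : xi k != 0. Proof. by rewrite oppr_eq0 T_neq0. Qed.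

Lemma xi_inj k l : w k = w l -> xi k = xi l -> k = l.
Proof.
move=> _ /oppr_inj; rewrite !charN // => /invr_inj Tkl.
apply/eqP; apply: contraT => kl.
have := rows_independent (d := 1) (c := 1) free kl isT.
rewrite !scale1r => /eqP []; apply: Tinj.
by rewrite (proj2 Tchar) charN // Tkl divff ?T_neq0.
Qed.

(** A multiplicative relation between the roots is a linear relation between the rows of [e]. *)
Lemma xi_gen (r : 'I_n -> nat) : \prod_(k < n) (- xi k) ^+ r k = 1 -> forall k, r k = 0%N.
Proof.
have TD (s : seq 'I_n) : \prod_(k <- s) (- xi k) ^+ r k = T (\sum_(k <- s) (- row k e) *+ r k).
  elim: s => [|k s IH]; first by rewrite !big_nil (proj1 Tchar).
  by rewrite !big_cons (proj2 Tchar) IH charMn // /xi opprK.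
rewrite TD => /Tinj h k.
have r0 : (\row_k - (r k)%:Z : M) *m e = 0.
  rewrite -[RHS]h mulmx_sum_row; apply: eq_bigr => i _.
  by rewrite mxE scaleNr mulNrn -scaler_nat natz.
by have /rowP /(_ k) := free r0; rewrite !mxE => /eqP; rewrite oppr_eq0 => /eqP [].
Qed.

(** ** Divisibility along lines *)

Definition line_poly (g : malg M F) (p v : M) (K : nat) : {poly F} :=
  \poly_(i < K) mcoef g (p + i%:Z *: v).

Lemma line_poly_mulU g p v c K :
  (forall i : int, mcoef g (p + i *: v) != 0 -> 0 <= i < K%:Z - 1) ->
  line_poly (mulU v c g) p v K = (1 + c *: 'X) * line_poly g p v K.
Proof.
move=> h; apply/polyP => i; rewrite mulrDl mul1r -scalerAl coefD coefZ coefXM !coef_poly.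
have out (j : int) : ~~ (0 <= j < K%:Z - 1) -> mcoef g (p + j *: v) = 0.
  by move=> hj; apply/eqP; apply: contraNT hj; exact: h.
rewrite /mulU mcoefD mcoef_shift.
have -> : p + i%:Z *: v - v = p + (i%:Z - 1) *: v by rewrite scalerBl scale1r addrA.
case: ltnP => iK; last first.
  case: eqP => [i0|/eqP i0]; rewrite ?mulr0 ?addr0 //.
  case: ltnP => iK'; rewrite ?mulr0 ?addr0 // out ?mulr0 ?addr0 //; lia.
congr (_ + _ * _); case: eqP => [->|/eqP i0]; first by rewrite out.
rewrite ifT; last by lia.
by congr (mcoef g (_ + _ *: _)); lia.
Qed.

Lemma line_poly_iterU r g p v c K :
  (forall i : int, mcoef g (p + i *: v) != 0 -> 0 <= i < K%:Z - r%:Z) ->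
  (forall i : int, mcoef (iter r (mulU v c) g) (p + i *: v) != 0 -> 0 <= i < K%:Z) /\
  line_poly (iter r (mulU v c) g) p v K = (1 + c *: 'X) ^+ r * line_poly g p v K.
Proof.
elim: r K => [|r IH] K h.
  by split=> [i /h|]; [lia|rewrite expr0 mul1r].
have [|h1 h2] := IH K; first by move=> i /h; lia.
have [|h3 _] := IH K.-1; first by move=> i /h; lia.
split.
  move=> i /=; rewrite /mulU mcoefD mcoef_shift.
  have -> : p + i *: v - v = p + (i - 1) *: v by rewrite scalerBl scale1r addrA.
  have [->|/h3] := eqVneq (mcoef (iter r (mulU v c) g) (p + i *: v)) 0; last by lia.
  have [->|/h3] := eqVneq (mcoef (iter r (mulU v c) g) (p + (i - 1) *: v)) 0; last by lia.
  by rewrite mulr0 addr0 eqxx.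
rewrite iterS line_poly_mulU; first by rewrite h2 mulrA -exprS.
by move=> i /h3; lia.
Qed.

Lemma line_bound (g : malg M F) (p v : M) : v != 0 -> exists N : nat,
  forall i : int, mcoef g (p + i *: v) != 0 -> (absz i <= N)%N.
Proof.
move=> v0; exists (\max_(m <- monalg.msupp g) absz (pairing v m) + absz (pairing v p))%N => i.
rewrite -mcoef_neq0 => ms.
have := @leq_bigmax_seq _ _ xpredT (fun m => absz (pairing v m)) _ ms isT.
move: (\max_(_ <- _) _)%N => K /=; rewrite pairingDr pairingZr; move: (pairing_neq0 v0); move: (pairing v v) => q q0.
have : (absz i <= absz (i * q)%R)%N by rewrite abszM leq_pmulr // absz_gt0.
by move: (i * q) (pairing v p) => iq vp; lia.
Qed.

Section Coset.
Variables (c : malg M F) (m : M).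
Hypotheses (Cc : Cval C c) (cs : sections (ev chi c)).

Definition coset_fun (u : Z2) : F := mcoef c (m + phi u).

(** By [mutated_divisible], level [- r] of [c] is divisible by the power [r] of the binomial of the
    mutation at [k]. The exponents of this binomial point along [w k], so on each line of this
    direction it becomes a power of ['X - xi k] up to a constant. *)
Lemma coset_fun_divisible k :
  line_divisible w xi (fun k => pairing (row k e) m) coset_fun k.
Proof.
move=> u N win; set r := order_at _.
have [r0|rpos] := posnP r; first by rewrite r0 expr0 dvd1p.
pose q := m + phi u; pose v := phi (w k).
have qr : pairing (row k e) q = - r%:Z.
  by rewrite pairingDr pairing_phi; move: rpos; rewrite /r /order_at /wray; lia.
have v0 : v != 0 by rewrite /v -vE v_neq0.
have ker : pairing (row k e) v = 0 by rewrite pairing_phi wedgexx.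
have [_ /(_ k) sk] := (sectionsP _).1 cs.
have U0 := one_plus_neq0 ringC hc li (CT (row k e)) (v_neq0 k).
have self : pairing (row k e) (row k e *m B) = 0 by rewrite vE.
have [h Ch hE] := mutated_divisible ringC hc (pairingDr (row k e)) self (CT (row k e)) U0 li Cc sk r.
rewrite vE -/v in hE.
set lv := level _ _ in hE.
have lvE (g : malg M F) (i : int) : mcoef (lv g) (q + i *: v) = mcoef g (q + i *: v).
  by rewrite mcoef_level pairingDr pairingZr ker qr mulr0 addr0 eqxx.
have [N1 hN1] := line_bound h q v0.
pose K1 := N1; pose K := (K1 + K1 + N + r + 1)%N.
pose p := q - K1%:Z *: v.
have pE (i : int) : p + i *: v = q + (i - K1%:Z) *: v.
  by rewrite /p scalerBl addrA addrAC.
have [|_ lpE] := @line_poly_iterU r (lv h) p v (T (row k e)) K.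
  by move=> i; rewrite pE lvE => /hN1; rewrite /K /K1; lia.
have cwin (i : int) : mcoef c (q + i *: v) != 0 -> 0 <= i < N%:Z.
  by move=> ci; apply: win; rewrite /coset_fun phiD phiZ addrA.
have shiftE : line_poly (lv c) p v K = 'X^K1 * \poly_(i < N) coset_fun (u + i%:Z *: w k).
  apply/polyP => i; rewrite coefXnM !coef_poly pE lvE.
  have [iK1|iK1] := ltnP i K1.
    case: ifP => // _; apply/eqP; apply: contraTT isT => /cwin; lia.
  rewrite /coset_fun phiD phiZ addrA -/q -/v.
  have -> : i%:Z - K1%:Z = (i - K1)%N by lia.
  case: ltnP => iK; case: ltnP => iN //; last by rewrite /K in iK; lia.
  by apply/eqP; apply: contraTT isT => /cwin; lia.
have : (1 + T (row k e) *: 'X) ^+ r %| 'X^K1 * \poly_(i < N) coset_fun (u + i%:Z *: w k).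
  by rewrite -shiftE hE lpE dvdp_mulr.
have -> : 1 + T (row k e) *: 'X = T (row k e) *: ('X - (xi k)%:P) :> {poly F}.
  rewrite scalerBr -[_ *: _%:P]mul_polyC -polyCM /xi mulrN -(proj2 Tchar) subrr (proj1 Tchar).
  by rewrite polyCN opprK addrC.
rewrite exprZn dvdpZl ?expf_neq0 ?T_neq0 // Gauss_dvdpr //.
apply: coprimep_expl; apply: coprimep_expr.
by rewrite coprimepX root_XsubC eq_sym xi_neq0.
Qed.

(** On the coset of [m] all exponents have the same degree, so [degree0_support] leaves only the
    exponent [m], with [<e_k, m> = 0] for all [k]; the [e_k] form a basis. *)
Lemma section_degree : mcoef c m != 0 -> deg m <= 0 -> m = 0.
Proof.
move=> cm dm.
pose supp := [seq xget 0 [set u | m + phi u = x] | x <- monalg.msupp c].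
have sup u : coset_fun u != 0 -> u \in supp.
  rewrite /coset_fun -mcoef_neq0 => us; apply/mapP; exists (m + phi u) => //.
  have ux : [set u' | m + phi u' = m + phi u] u by [].
  by have /= /addrI /(phi_inj psi_surj) -> := xgetI 0 ux.
have g0 : coset_fun 0 != 0 by rewrite /coset_fun phi0 addr0.
have [ak _] := degree0_support cyc sup xi_inj xi_gen coset_fun_divisible k0 dm g0.
have : e *m m^T = 0.
  apply/colP => k; have := ak k; rewrite wedge0l addr0 => h.
  rewrite !mxE -[RHS]h pairingE; apply: eq_bigr => j _; by rewrite !mxE.
move=> /(congr1 (mulmx (invmx e))); rewrite mulKmx // mulmx0 => /(congr1 trmx).
by rewrite trmxK trmx0.
Qed.
End Coset.

(** ** Sections of degree one *)

(** The functions of [sections_exist] are the coefficients of sections on the coset of [m1], where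
    [<e_k0, m1> = 1] and [<e_k, m1> = 0] for the other [k]; their degree is one by [sum_w]. *)
Lemma sections_unbounded (S0 : seq M) : exists c : malg M F,
  [/\ Cval C c, sections (ev chi c), exists m, mcoef c m != 0,
      forall m, mcoef c m != 0 -> deg m = 1 & forall m, m \in S0 -> mcoef c m = 0].
Proof.
pose m1 : M := (col k0 (invmx e))^T.
have m1E k : pairing (row k e) m1 = (k == k0)%:Z.
  transitivity ((e *m invmx e) k k0); last by rewrite mulmxV // mxE; case: (k == k0).
  by rewrite pairingE mxE; apply: eq_bigr => j _; rewrite !mxE.
have pairE k u : pairing (row k e) (m1 + phi u) = (k == k0)%:Z + wedge u (w k).
  by rewrite pairingDr m1E pairing_phi.
have deg1 u : deg (m1 + phi u) = 1.
  rewrite /deg (eq_bigr _ (fun k _ => pairE k u)) big_split /= -wedge_sumr (sum_w cyc).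
  rewrite wedge0r addr0 (bigD1 k0) //= eqxx big1 ?addr0 // => i /negbTE -> //.
pose S := [seq xget 0 [set u | m1 + phi u = x] | x <- S0].
pose mm := size S0; pose pts := bpoints w V nx mm.
pose K := (\max_(u <- pts) \max_(k < n) absz (wedge u (nx (w k))))%N.
have Kb k u : u \in pts -> 0 <= wedge u (nx (w k)) + K%:Z.
  move=> us; have h1 := @leq_bigmax_seq _ pts xpredT (fun u => \max_(k < n) absz (wedge u (nx (w k))))%N u us isT.
  have h2 := @leq_bigmax_cond _ xpredT (fun k => absz (wedge u (nx (w k)))) k isT.
  have : (absz (wedge u (nx (w k))) <= K)%N by exact: leq_trans h2 h1.
  lia.
have Cxi k : C (xi k) by apply: subringN.
have [|g [Cg [u0 u0p gu0] gS gout gdiv]] := sections_exist cyc k0 ringC Cxi K (m := mm) (S := S).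
  by rewrite size_map.
pose c : malg M F := \sum_(u <- pts) mono (g u) (m1 + phi u).
have csup m : mcoef c m != 0 -> exists2 u, u \in pts & m = m1 + phi u.
  move=> h; apply: contrapT => no; move/eqP: h; apply; rewrite mcoef_sum big_seq big1 // => u us.
  apply/eqP; apply: contraT => /mcoefU_neq0 mE; case: no; by exists u.
have cE u : mcoef c (m1 + phi u) = g u.
  have [us|us] := boolP (u \in pts); last first.
    rewrite gout //; apply/eqP; apply: contraT => /csup [u' u's] /addrI /(phi_inj psi_surj) uu.
    by move: us; rewrite uu u's.
  rewrite mcoef_sum (bigD1_seq u) ?(bpoints_uniq cyc) //= mcoefU eqxx mulr1n big1 ?addr0 // => u' uu'.
  apply/eqP; apply: contraT => /mcoefU_neq0 /addrI /(phi_inj psi_surj) e1.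
  by move: uu'; rewrite e1 eqxx.
exists c; split.
- by apply: Cval_sum => // u _; exact: (Cval_mono ringC).
- apply/sectionsP; split=> [|k].
    by exists c => //; apply: Cval_sum => // u _; exact: (Cval_mono ringC).
  set chik := mut B T chi e k.
  have hck : is_char chik := mut_char ringC CT k initial_good.
  have sR := span_ring ringC hck.
  pose a m := pairing (row k e) m; pose v := phi (w k); pose U := 1 + T (row k e) * chi v.
  have U0 : U != 0 by rewrite /U /v -vE; exact: (one_plus_neq0 ringC hc li (CT _) (v_neq0 k)).
  have chikE m : chik m = chi m * U ^ (- a m) by rewrite /chik /mut /mutated vE.
  have av : a v = 0 by rewrite /a /v pairing_phi wedgexx.
  have chiv : chi v = chik v by rewrite chikE av oppr0 expr0z mulr1.
  have sv : span chik (chi v) by rewrite chiv; exact: span_char.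
  have sU : span chik U.
    apply: (subringD sR); first exact: (subring1 sR).
    by apply: (subringM sR) => //; exact: span_scalar.
  have UE : chi v - xi k = T (- row k e) * U.
    rewrite /U mulrDr mulr1 mulrA -(proj2 Tchar) addNr (proj1 Tchar) mul1r.
    by rewrite /xi opprK addrC.
  have -> : ev chi c = \sum_(u <- pts) g u * chi (m1 + phi u).
    by rewrite ev_sum; apply: eq_bigr => u _; rewrite evU.
  have lev : \sum_(u <- pts) g u * chi (m1 + phi u) =
     \sum_(j <- undup [seq wedge u (w k) | u <- pts])
       \sum_(u <- pts | wedge u (w k) == j) g u * chi (m1 + phi u).
    under [RHS]eq_bigr => j _ do rewrite big_mkcond.
    rewrite exchange_big; apply: eq_big_seq => u us /=.
    have lu : wedge u (w k) \in undup [seq wedge u (w k) | u <- pts].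
      by rewrite mem_undup; exact: (map_f (fun u => wedge u (w k))).
    rewrite (bigD1_seq _ lu (undup_uniq _)) /= eqxx big1 ?addr0 //.
    by move=> j; rewrite eq_sym => /negbTE ->.
  rewrite lev; apply: (subring_sum sR) => j _.
  pose b := nx (w k); pose mj := m1 + phi (- K%:Z *: w k - j *: b).
  have wb : wedge (w k) b = 1 := rc_wnx cyc (rc_w cyc k).
  have amj : a mj = (k == k0)%:Z + j.
    by rewrite /a /mj pairE !wedgeE mulr0 add0r (wedgeC b) wb; ring.
  have -> : \sum_(u <- pts | wedge u (w k) == j) g u * chi (m1 + phi u) =
      chi mj * (level_poly w nx pts g K k j).[chi v].
    rewrite /level_poly horner_sum mulr_sumr big_seq_cond [RHS]big_seq_cond.
    apply: eq_bigr => u /andP [us /eqP uj].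
    rewrite hornerZ hornerXn mulrCA; congr (_ * _).
    rewrite -charMn // -(proj2 hc); congr chi; rewrite /mj -addrA; congr (_ + _).
    rewrite -scaler_nat natz /line_index gez0_abs ?Kb // -phiZ -phiD; congr phi.
    rewrite {1}(wedge_basis u wb) (wedgeC (w k) u) uj -/b; apply: Z2P; rewrite !mxE; ring.
  have Cl i : C (level_poly w nx pts g K k j)`_i.
    rewrite /level_poly coef_sum; apply: subring_sum => // u _.
    by rewrite coefZ coefXn; apply: subringM => //; exact: subring_nat.
  have [q -> Cq] := dvd_XsubC_exp_over ringC (Cxi k) Cl (gdiv k j).
  rewrite hornerM horner_exp hornerXsubC UE mulrA; apply: (subringM sR); last first.
    by apply: (horner_subring sR) => // i; exact: span_scalar.
  rewrite exprMn mulrCA; apply: (subringM sR).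
    by apply: (subringX sR); exact: span_scalar.
  rewrite -amj; have [le|/ltW ge] := leP (a mj) 0.
    rewrite (_ : chi mj * _ = chik mj); first exact: span_char.
    by rewrite chikE exprnP; congr (_ * _ ^ _); rewrite /order_at; lia.
  rewrite (_ : order_at _ = 0%N) ?expr0 ?mulr1; last by rewrite /order_at; lia.
  have -> : chi mj = chik mj * U ^+ absz (a mj).
    by rewrite chikE -mulrA exprnP gez0_abs // -expfzDr // addNr expr0z mulr1.
  by apply: (subringM sR); [exact: span_char|exact: (subringX sR)].
- by exists (m1 + phi u0); rewrite cE.
- by move=> m /csup [u _ ->].
move=> m mS0; apply/eqP; apply: contraT => cm; have [u up mE] := csup m cm.
move: cm; rewrite mE cE gS ?eqxx //; apply/mapP; exists m => //.
have ux : [set u' | m1 + phi u' = m] u by [].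
by have /= := xgetI 0 ux; rewrite mE => /addrI /(phi_inj psi_surj) ->.
Qed.

(** The sections all of whose exponents have positive degree form an ideal. If it had finitely many
    generators, an element of degree one would be a combination of them in which only the constant
    parts of the coefficients contribute, by [section_degree]. So its exponents would belong to the
    finite set of exponents of the generators, against [sections_unbounded]. *)
Theorem sections_not_noetherian : ~ noetherian sections.
Proof.
move=> noeth.
pose I : set F := [set f | sections f /\ exists2 c, Cval C c &
  f = ev chi c /\ forall m, mcoef c m != 0 -> 0 < deg m].
have degB m m' : deg (m - m') = deg m - deg m' by apply/eqP; rewrite eq_sym subr_eq -degD subrK.
have deg_ge0 c : Cval C c -> sections (ev chi c) -> forall m, mcoef c m != 0 ->
    0 <= deg m /\ (deg m = 0 -> m = 0).
  move=> Cc sc m cm; split.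
    rewrite leNgt; apply/negP => lt0; have m0 := section_degree Cc sc cm (ltW lt0).
    by move: lt0; rewrite m0 (_ : deg 0 = 0) //; apply: (addrI (deg 0)); rewrite -degD !addr0.
  by move=> d0; apply: (section_degree Cc sc cm); rewrite d0.
have Iid : is_ideal sections I.
  split.
  - by move=> f [].
  - split; first exact: subring0 sections_ring.
    exists 0; first by move=> m; rewrite mcoef0; exact: subring0.
    by rewrite ev0; split=> // m; rewrite mcoef0 eqxx.
  - move=> x y [sx [c Cc [xE xd]]] [sy [d Cd [yE yd]]]; split.
      exact: (subringD sections_ring sx sy).
    exists (c + d); first exact: CvalD.
    split=> [|m]; first by rewrite ev_is_additive xE yE.
    rewrite mcoefD => h; have [c0|/xd //] := eqVneq (mcoef c m) 0.
    by apply: yd; move: h; rewrite c0 add0r.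
  - move=> a x sa [sx [c Cc [xE xd]]]; split; first exact: (subringM sections_ring sa sx).
    have [d Cd dE] := sa [::]; exists (conv d c); first exact: Cval_conv.
    split=> [|m]; first by rewrite ev_conv // xE dE.
    rewrite mcoef_conv => h.
    have [v dv cv] : exists2 v, mcoef d v != 0 & mcoef c (m - v) != 0.
      apply: contrapT => no; move/eqP: h; apply; apply: big1 => v _.
      have [->|dv] := eqVneq (mcoef d v) 0; first by rewrite mul0r.
      have [->|cv] := eqVneq (mcoef c (m - v)) 0; first by rewrite mulr0.
      by case: no; exists v.
    have := xd _ cv; rewrite degB; have [|d0 _] := deg_ge0 d Cd _ v dv; first by rewrite -dE.
    lia.
have [r [g [Ig gen]]] := noeth I Iid.
have ch i : exists c, Cval C c /\ g i = ev chi c.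
  by have [_ [c Cc [gE _]]] := Ig i; exists c.
have [cg cgP] := boolp.choice ch.
pose S0 := flatten [seq enum_fset (monalg.msupp (cg i)) | i <- enum 'I_r].
have [c [Cc sc [m cm] cd cS]] := sections_unbounded S0.
have If : I (ev chi c) by split=> //; exists c => //; split=> // x /cd ->.
have [a [sa fE]] := gen _ If.
have ch2 i : exists d, Cval C d /\ a i = ev chi d.
  by have [d Cd dE] := sa i [::]; exists d.
have [da daP] := boolp.choice ch2.
have ce : c = \sum_(i < r) conv (da i) (cg i).
  apply: (ev_inj ringC li) => //.
    by apply: Cval_sum => // i _; apply: Cval_conv => //; [exact: (daP i).1|exact: (cgP i).1].
  rewrite fE ev_sum; apply: eq_bigr => i _.
  by rewrite ev_conv // (daP i).2 (cgP i).2.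
have [i im] : exists i, mcoef (conv (da i) (cg i)) m != 0.
  apply: contrapT => no; move/eqP: cm; apply; rewrite ce mcoef_sum big1 // => i _.
  by apply/eqP; apply: contraT => h; case: no; exists i.
have [v dv cv] : exists2 v, mcoef (da i) v != 0 & mcoef (cg i) (m - v) != 0.
  apply: contrapT => no; move/eqP: im; apply; rewrite mcoef_conv; apply: big1 => v _.
  have [->|dv] := eqVneq (mcoef (da i) v) 0; first by rewrite mul0r.
  have [->|cv] := eqVneq (mcoef (cg i) (m - v)) 0; first by rewrite mulr0.
  by case: no; exists v.
have [_ [c' Cc' [gE gd]]] := Ig i.
have cc' : cg i = c' by apply: (ev_inj ringC li) => //; [exact: (cgP i).1|rewrite -gE (cgP i).2].
have d1 : 0 < deg (m - v) by apply: gd; rewrite -cc'.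
have [||d0 d0'] := deg_ge0 (da i) _ _ v dv; first exact: (daP i).1.
  by rewrite -(daP i).2; exact: sa.
have v0 : v = 0 by apply: d0'; move: d1; rewrite degB (cd m cm); lia.
move: cm; rewrite cS ?eqxx //; apply/flattenP; exists (enum_fset (monalg.msupp (cg i))).
  by apply: map_f; rewrite mem_enum.
by move: cv; rewrite v0 subr0 -mcoef_neq0.
Qed.

End Core.

(** * Places of a rational function field *)

Section Places.
Variable k : fieldType.
Implicit Types (p q pi : {poly k}).

Definition monic_irreducible pi := pi \is monic /\ irreducible_poly pi.

Lemma irr_neq0 pi : monic_irreducible pi -> pi != 0.
Proof. by case=> /monic_neq0. Qed.

Lemma irr_size pi : monic_irreducible pi -> (1 < size pi)%N.
Proof. by case=> _ []. Qed.

Lemma irr_coprime pi q : monic_irreducible pi -> coprimep pi q = ~~ (pi %| q).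
Proof.
move=> ip; have [mp [sp ip']] := ip; apply/idP/idP => [cop|ndv].
  apply/negP => dv; move: cop; rewrite coprimep_def => /eqP.
  have g0 : gcdp pi q != 0 by rewrite gcdp_eq0 negb_and irr_neq0.
  have := dvdp_leq g0 (_ : pi %| gcdp pi q); rewrite dvdp_gcd dvdpp dv => /(_ isT).
  by move=> + e; rewrite e leqNgt sp.
rewrite coprimep_def; apply: contraT => h.
have e := ip' _ h (dvdp_gcdl pi q); move: ndv.
by rewrite -(eqp_dvdl _ e) dvdp_gcdr.
Qed.

Lemma irr_mul pi p q : monic_irreducible pi -> pi %| p * q = (pi %| p) || (pi %| q).
Proof.
move=> ip; apply/idP/orP => [dv|[h|h]]; [|exact: dvdp_mulr|exact: dvdp_mull].
have [|nd] := boolP (pi %| p); first by left.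
by right; rewrite -(Gauss_dvdpr q (_ : coprimep pi p)) // irr_coprime.
Qed.

Lemma irr_dvd_irr pi q : monic_irreducible pi -> monic_irreducible q -> pi %| q -> pi = q.
Proof.
move=> [mp [sp ip]] [mq [sq iq]] dv; apply/eqP; rewrite -eqp_monic //; apply: iq => //.
by rewrite neq_ltn sp orbT.
Qed.

Lemma irr_XsubC c : monic_irreducible ('X - c%:P).
Proof.
split; first exact: monicXsubC.
split; first by rewrite size_XsubC.
move=> q sq dv; rewrite -dvdp_size_eqp //; rewrite size_XsubC.
have := dvdp_leq (monic_neq0 (monicXsubC c)) dv; rewrite size_XsubC.
have : size q != 0%N by rewrite size_poly_eq0; apply: contraTneq dv => ->; rewrite dvd0p -size_poly_eq0 size_XsubC.
by move: (size q) sq => [|[|[|]]].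
Qed.

(** The multiplicity of [pi] in [p]; for [p] nonzero it is less than [size p]. *)
Definition mu pi p : nat := \max_(e < size p | pi ^+ e %| p) e.

Lemma mu_decomp pi p : monic_irreducible pi -> p != 0 ->
  exists (m : nat) p', p = pi ^+ m * p' /\ ~~ (pi %| p').
Proof.
move=> ip; have [N] := ubnP (size p); elim: N p => // N IH p sN p0.
have [dv|nd] := boolP (pi %| p); last by exists 0%N, p; rewrite mul1r.
have /dvdpP [q e] := dv; have q0 : q != 0 by apply: contraNneq p0 => q0; rewrite e q0 mul0r.
have [|m [p' [qe nd]]] := IH q _ q0.
  have s1 := irr_size ip; apply: leq_trans (_ : size p <= N)%N => //.
  rewrite e size_mul ?(irr_neq0 ip) //; move: (size q) (size pi) s1 => a b. lia.
by exists m.+1, p'; split=> //; rewrite e qe exprSr mulrAC.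
Qed.

Lemma mu_unique pi m p' : monic_irreducible pi -> p' != 0 -> ~~ (pi %| p') ->
  mu pi (pi ^+ m * p') = m.
Proof.
move=> ip p0 nd; have s1 := irr_size ip; have pi0 := irr_neq0 ip.
have dvE e : (pi ^+ e %| pi ^+ m * p') = (e <= m)%N.
  apply/idP/idP => [|em]; last by rewrite -(subnKC em) exprD -mulrA dvdp_mulr.
  apply: contraTT; rewrite -ltnNge => me.
  rewrite -(subnKC me) addSnnS exprD dvdp_mul2l ?expf_neq0 // exprS.
  by apply: contra nd => /(dvdp_trans _); apply; rewrite dvdp_mulr.
have ms : (m < size (pi ^+ m * p')%R)%N.
  have mm : (m < size (pi ^+ m)%R)%N.
    elim: (m) => [|j IH]; first by rewrite expr0 size_poly1.
    by rewrite exprS size_mul ?expf_neq0 //; move: (size pi) (size (pi ^+ j)%R) s1 IH => a b; lia.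
  apply: leq_trans mm _; rewrite dvdp_leq ?dvdp_mulr //.
  by rewrite mulf_neq0 ?expf_neq0.
apply/eqP; rewrite eqn_leq; apply/andP; split.
  by apply/bigmax_leqP => e; rewrite dvE.
by apply: (@leq_bigmax_cond _ _ _ (Ordinal ms)); rewrite dvE.
Qed.

Lemma muM pi p q : monic_irreducible pi -> p != 0 -> q != 0 ->
  mu pi (p * q) = (mu pi p + mu pi q)%N.
Proof.
move=> ip p0 q0; have [m [p' [pe np]]] := mu_decomp ip p0.
have [l [q' [qe nq]]] := mu_decomp ip q0.
have p'0 : p' != 0 by apply: contraNneq np => ->; exact: dvdp0.
have q'0 : q' != 0 by apply: contraNneq nq => ->; exact: dvdp0.
rewrite pe qe (_ : _ * _ = pi ^+ (m + l) * (p' * q')); last by rewrite exprD; ring.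
by rewrite !mu_unique // ?mulf_neq0 // irr_mul // negb_or np.
Qed.

Lemma mu_ndvd pi p : monic_irreducible pi -> ~~ (pi %| p) -> mu pi p = 0%N.
Proof.
move=> ip nd; rewrite -[p]mul1r -(expr0 pi) mu_unique //.
by apply: contraNneq nd => ->; exact: dvdp0.
Qed.

Lemma mu_irr pi q : monic_irreducible pi -> monic_irreducible q -> mu pi q = (pi == q).
Proof.
move=> ip iq; have [->|nq] := eqVneq pi q.
  have := @mu_unique q 1 1 iq (oner_neq0 _); rewrite expr1 mulr1; apply.
  by apply/negP => /(dvdp_leq (oner_neq0 _)); rewrite size_poly1; have := irr_size iq; case: (size q) => [|[]].
by rewrite mu_ndvd //; apply: contra nq => /irr_dvd_irr ->.
Qed.

(** The places of [k(y)]: [None] is the pole of [y]. *)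
Definition place := option {poly k}.
Definition is_place : set place := [set pl | if pl is Some pi then monic_irreducible pi else True].

(** The order at a place times the degree of its residue field. *)
Definition place_val (pl : place) p : int :=
  if pl is Some pi then ((size pi).-1 * mu pi p)%N%:Z else 1 - (size p)%:Z.

Lemma place_valM pl p q : is_place pl -> p != 0 -> q != 0 ->
  place_val pl (p * q) = place_val pl p + place_val pl q.
Proof.
case: pl => [pi ip|_] p0 q0 /=; first by rewrite muM // mulnDr PoszD.
by rewrite size_mul //; move: p0 q0; rewrite -!size_poly_gt0; move: (size p) (size q) => a b; lia.
Qed.

Lemma irr_factor p : (1 < size p)%N -> exists2 pi, monic_irreducible pi & pi %| p.
Proof.
have [N] := ubnP (size p); elim: N p => // N IH p sN s1.
have p0 : p != 0 by rewrite -size_poly_gt0; lia.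
have l0 : lead_coef p != 0 by rewrite lead_coef_eq0.
have [[q [sq dq nq]]|irr] := boolp.pselect (exists q, [/\ size q != 1%N, q %| p & ~~ (q %= p)]).
  have q0 : q != 0 by apply: contraTneq dq => ->; rewrite dvd0p.
  have lt : (size q < size p)%N.
    rewrite ltn_neqAle dvdp_leq // andbT; apply: contra nq => /eqP e.
    by rewrite -dvdp_size_eqp // e.
  have [||pi ip dp] := IH q; [lia|by move: sq; rewrite -size_poly_gt0 in q0; lia|].
  by exists pi => //; exact: dvdp_trans dq.
have eqv : (lead_coef p)^-1 *: p %= p by rewrite eqp_scale ?invr_eq0.
exists ((lead_coef p)^-1 *: p); last by rewrite (eqp_dvdl _ eqv).
split; first by rewrite monicE lead_coefZ mulVf.
split; first by rewrite (eqp_size eqv).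
move=> q sq; rewrite (eqp_dvdr _ eqv) (eqp_rtrans eqv) => dq.
by apply/negPn/negP => nq; apply: irr; exists q.
Qed.

(** By additivity it is enough to consider constants and irreducible polynomials; the only zero of
    the latter has the degree of the polynomial as its weight, which the pole compensates. The list
    [Fp] contains the zeros of [p]. *)
Lemma place_sum p : p != 0 -> exists Fp : seq place,
  (forall pl, pl \in Fp -> is_place pl) /\
  forall L : seq place, uniq L -> (forall pl, pl \in L -> is_place pl) ->
    None \in L -> {subset Fp <= L} -> \sum_(pl <- L) place_val pl p = 0.
Proof.
have [N] := ubnP (size p); elim: N p => // N IH p sN p0.
have [s1|s1] := ltnP 1 (size p); last first.
  exists [::]; split=> // L _ LP _ _.
  have sp : size p = 1%N by move: p0 s1; rewrite -size_poly_gt0; lia.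
  rewrite big_seq big1 // => -[pi|] /LP /=; last by rewrite sp.
  move=> ip; rewrite mu_ndvd ?muln0 //; apply/negP => /(dvdp_leq p0).
  by rewrite sp leqNgt irr_size.
have [pi ip /dvdpP [q e]] := irr_factor s1.
have q0 : q != 0 by apply: contraNneq p0 => q0; rewrite e q0 mul0r.
have [|Fq [FqP Fqs]] := IH q _ q0.
  have := irr_size ip; move: sN; rewrite e size_mul ?(irr_neq0 ip) //.
  by move: (size q) (size pi) => a b; lia.
exists (Some pi :: Fq); split=> [pl|L uL LP NL sub].
  by rewrite inE => /orP [/eqP -> //|/FqP].
have -> : \sum_(pl <- L) place_val pl p = \sum_(pl <- L) (place_val pl q + place_val pl pi).
  by apply: eq_big_seq => pl /LP h; rewrite e place_valM ?(irr_neq0 ip).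
rewrite big_split /= Fqs //; last by move=> pl h; apply: sub; rewrite inE h orbT.
have sL : Some pi \in L by apply: sub; rewrite inE eqxx.
rewrite add0r (bigD1_seq None) //= big_mkcond (bigD1_seq _ sL) //=.
rewrite mu_irr // eqxx muln1 big1_seq ?addr0.
  by have := irr_size ip; move: (size pi) => a; lia.
move=> [q'|] //= /andP [ne /LP /= iq'].
by rewrite mu_irr // (_ : (q' == pi) = false) ?muln0 //; apply: contraNF ne => /eqP ->.
Qed.

End Places.

(** * Divisors with a coefficient field, and their points *)

Lemma injective_row_dim (k : fieldType) (N d : nat) (f : 'rV[k]_N -> 'rV[k]_d) :
  (forall u v, f (u + v) = f u + f v) -> (forall c u, f (c *: u) = c *: f u) ->
  (forall u, f u = 0 -> u = 0) -> (N <= d)%N.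
Proof.
move=> fD fZ finj; pose A := \matrix_(i < N) f (delta_mx 0 i).
have f0 : f 0 = 0 by rewrite -(scale0r 0) fZ scale0r.
have fA v : v *m A = f v.
  rewrite mulmx_sum_row [in RHS](row_sum_delta v).
  rewrite (big_morph f fD f0); apply: eq_bigr => i _.
  by rewrite fZ rowK.
have : row_free A by apply: inj_row_free => v; rewrite fA; exact: finj.
by rewrite /row_free => /eqP <-; exact: rank_leq_col.
Qed.

Section Dvr.
Variables (k F : fieldType) (iota : {rmorphism k -> F}).

(** The value of a polynomial over [k] at [s]. *)
Definition hs (s : F) (p : {poly k}) : F := (map_poly iota p).[s].

Lemma hsD s p q : hs s (p + q) = hs s p + hs s q.
Proof. by rewrite /hs rmorphD hornerD. Qed.
Lemma hsN s p : hs s (- p) = - hs s p.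
Proof. by rewrite /hs rmorphN hornerN. Qed.
Lemma hsB s p q : hs s (p - q) = hs s p - hs s q.
Proof. by rewrite hsD hsN. Qed.
Lemma hsM s p q : hs s (p * q) = hs s p * hs s q.
Proof. by rewrite /hs rmorphM hornerM. Qed.
Lemma hsC s c : hs s c%:P = iota c.
Proof. by rewrite /hs map_polyC hornerC. Qed.
Lemma hs0 s : hs s 0 = 0.
Proof. by rewrite /hs rmorph0 horner0. Qed.
Lemma hs1 s : hs s 1 = 1.
Proof. by rewrite -[1]/(1%:P) hsC rmorph1. Qed.
Lemma hsX s : hs s 'X = s.
Proof. by rewrite /hs map_polyX hornerX. Qed.
Lemma hsXn s n p : hs s (p ^+ n) = hs s p ^+ n.
Proof. by elim: n => [|n IH]; rewrite ?expr0 ?hs1 // !exprS hsM IH. Qed.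
Lemma hsZ s c p : hs s (c *: p) = iota c * hs s p.
Proof. by rewrite -mul_polyC hsM hsC. Qed.

Variables (O K1 : set F) (x : F).

(** [O] is a discrete valuation ring with uniformizer [x] and coefficient field [K1]. *)
Record coefficient_dvr := CoefficientDvr {
  cd_O : is_subring O;
  cd_x : O x;
  cd_x0 : x != 0;
  cd_sub : K1 `<=` O;
  cd_K1 : is_subring K1;
  cd_inv : forall r, K1 r -> K1 r^-1;
  cd_split : forall f, O f -> exists r c, [/\ K1 r, O c & f = r + x * c];
  cd_indep : forall r c, K1 r -> O c -> r = x * c -> r = 0;
  cd_unit : forall r c, K1 r -> O c -> r != 0 -> O (r + x * c)^-1 }.

Hypothesis dvr : coefficient_dvr.
Let rO := cd_O dvr.
Let rK := cd_K1 dvr.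
Let Ox := cd_x dvr.

(** By [cd_split] and [cd_indep] the coefficient field is mapped isomorphically to the residue
    field, so the residue map can be given values in [K1]. *)
Definition res (f : F) : F := xget 0 [set r | K1 r /\ exists2 c, O c & f = r + x * c].

Lemma resP f : O f -> K1 (res f) /\ exists2 c, O c & f = res f + x * c.
Proof.
move=> /(cd_split dvr) [r [c [Kr Oc fE]]].
exact: (@xgetPex _ 0 [set r | K1 r /\ exists2 c, O c & f = r + x * c]
  (ex_intro _ r (conj Kr (ex_intro2 _ _ c Oc fE)))).
Qed.

Lemma res_eq r c : K1 r -> O c -> res (r + x * c) = r.
Proof.
move=> Kr Oc; have Of : O (r + x * c).
  by apply: (subringD rO); [exact: (cd_sub dvr)|exact: (subringM rO)].
have [Kr' [c' Oc' e]] := resP Of.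
apply/eqP; rewrite -subr_eq0; apply/eqP; apply: (cd_indep dvr (c := c - c')).
- exact: (subringB rK).
- exact: (subringB rO).
move: e; move: (res _) => R e; have -> : R = r + x * c - x * c' by rewrite e addrK.
by ring.
Qed.

Lemma res_K1 r : K1 r -> res r = r.
Proof. by move=> Kr; rewrite -{1}[r]addr0 -(mulr0 x) res_eq //; exact: subring0 rO. Qed.

Lemma K1_res f : O f -> K1 (res f).
Proof. by move=> /resP []. Qed.

Lemma resD f g : O f -> O g -> res (f + g) = res f + res g.
Proof.
move=> Of Og; have [Kf [c Oc ->]] := resP Of; have [Kg [d Od ->]] := resP Og.
rewrite !res_eq // addrACA -mulrDr res_eq //; [exact: (subringD rK)|exact: (subringD rO)].
Qed.

Lemma resN f : O f -> res (- f) = - res f.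
Proof.
move=> Of; have [Kf [c Oc ->]] := resP Of.
rewrite res_eq // opprD -mulrN res_eq //; [exact: (subringN rK)|exact: (subringN rO)].
Qed.

Lemma resB f g : O f -> O g -> res (f - g) = res f - res g.
Proof. by move=> Of Og; rewrite resD ?resN //; exact: (subringN rO). Qed.

Lemma resM f g : O f -> O g -> res (f * g) = res f * res g.
Proof.
move=> Of Og; have [Kf [c Oc ->]] := resP Of; have [Kg [d Od ->]] := resP Og.
rewrite !res_eq //.
rewrite (_ : _ * _ = res f * res g + x * (res f * d + c * res g + x * c * d)); last by ring.
rewrite res_eq //; first exact: (subringM rK).
apply: (subringD rO); last by apply: (subringM rO) => //; exact: (subringM rO).
by apply: (subringD rO); apply: (subringM rO) => //; apply: (cd_sub dvr).
Qed.

Lemma res1 : res 1 = 1. Proof. by apply: res_K1; exact: subring1 rK. Qed.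
Lemma res0 : res 0 = 0. Proof. by apply: res_K1; exact: subring0 rK. Qed.

Lemma resx c : O c -> res (x * c) = 0.
Proof. by move=> Oc; rewrite -[_ * _]add0r res_eq //; exact: subring0 rK. Qed.

Lemma res_eq0 f : O f -> res f = 0 -> exists2 c, O c & f = x * c.
Proof.
by move=> /resP [_ [c Oc e]] r0; exists c; rewrite // e r0 add0r.
Qed.

Lemma res_unit f : O f -> res f != 0 -> O f^-1 /\ res f^-1 = (res f)^-1.
Proof.
move=> Of r0; have Oi : O f^-1.
  by have [Kf [c Oc e]] := resP Of; rewrite e; exact: (cd_unit dvr).
split=> //; have f0 : f != 0 by apply: contraNneq r0 => ->; rewrite res0.
apply: (mulfI r0); rewrite -resM // divff // res1 divff //.
Qed.

Lemma max_idealP f : max_ideal O f <-> O f /\ res f = 0.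
Proof.
split=> [[Of h]|[Of r0]]; split=> //.
  apply/eqP; apply: contraT => r0; have [Oi _] := res_unit Of r0.
  by case: h => [f0|//]; move: r0; rewrite f0 res0 eqxx.
have [->|f0] := eqVneq f 0; [by left|right => Oi].
have := resM Of Oi; rewrite divff // res1 r0 mul0r => /eqP.
by rewrite oner_eq0.
Qed.

(** ** Places of the coefficient field [k(s)] *)
Section Place.
Variables (s : F) (pi : {poly k}).
Hypothesis Ks : forall r, K1 r <-> exists p q, hs s q != 0 /\ r = hs s p / hs s q.
Hypothesis trans : forall p, hs s p = 0 -> p = 0.
Hypothesis ip : monic_irreducible pi.

Lemma hs_neq0 p : p != 0 -> hs s p != 0.
Proof. by apply: contra => /eqP /trans ->. Qed.

Lemma hs_inj p q : hs s p = hs s q -> p = q.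
Proof.
by move=> e; apply/eqP; rewrite -subr_eq0; apply/eqP/trans; rewrite hsB e subrr.
Qed.

Lemma ndvd_neq0 q : ~~ (pi %| q) -> q != 0.
Proof. by apply: contraNneq => ->; exact: dvdp0. Qed.

Lemma hsq0 q : ~~ (pi %| q) -> hs s q != 0.
Proof. by move=> /ndvd_neq0; exact: hs_neq0. Qed.

(** The valuation ring of the place [pi] of [k(s)]. *)
Definition place_ring : set F := [set r | exists p q, ~~ (pi %| q) /\ r = hs s p / hs s q].
Definition place_max : set F :=
  [set r | exists p q, [/\ ~~ (pi %| q), pi %| p & r = hs s p / hs s q]].

Lemma place_frac p q p' q' : ~~ (pi %| q) -> ~~ (pi %| q') ->
  hs s p / hs s q = hs s p' / hs s q' -> p * q' = p' * q.
Proof.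
move=> /ndvd_neq0/hs_neq0 q0 /ndvd_neq0/hs_neq0 q'0 /eqP.
by rewrite eqr_div // -!hsM => /eqP /hs_inj.
Qed.

Lemma one_ndvd : ~~ (pi %| 1).
Proof.
by rewrite dvdp1 neq_ltn irr_size ?orbT.
Qed.

Lemma hs_place_ring p : place_ring (hs s p).
Proof. by exists p, 1; rewrite one_ndvd hs1 divr1. Qed.

Lemma place_ring_sub : place_ring `<=` K1.
Proof. by move=> r [p [q [nq ->]]]; apply/Ks; exists p, q; split=> //; exact: hsq0. Qed.

Lemma place_ring_ring : is_subring place_ring.
Proof.
split; first by rewrite -(hs1 s); exact: hs_place_ring.
- move=> _ _ [p [q [nq ->]]] [p' [q' [nq' ->]]].
  exists (p * q' - p' * q), (q * q'); split; first by rewrite irr_mul // negb_or nq.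
  by rewrite hsB !hsM -mulNr addf_div ?hsq0 // mulNr.
- move=> _ _ [p [q [nq ->]]] [p' [q' [nq' ->]]].
  exists (p * p'), (q * q'); split; first by rewrite irr_mul // negb_or nq.
  by rewrite !hsM mulf_div.
Qed.

Lemma place_maxE p q : ~~ (pi %| q) -> place_max (hs s p / hs s q) <-> pi %| p.
Proof.
move=> nq; split=> [[p' [q' [nq' dp' e]]]|dp]; last by exists p, q.
have := place_frac nq nq' e => /(congr1 (fun z => pi %| z)).
by rewrite /= !irr_mul // (negbTE nq') orbF dp'.
Qed.

Lemma place_max_hs p : place_max (hs s p) <-> pi %| p.
Proof. by rewrite -(place_maxE p one_ndvd) hs1 divr1. Qed.

Lemma place_max1 : ~ place_max 1.
Proof. by rewrite -(hs1 s) => /place_max_hs; apply/negP; exact: one_ndvd. Qed.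

Lemma place_max0 : place_max 0.
Proof. by rewrite -(hs0 s); apply/place_max_hs; exact: dvdp0. Qed.

Lemma place_maxD r r' : place_max r -> place_max r' -> place_max (r + r').
Proof.
move=> [p [q [nq dp ->]]] [p' [q' [nq' dp' ->]]].
exists (p * q' + p' * q), (q * q'); split.
- by rewrite irr_mul // negb_or nq.
- by rewrite dvdp_add // dvdp_mulr.
by rewrite hsD !hsM addf_div ?hsq0.
Qed.

Lemma place_maxM r r' : place_ring r -> place_ring r' ->
  place_max (r * r') <-> place_max r \/ place_max r'.
Proof.
move=> [p [q [nq ->]]] [p' [q' [nq' ->]]].
have nqq : ~~ (pi %| q * q') by rewrite irr_mul // negb_or nq.
rewrite mulf_div -!hsM !place_maxE // irr_mul //.
by split=> [/orP //|h]; apply/orP.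
Qed.

Lemma place_unit r : place_ring r -> ~ place_max r -> place_ring r^-1 /\ ~ place_max r^-1.
Proof.
move=> [p [q [nq ->]]]; rewrite place_maxE // => /negP np; rewrite invf_div.
by split; [exists q, p|rewrite place_maxE //; exact/negP].
Qed.

(** The valuation, weighted by the residue degree. *)
Definition has_val (r : F) (d : int) := exists p q, [/\ p != 0, q != 0, r = hs s p / hs s q
  & d = ((size pi).-1 * mu pi p)%N%:Z - ((size pi).-1 * mu pi q)%N%:Z].

Lemma has_val_unique r d d' : has_val r d -> has_val r d' -> d = d'.
Proof.
move=> [p [q [p0 q0 -> ->]]] [p' [q' [p'0 q'0 e ->]]].
have e1 : p * q' = p' * q.
  by move/eqP: e; rewrite eqr_div ?hs_neq0 // -!hsM => /eqP /hs_inj.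
have := congr1 (mu pi) e1; rewrite !muM // => e2.
have : (((size pi).-1 * (mu pi p + mu pi q')) = (size pi).-1 * (mu pi p' + mu pi q))%N by rewrite e2.
by rewrite !mulnDr; lia.
Qed.

Lemma has_valM r r' d d' : has_val r d -> has_val r' d' -> has_val (r * r') (d + d').
Proof.
move=> [p [q [p0 q0 -> ->]]] [p' [q' [p'0 q'0 -> ->]]].
exists (p * p'), (q * q'); rewrite !mulf_neq0 // !hsM mulf_div; split=> //.
rewrite !muM // !mulnDr; lia.
Qed.

Lemma has_valV r d : has_val r d -> has_val r^-1 (- d).
Proof.
move=> [p [q [p0 q0 -> ->]]]; exists q, p; rewrite p0 q0 invf_div; split=> //.
by rewrite opprB.
Qed.

Lemma has_val_unit r : place_ring r -> ~ place_max r -> has_val r 0.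
Proof.
move=> [p [q [nq ->]]]; rewrite place_maxE // => /negP np.
exists p, q; split=> //; [exact: ndvd_neq0|exact: ndvd_neq0|].
by rewrite (mu_ndvd ip np) (mu_ndvd ip nq) muln0 subrr.
Qed.

Lemma has_val_total r : K1 r -> r != 0 -> exists d, has_val r d.
Proof.
move=> /Ks [p [q [q0 rE]]] r0.
exists (((size pi).-1 * mu pi p)%N%:Z - ((size pi).-1 * mu pi q)%N%:Z), p, q; split=> //.
  by apply: contraNneq r0 => p0; rewrite rE p0 hs0 mul0r.
by apply: contraNneq q0 => ->; rewrite hs0.
Qed.

(** ** A point on the curve *)

(** [P] is the local ring of a point of a regular surface, lying on the curve with local
    ring [O] at the place [pi]; there the curve has local equation [g]. *)
Record curve_point (P : set F) (g : F) := CurvePoint {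
  cp_ring : is_subring P;
  cp_sub : P `<=` O;
  cp_place : place_ring `<=` P;
  cp_res : forall f, P f -> place_ring (res f);
  cp_gP : P g;
  cp_g0 : g != 0;
  cp_resg : res g = 0;
  cp_g : forall f, P f -> res f = 0 -> exists2 q, P q & f = g * q }.

Section Colength.
Variables (P : set F) (g g' a : F).
Hypothesis cp : curve_point P g.
Hypothesis eq' : local_equation O P g'.
Hypotheses (Pa : P a) (ra : res a != 0).
Let rP := cp_ring cp.

Lemma equation_sub q : P q -> P (g' * q) /\ res (g' * q) = 0.
Proof.
move=> Pq; have [_ /(_ (ex_intro2 _ _ q Pq erefl)) [h]] := eq' (g' * q).
by move=> /max_idealP [_].
Qed.

Lemma res_zero_equation f : P f -> res f = 0 -> exists2 q, P q & f = g' * q.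
Proof.
by move=> Pf rf; apply/(eq' f); split=> //; apply/max_idealP; split=> //; exact: (cp_sub cp).
Qed.

Lemma Pres f : P f -> P (res f).
Proof. by move=> Pf; apply: (cp_place cp); exact: (cp_res cp). Qed.

(** Modulo the local equation the ring of the point becomes the valuation ring of [pi], and [a]
    becomes a unit times [pi ^+ m]. So the polynomials of degree less than [N], the degree of
    [pi ^+ m], represent each class exactly once, and the linear maps between the two systems of
    coordinates are injective in both directions. *)
Lemma colength_val d : colength iota P g' a d -> has_val (res a) d.
Proof.
case=> b [Pb bP].
have [p [q [nq raE]]] := cp_res cp Pa.
have p0 : p != 0 by apply: contraNneq ra => p0; rewrite raE p0 hs0 mul0r.
have [m [p' [pE np']]] := mu_decomp ip p0.
have p'0 := ndvd_neq0 np'; have q0 := ndvd_neq0 nq.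
have muE : mu pi p = m by rewrite pE mu_unique.
pose N := ((size pi).-1 * m)%N.
have sN : size (pi ^+ m) = N.+1.
  have [mp _] := ip; rewrite /N; elim: (m) => [|j IH]; first by rewrite expr0 size_poly1 muln0.
  rewrite exprS size_Mmonic ?monic_exp ?irr_neq0 // IH.
  by rewrite addnS /= mulnS -addSn prednK // ltnW // irr_size.
pose Q f := exists u v, [/\ P u, P v & f = g' * u + a * v].
have QD f h : Q f -> Q h -> Q (f + h).
  move=> [u [v [Pu Pv ->]]] [u' [v' [Pu' Pv' ->]]]; exists (u + u'), (v + v').
  by split; [exact: (subringD rP)|exact: (subringD rP)|ring].
have QM r f : P r -> Q f -> Q (r * f).
  move=> Pr [u [v [Pu Pv ->]]]; exists (r * u), (r * v).
  by split; [exact: (subringM rP)|exact: (subringM rP)|ring].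
have P1 : P 1 := subring1 rP; have P0 : P 0 := subring0 rP.
have Qres f : P f -> res f = 0 -> Q f.
  move=> Pf rf; have [u Pu ->] := res_zero_equation Pf rf; exists u, 0.
  by rewrite mulr0 addr0.
have Qa : Q a by exists 0, 1; rewrite mulr0 add0r mulr1.
have resres f : P f -> res (res f) = res f.
  by move=> Pf; apply: res_K1; apply: K1_res; exact: (cp_sub cp).
have Qra : Q (res a).
  rewrite -[res a](subKr a); rewrite opprB.
  have -> : a + (res a - a) = a + (-1) * (a - res a) by ring.
  apply: QD => //; apply: QM; first by apply: (subringN rP).
  apply: Qres; first by apply: (subringB rP) => //; exact: Pres.
  rewrite resB ?resres ?subrr //; apply: (cp_sub cp) => //; exact: Pres.
have Phs z : P (hs s z) by apply: (cp_place cp); exact: hs_place_ring.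
have Qpi z : Q (hs s (pi ^+ m * z)).
  have -> : hs s (pi ^+ m * z) = (hs s (q * z) / hs s p') * res a.
    by rewrite raE pE !hsM; field; rewrite !hs_neq0.
  by apply: QM => //; apply: (cp_place cp); exists (q * z), p'.
have Qsmall (z : {poly k}) : (size z <= N)%N -> Q (hs s z) -> z = 0.
  move=> sz [u [v [Pu Pv e]]]; apply/eqP; apply: contraT => z0.
  have [Pgu rgu] := equation_sub Pu.
  have rv := cp_res cp Pv; have [p1 [q1 [nq1 rvE]]] := rv.
  have : hs s z = res a * res v.
    rewrite -(res_K1 (place_ring_sub (hs_place_ring z))) e resD ?rgu ?add0r ?resM //;
      by apply: (cp_sub cp) => //; exact: (subringM rP).
  rewrite raE rvE => hz; have qz := hsq0 nq; have q1z := hsq0 nq1.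
  have e1 : p * p1 = z * (q * q1).
    by apply: hs_inj; rewrite !hsM hz; field; rewrite qz q1z.
  have : pi ^+ m %| z * (q * q1) by rewrite -e1 pE -mulrA dvdp_mulr.
  rewrite Gauss_dvdpl; last by apply: coprimep_expl; rewrite coprimepMr !irr_coprime // nq.
  by move=> /(dvdp_leq z0); rewrite sN ltnNge sz.
have rep f : P f -> exists z : {poly k}, (size z <= N)%N /\ Q (f - hs s z).
  move=> Pf; have [u [v [nv rf]]] := cp_res cp Pf.
  have cop : coprimep v (pi ^+ m) by rewrite coprimep_sym; apply: coprimep_expl; rewrite irr_coprime.
  have [[al be] /= bez] := Bezout_eq1_coprimepP _ _ cop.
  exists ((u * al) %% (pi ^+ m)); split.
    by rewrite -ltnS -sN ltn_modp expf_neq0 ?irr_neq0.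
  have -> : f - hs s ((u * al) %% pi ^+ m) = (f - res f) + (res f - hs s (u * al))
      + hs s (pi ^+ m * ((u * al) %/ pi ^+ m)).
    have := congr1 (hs s) (divp_eq (u * al) (pi ^+ m)); rewrite hsD [in RHS]hsM => ->.
    by rewrite hsM; ring.
  apply: (QD _ _) => //; apply: (QD _ _).
    apply: Qres; first by apply: (subringB rP) => //; exact: Pres.
    rewrite resB ?resres ?subrr //; apply: (cp_sub cp) => //; exact: Pres.
  have -> : res f - hs s (u * al) = (hs s u / hs s v) * hs s (pi ^+ m * be).
    rewrite rf; have := congr1 (hs s) bez; rewrite !hsD !hsM hs1 => e1.
    rewrite -[hs s u / hs s v]mulr1 -[in LHS]e1; field; exact: hs_neq0 (ndvd_neq0 nv).
  by apply: QM => //; apply: (cp_place cp); exists u, v.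
have Qu f (c c' : 'rV[k]_d) : P f -> Q (f - \sum_(i < d) iota (c 0 i) * b i) ->
    Q (f - \sum_(i < d) iota (c' 0 i) * b i) -> c = c'.
  move=> Pf h h'; have [c1 [_ u]] := bP f Pf.
  exact: etrans (esym (u c h)) (u c' h').
have Pk c : P (iota c) by rewrite -(hsC s); exact: Phs.
have Psum (c : 'rV[k]_d) : P (\sum_(i < d) iota (c 0 i) * b i).
  by apply: (subring_sum rP) => i _; exact: (subringM rP).
have sumD (c c' : 'rV[k]_d) : \sum_(i < d) iota ((c + c') 0 i) * b i =
    \sum_(i < d) iota (c 0 i) * b i + \sum_(i < d) iota (c' 0 i) * b i.
  by rewrite -big_split; apply: eq_bigr => i _; rewrite mxE rmorphD mulrDl.
have sumZ r (c : 'rV[k]_d) : \sum_(i < d) iota ((r *: c) 0 i) * b i =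
    iota r * \sum_(i < d) iota (c 0 i) * b i.
  by rewrite mulr_sumr; apply: eq_bigr => i _; rewrite mxE rmorphM mulrA.
(* The coordinates of a polynomial in the given basis, and conversely. *)
have chA (z : 'rV[k]_N) : exists c : 'rV[k]_d, Q (hs s (rVpoly z) - \sum_(i < d) iota (c 0 i) * b i).
  by have [c [h _]] := bP _ (Phs (rVpoly z)); exists c.
have [A AP] := boolp.choice chA.
have chB (c : 'rV[k]_d) : exists z : 'rV[k]_N, Q (\sum_(i < d) iota (c 0 i) * b i - hs s (rVpoly z)).
  have [z [sz h]] := rep _ (Psum c); exists (poly_rV z).
  by rewrite poly_rV_K.
have [A' A'P] := boolp.choice chB.
have Q0 : Q 0 by exists 0, 0; rewrite !mulr0 addr0.
have QN f : Q f -> Q (- f) by move=> h; rewrite -mulN1r; apply: QM => //; exact: (subringN rP).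
have le1 : (N <= d)%N.
  apply: (injective_row_dim (f := A)).
  - move=> u v; apply: (Qu _ _ _ (Phs (rVpoly (u + v))) (AP _)).
    rewrite sumD linearD hsD opprD addrACA; exact: (QD _ _ (AP u) (AP v)).
  - move=> c u; apply: (Qu _ _ _ (Phs (rVpoly (c *: u))) (AP _)).
    by rewrite sumZ linearZ hsZ -mulrBr; exact: (QM _ _ (Pk c) (AP u)).
  - move=> u Au; have := AP u; rewrite Au big1 ?subr0 => [h|i _]; last by rewrite mxE rmorph0 mul0r.
    have sz : (size (rVpoly u) <= N)%N by exact: size_poly.
    have z0 := Qsmall _ sz h.
    by rewrite -[u]rVpolyK z0 linear0.
have le2 : (d <= N)%N.
  have A'u (c : 'rV[k]_d) (z : {poly k}) : (size z <= N)%N -> Q (\sum_(i < d) iota (c 0 i) * b i - hs s z) -> z = rVpoly (A' c).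
    move=> sz h; apply/eqP; rewrite -subr_eq0; apply/eqP; apply: Qsmall.
      rewrite (leq_trans (size_polyD _ _)) // size_polyN geq_max sz /=; exact: size_poly.
    rewrite hsB; have := QD _ _ (QN _ h) (A'P c); rewrite opprB.
    by rewrite addrA subrK.
  apply: (injective_row_dim (f := A')).
  - move=> u v; apply: (can_inj rVpolyK); apply/esym; rewrite linearD /=.
    apply: A'u; first by rewrite -linearD; exact: size_poly.
    rewrite sumD hsD opprD addrACA; exact: (QD _ _ (A'P u) (A'P v)).
  - move=> c u; apply: (can_inj rVpolyK); apply/esym; rewrite linearZ /=.
    apply: A'u; first by rewrite -linearZ; exact: size_poly.
    by rewrite sumZ hsZ -mulrBr; exact: (QM _ _ (Pk c) (A'P u)).
  - move=> u A'u0; have := A'P u; rewrite A'u0 linear0 hs0 subr0 => h.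
    apply: (Qu 0 _ _ P0); rewrite sub0r; first exact: QN.
    by rewrite big1 ?oppr0 // => i _; rewrite mxE rmorph0 mul0r.
have -> : d = N by apply/eqP; rewrite eqn_leq le1 le2.
exists p, q; rewrite p0 q0; split=> //.
by rewrite muE (mu_ndvd ip nq) muln0 subr0.
Qed.
End Colength.

(** Two local equations differ by a unit of the ring of the point, so the equation [g] may be used.
    There [h = g * (wh * gam)], and the order is the valuation of the residue of [wh * gam]. *)
Lemma conormal_order_val P g gam h wh m : curve_point P g -> x = g * gam -> O gam ->
  res gam != 0 -> h = x * wh -> O wh -> res wh != 0 -> conormal_order iota O h P m ->
  exists d d', [/\ has_val (res wh) d, has_val (res gam) d' & m = d + d'].
Proof.
move=> cp xE Og rg hE Ow rw [g' [a [b [eq' [Pa Pb na nb] hb [d1 [d2 [c1 c2 ->]]]]]]].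
have rP := cp_ring cp; have PO := cp_sub cp.
have ra : res a != 0.
  by apply/eqP => r0; apply: na; apply/max_idealP; split=> //; exact: PO.
have rb : res b != 0.
  by apply/eqP => r0; apply: nb; apply/max_idealP; split=> //; exact: PO.
have v1 := colength_val cp eq' Pa ra c1; have v2 := colength_val cp eq' Pb rb c2.
have [Pg1 rg1] := equation_sub eq' (subring1 rP); rewrite mulr1 in Pg1 rg1.
have [q1 Pq1 g'E] := cp_g cp Pg1 rg1.
have [q2 Pq2 gE] := res_zero_equation cp eq' (cp_gP cp) (cp_resg cp).
have qq : q1 * q2 = 1.
  by apply: (mulfI (cp_g0 cp)); rewrite mulrA -g'E -gE mulr1.
have u1 : ~ place_max (res q1).
  move=> h1; apply: place_max1; rewrite -res1 -qq resM; try exact: PO.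
  by apply/(place_maxM (cp_res cp Pq1) (cp_res cp Pq2)); left.
have v3 := has_val_unit (cp_res cp Pq1) u1.
have e : wh * gam * b = a * q1.
  apply: (mulfI (cp_g0 cp)); transitivity (h * b); first by rewrite hE xE; ring.
  by rewrite hb g'E; ring.
have re : res wh * res gam = res a * (res b)^-1 * res q1.
  have := congr1 res e; rewrite !resM //; try exact: PO; last exact: (subringM rO).
  move=> e'; apply: (mulIf rb); rewrite e'; field; exact: rb.
have [d vw] := has_val_total (K1_res Ow) rw.
have [d' vg] := has_val_total (K1_res Og) rg.
exists d, d'; split=> //.
apply: (has_val_unique (r := res wh * res gam)); last exact: has_valM.
by rewrite re -[_ - _]addr0; apply: has_valM => //; apply: has_valM => //; exact: has_valV.
Qed.
End Place.
End Dvr.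

(** * Charts that meet a divisor *)

Section LocalRings.
Variable F : fieldType.
Implicit Types (A P p : set F).

Section Localization.
Variables (A p : set F).
Hypotheses (rA : is_subring A) (pp : is_prime_ideal A p).

Lemma prime_0 : p 0. Proof. by case: pp => [[]]. Qed.
Lemma prime_sub : p `<=` A. Proof. by case: pp => [[]]. Qed.
Lemma prime_1 : ~ p 1. Proof. by case: pp. Qed.
Lemma prime_D a b : p a -> p b -> p (a + b). Proof. by case: pp => [[_ _ h _]] _ _; exact: h. Qed.
Lemma prime_Ml a b : A a -> p b -> p (a * b). Proof. by case: pp => [[_ _ _ h]] _ _; exact: h. Qed.
Lemma prime_M a b : A a -> A b -> p (a * b) -> p a \/ p b. Proof. by case: pp => _ _; apply. Qed.
Lemma prime_N a : p a -> p (- a).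
Proof. by move=> pa; rewrite -mulN1r; apply: prime_Ml => //; exact: subringN rA _ (subring1 rA). Qed.
Lemma prime_neq0 b : ~ p b -> b != 0.
Proof. by apply: contra_notN => /eqP ->; exact: prime_0. Qed.
Lemma sub_localization : A `<=` localization A p.
Proof. by move=> a Aa; exists a, 1; rewrite divr1; split=> //; [exact: subring1 rA|exact: prime_1]. Qed.

Lemma localization_ring : is_subring (localization A p).
Proof.
split; first by apply: sub_localization; exact: subring1 rA.
  move=> _ _ [a [b [Aa Ab nb ->]]] [a' [b' [Aa' Ab' nb' ->]]].
  exists (a * b' - a' * b), (b * b'); split.
  + by apply: (subringB rA); exact: (subringM rA).
  + exact: (subringM rA).
  + by case/prime_M.
  by rewrite -mulNr addf_div ?prime_neq0 // mulNr.
move=> _ _ [a [b [Aa Ab nb ->]]] [a' [b' [Aa' Ab' nb' ->]]].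
exists (a * a'), (b * b'); split; try exact: (subringM rA).
  by case/prime_M.
by rewrite mulf_div.
Qed.

Lemma localization_unit b : A b -> ~ p b -> localization A p b^-1.
Proof. by move=> Ab nb; exists 1, b; rewrite div1r; split=> //; exact: subring1 rA. Qed.

Definition local_max := [set f | exists a b, [/\ p a, A b, ~ p b & f = a / b]].

Lemma local_max_sub a : A a -> local_max a -> p a.
Proof.
move=> Aa [c [d [pc Ad nd e]]]; have : p (a * d) by rewrite e divfK ?prime_neq0.
by case/prime_M.
Qed.

Lemma local_max_prime : is_prime_ideal (localization A p) local_max.
Proof.
split; first split.
- by move=> _ [a [b [pa Ab nb ->]]]; exists a, b; split=> //; exact: prime_sub.
- by exists 0, 1; rewrite mul0r; split; [exact: prime_0|exact: subring1 rA|exact: prime_1|].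
- move=> _ _ [a [b [pa Ab nb ->]]] [a' [b' [pa' Ab' nb' ->]]].
  exists (a * b' + a' * b), (b * b'); split.
  + by apply: prime_D; rewrite mulrC; exact: prime_Ml.
  + exact: (subringM rA).
  + by case/prime_M.
  by rewrite addf_div ?prime_neq0.
- move=> _ _ [c [d [Ac Ad nd ->]]] [a [b [pa Ab nb ->]]].
  exists (c * a), (d * b); split; [exact: prime_Ml|exact: (subringM rA)|by case/prime_M|].
  by rewrite mulf_div.
- by move=> /(local_max_sub (subring1 rA)) /prime_1.
move=> _ _ [a [b [Aa Ab nb ->]]] [a' [b' [Aa' Ab' nb' ->]]] [c [d [pc Ad nd e]]].
have : p (a * a' * d).
  have -> : a * a' * d = (b * b') * c.
    by rewrite mulf_div in e; apply/eqP; rewrite mulrC [_ * c]mulrC mulrC -eqr_div ?mulf_neq0 ?prime_neq0 // e.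
  by apply: prime_Ml => //; exact: (subringM rA).
case/prime_M => //; first exact: (subringM rA).
by case/prime_M => // h; [left; exists a, b|right; exists a', b'].
Qed.

Lemma localization_max_unit f : localization A p f -> ~ local_max f -> localization A p f^-1.
Proof.
move=> [a [b [Aa Ab nb ->]]] nm; rewrite invf_div; exists b, a; split=> // pa.
by apply: nm; exists a, b.
Qed.

Lemma local_maxP f : max_ideal (localization A p) f <-> local_max f.
Proof.
split=> [[Pf h]|mf].
  apply: contrapT => nm; have Pi := localization_max_unit Pf nm.
  by case: h => // f0; apply: nm; rewrite f0; case: local_max_prime => [[]].
have Pf : localization A p f by case: local_max_prime => [[h _ _ _]] _ _; exact: h.
split=> //; have [->|f0] := eqVneq f 0; [by left|right => Pi].
case: local_max_prime => [[_ _ _ h]] n1 _; apply: n1.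
by rewrite -(mulVf f0); exact: h.
Qed.

(** The trace on [A'] of the maximal ideal of the local ring defines the same localization. *)
Lemma Spec_between A' : is_subring A' -> A `<=` A' -> A' `<=` localization A p ->
  Spec A' (localization A p).
Proof.
move=> rA' AA' A'P; exists (A' `&` local_max).
have [[m1 m0 mD mM] n1 mp] := local_max_prime.
split.
  split; first split.
  - by move=> f [].
  - by split=> //; exact: subring0 rA'.
  - by move=> f g [A'f mf] [A'g mg]; split; [exact: (subringD rA')|exact: mD].
  - by move=> a f A'a [A'f mf]; split; [exact: (subringM rA')|apply: mM => //; exact: A'P].
  - by case.
  move=> a b A'a A'b [_ /(mp _ _ (A'P _ A'a) (A'P _ A'b)) [h|h]]; [left|right]; split=> //.
apply/seteqP; split=> f.
  move=> [a [b [Aa Ab nb ->]]]; exists a, b; split=> //; try exact: AA'.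
  by case=> _ /(local_max_sub Ab).
move=> [a [b [A'a A'b nb ->]]]; apply: (subringM localization_ring); first exact: A'P.
apply: localization_max_unit; first exact: A'P.
by move=> mb; apply: nb.
Qed.
End Localization.
End LocalRings.

Section ChartPoints.
Variables (k F : fieldType) (iota : {rmorphism k -> F}) (O K1 : set F) (x : F).
Hypothesis dvr : coefficient_dvr O K1 x.
Let rO := cd_O dvr.
Notation res := (res O K1 x).

Section Chart.
Variables (s : F).
Hypothesis Ks : forall r, K1 r <-> exists p q, hs iota s q != 0 /\ r = hs iota s p / hs iota s q.
Hypothesis trans : forall p, hs iota s p = 0 -> p = 0.
Notation h := (hs iota s).

(** A chart, with ring [A], that meets the divisor with local ring [O] in a curve with equation [g].
    By [ch_num] the functions on this curve are polynomials in [s], divided by polynomials in [s]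
    that are inverted in [A]. *)
Record chart (A : set F) (g : F) := Chart {
  ch_ring : is_subring A;
  ch_sub : A `<=` O;
  ch_hs : forall p, A (h p);
  ch_res : forall a, A a -> A (res a);
  ch_num : forall a, A a -> exists p q, [/\ h q != 0, A (h q)^-1 & res a = h p / h q];
  ch_g : A g;
  ch_g0 : g != 0;
  ch_resg : res g = 0;
  ch_div : forall a, A a -> res a = 0 -> exists2 a', A a' & a = g * a';
  ch_frac : forall f, O f -> exists a b, [/\ A a, A b, res b != 0 & f = a / b] }.

(** The local ring at the point of the curve given by the place [pi]. *)
Definition chart_ring (A : set F) pi : set F :=
  [set f | exists a b, [/\ A a, A b, ~ place_max iota s pi (res b) & f = a / b]].
(** The point of the place [pi] belongs to the chart. *)
Definition admissible (A : set F) pi := ~ A (h pi)^-1.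

Variables (A : set F) (g : F).
Hypothesis ch : chart A g.
Let rA := ch_ring ch.

Lemma chart_O : localization A [set a | A a /\ res a = 0] = O.
Proof.
apply/seteqP; split=> f.
  move=> [a [b [Aa Ab nb ->]]]; apply: (subringM rO); first exact: (ch_sub ch).
  apply: (res_unit dvr _ _).1; first exact: (ch_sub ch).
  by apply/eqP => rb; apply: nb.
move=> /(ch_frac ch) [a [b [Aa Ab rb ->]]]; exists a, b; split=> //.
by case=> _ rb0; rewrite rb0 eqxx in rb.
Qed.

(** ** The points of the chart on the curve *)
Section Admissible.
Variable pi : {poly k}.
Hypotheses (ip : monic_irreducible pi) (ad : admissible A pi).
Notation pmax := (place_max iota s pi).
Notation pring := (place_ring iota s pi).

Lemma admissible_ndvd q : h q != 0 -> A (h q)^-1 -> ~~ (pi %| q).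
Proof.
move=> q0 Aq; apply/negP => /dvdpP [q' e]; apply: ad.
have -> : (h pi)^-1 = h q' * (h q)^-1.
  move: q0; rewrite e hsM => q0; field.
  by move: q0; rewrite mulf_eq0 negb_or andbC.
by apply: (subringM rA) => //; exact: (ch_hs ch).
Qed.

Lemma chart_place_ring a : A a -> pring (res a).
Proof.
by move=> /(ch_num ch) [p [q [q0 Aq ->]]]; exists p, q; split=> //; exact: admissible_ndvd.
Qed.

Lemma chart_prime : is_prime_ideal A [set a | A a /\ pmax (res a)].
Proof.
have AO := ch_sub ch.
split; first split.
- by move=> a [].
- by split; [exact: subring0 rA|rewrite (res0 dvr); exact: (place_max0 trans ip)].
- move=> a b [Aa ra] [Ab rb]; split; first exact: (subringD rA).
  by rewrite (resD dvr); [exact: (place_maxD trans ip)|exact: AO|exact: AO].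
- move=> a b Aa [Ab rb]; split; first exact: (subringM rA).
  rewrite (resM dvr); [|exact: AO|exact: AO].
  by apply/(place_maxM trans ip); [exact: chart_place_ring|exact: chart_place_ring|right].
- by case=> _; rewrite (res1 dvr) => /(place_max1 trans ip).
move=> a b Aa Ab [_]; rewrite (resM dvr); [|exact: AO|exact: AO].
by move=> /(place_maxM trans ip (chart_place_ring Aa) (chart_place_ring Ab)) [r|r]; [left|right].
Qed.

Lemma chart_ringE : chart_ring A pi = localization A [set a | A a /\ pmax (res a)].
Proof.
apply/seteqP; split=> f [a [b [Aa Ab nb ->]]]; exists a, b; split=> //; first by case.
by move=> pb; apply: nb.
Qed.

Lemma chart_ring_Spec : Spec A (chart_ring A pi).
Proof. by exists [set a | A a /\ pmax (res a)]; split; [exact: chart_prime|exact: chart_ringE]. Qed.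

Lemma chart_max f : max_ideal (chart_ring A pi) f <-> chart_ring A pi f /\ pmax (res f).
Proof.
have AO := ch_sub ch.
have unit b : A b -> ~ pmax (res b) -> O b^-1 /\ res b^-1 = (res b)^-1.
  move=> Ab nb; apply: (res_unit dvr); first exact: AO.
  by apply/eqP => rb; apply: nb; rewrite rb; exact: (place_max0 trans ip).
rewrite chart_ringE (local_maxP rA chart_prime); split=> [[a [b [[Aa ra] Ab nb ->]]]|[[a [b [Aa Ab nb ->]]]]].
  have nb' : ~ pmax (res b) by move=> h1; apply: nb.
  have [Ob rb] := unit b Ab nb'.
  split; first by exists a, b.
  rewrite (resM dvr) ?rb //; last exact: AO.
  have [h1 h2] := place_unit trans ip (chart_place_ring Ab) nb'.
  by apply/(place_maxM trans ip (chart_place_ring Aa) h1); left.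
have nb' : ~ pmax (res b) by move=> h1; apply: nb.
have [Ob rb] := unit b Ab nb'.
rewrite (resM dvr) ?rb //; last exact: AO.
have [h1 h2] := place_unit trans ip (chart_place_ring Ab) nb'.
move=> /(place_maxM trans ip (chart_place_ring Aa) h1) [] // ra.
by exists a, b.
Qed.

Lemma chart_point : curve_point iota O K1 x s pi (chart_ring A pi) g.
Proof.
have AO := ch_sub ch; have rP := localization_ring rA chart_prime.
have PO : chart_ring A pi `<=` O.
  move=> _ [a [b [Aa Ab nb ->]]]; apply: (subringM rO); first exact: AO.
  apply: (res_unit dvr _ _).1; first exact: AO.
  by apply/eqP => rb; apply: nb; rewrite rb; exact: (place_max0 trans ip).
have AP : A `<=` chart_ring A pi by rewrite chart_ringE; exact: (sub_localization rA chart_prime).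
have Pinv b : A b -> ~ pmax (res b) -> O b^-1 /\ res b^-1 = (res b)^-1.
  move=> Ab nb; apply: (res_unit dvr); first exact: AO.
  by apply/eqP => rb; apply: nb; rewrite rb; exact: (place_max0 trans ip).
split=> //.
- by rewrite chart_ringE.
- move=> _ [p [q [nq ->]]]; exists (h p), (h q); split; try exact: (ch_hs ch); last by [].
  rewrite (res_K1 dvr); last by apply: (place_ring_sub Ks trans); exact: (hs_place_ring iota s ip).
  by move=> /(place_max_hs trans ip); apply/negP.
- move=> _ [a [b [Aa Ab nb ->]]]; have [Ob rb] := Pinv b Ab nb.
  rewrite (resM dvr) ?rb //; last exact: AO.
  apply: (subringM (place_ring_ring trans ip)); first exact: chart_place_ring.
  exact: (place_unit trans ip (chart_place_ring Ab) nb).1.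
- exact: AP (ch_g ch).
- exact: (ch_g0 ch).
- exact: (ch_resg ch).
move=> _ [a [b [Aa Ab nb ->]]]; have [Ob rb] := Pinv b Ab nb.
rewrite (resM dvr) ?rb //; last exact: AO.
move=> /eqP; rewrite mulf_eq0 invr_eq0 => /orP [/eqP ra|/eqP r0].
  have [a' Aa' ->] := ch_div ch Aa ra; exists (a' / b); last by rewrite mulrA.
  by exists a', b.
by case: nb; rewrite r0; exact: (place_max0 trans ip).
Qed.
End Admissible.

Lemma curve_point_place_ring pi P g' r : monic_irreducible pi ->
  curve_point iota O K1 x s pi P g' -> K1 r -> P r <-> place_ring iota s pi r.
Proof.
move=> ip cp Kr; split; last exact: (cp_place cp).
by move=> /(cp_res cp); rewrite (res_K1 dvr).
Qed.

(** The inverse of [h pi] belongs to [O] only. *)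
Lemma curve_point_neq pi P g' : monic_irreducible pi ->
  curve_point iota O K1 x s pi P g' -> P <> O.
Proof.
move=> ip cp e; have Kh : K1 (h pi)^-1.
  by apply: (cd_inv dvr); apply: (place_ring_sub Ks trans); exact: (hs_place_ring iota s ip).
have : P (h pi)^-1 by rewrite e; exact: (cd_sub dvr).
move=> /(curve_point_place_ring ip cp Kh) hr.
apply: (place_max1 trans ip); rewrite -(mulVf (hs_neq0 trans (irr_neq0 ip))).
apply/(place_maxM trans ip hr); first exact: (hs_place_ring iota s ip).
by right; apply/(place_max_hs trans ip); exact: dvdpp.
Qed.

(** A prime ideal whose local ring is contained in [O] contains all functions that vanish on the
    curve, so it is determined by the polynomials [q0] with [h q0] in it. As [P <> O] these form
    a nonzero prime ideal, generated by a monic irreducible polynomial. *)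
Lemma chart_classify P : Spec A P -> P `<=` O -> P <> O ->
  exists pi, [/\ monic_irreducible pi, admissible A pi & P = chart_ring A pi].
Proof.
move=> [p [pp ->]] PO nPO; have AO := ch_sub ch.
have qp a : A a -> res a = 0 -> p a.
  move=> Aa ra; apply: contrapT => na; have := PO _ (localization_unit rA Aa na).
  move=> Oa; have a0 := prime_neq0 pp na.
  have := resM dvr (AO _ Aa) Oa; rewrite divff // (res1 dvr) ra mul0r => /eqP.
  by rewrite oner_eq0.
have resp a : A a -> p a <-> p (res a).
  move=> Aa; have d : p (a - res a).
    apply: qp; first by apply: (subringB rA) => //; exact: (ch_res ch).
    rewrite (resB dvr (AO _ Aa)); last by apply: AO; exact: (ch_res ch).
    rewrite (@res_K1 _ _ _ _ dvr (res a)) ?subrr //; exact: (K1_res dvr (AO _ Aa)).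
  split=> h1; first by rewrite -(subKr a (res a)); apply: (prime_D pp) => //; exact: (prime_N rA pp).
  by rewrite -(subrK (res a) a); exact: (prime_D pp).
have [a [Aa pa ra]] : exists a, [/\ A a, p a & res a != 0].
  apply: contrapT => hn; apply: nPO; rewrite -chart_O; congr localization.
  apply/seteqP; split=> a; last by move=> [Aa ra]; exact: qp.
  move=> pa; have Aa := prime_sub pp pa; split=> //; apply/eqP; apply: contraT => ra.
  by case: hn; exists a.
have num b : A b -> exists p1 q1, [/\ h q1 != 0, A (h q1)^-1, res b = h p1 / h q1 & p b <-> p (h p1)].
  move=> Ab; have [p1 [q1 [q0 Aq e]]] := ch_num ch Ab; exists p1, q1; split=> //.
  rewrite resp //; split=> h1.
    by rewrite -(divfK q0 (h p1)) mulrC -e; apply: (prime_Ml pp) => //; exact: (ch_hs ch).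
  by rewrite e mulrC; exact: (prime_Ml pp).
have [q0 [q0n pq0]] : exists q0, q0 != 0 /\ p (h q0).
  have [p1 [q1 [q0 Aq e hp]]] := num a Aa; exists p1; split; last exact: hp.1 pa.
  by apply: contraNneq ra => p0; rewrite e p0 hs0 mul0r.
have [pi [ip ppi]] : exists pi, monic_irreducible pi /\ p (h pi).
  have [N] := ubnP (size q0); elim: N q0 q0n pq0 => // N IH q0 q0n pq0 sN.
  have s1 : (1 < size q0)%N.
    rewrite ltnNge; apply/negP => s1; have e := size1_polyC s1.
    apply: (prime_1 pp); have c0 : q0`_0 != 0 by move: q0n; rewrite e polyC_eq0 coefC.
    have -> : 1 = h (q0`_0)^-1%:P * h q0 by rewrite {2}e !hsC -rmorphM mulVf ?rmorph1.
    by apply: (prime_Ml pp) => //; exact: (ch_hs ch).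
  have [pi ip /dvdpP [q e]] := irr_factor s1.
  move: pq0; rewrite e hsM => /(prime_M pp) [||pq|]; try exact: (ch_hs ch); last by exists pi.
  have qn : q != 0 by apply: contraNneq q0n => z; rewrite e z mul0r.
  apply: (IH q) => //; move: sN; rewrite e size_mul ?(irr_neq0 ip) //.
  by have := irr_size ip; move: (size pi) (size q) => a1 b1; lia.
have ad : admissible A pi.
  move=> Ai; apply: (prime_1 pp); rewrite -(mulVf (hs_neq0 trans (irr_neq0 ip))).
  exact: (prime_Ml pp).
exists pi; split=> //; rewrite chart_ringE; congr localization.
apply/seteqP; split=> b.
  move=> pb; have Ab := prime_sub pp pb; split=> //.
  have [p1 [q1 [q10 Aq e /iffLR/(_ pb) hp]]] := num b Ab.
  rewrite e; apply/(place_maxE trans ip); first exact: admissible_ndvd.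
  apply: contraT => nd.
  have cop : coprimep p1 pi by rewrite coprimep_sym irr_coprime.
  have [[al be] /= bez] := Bezout_eq1_coprimepP _ _ cop.
  case: (prime_1 pp); rewrite -(hs1 iota s) -bez hsD !hsM.
  by apply: (prime_D pp); apply: (prime_Ml pp) => //; exact: (ch_hs ch).
move=> [Ab mb]; have [p1 [q1 [q10 Aq e hp]]] := num b Ab; apply: hp.2.
move: mb; rewrite e => /(place_maxE trans ip) dv.
have /dvdpP [q' ->] := dv (admissible_ndvd ad q10 Aq).
by rewrite hsM; apply: (prime_Ml pp) => //; exact: (ch_hs ch).
Qed.
End Chart.
End ChartPoints.

(** * Blowing up a point of the divisor *)

Lemma blowup_chart_ring (F : fieldType) (P : set F) g : is_subring (blowup_chart P g).
Proof.
split=> [R rR _ _|a b ha hb R rR PR mR|a b ha hb R rR PR mR]; first exact: subring1 rR.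
  by apply: (subringB rR); [exact: ha|exact: hb].
by apply: (subringM rR); [exact: ha|exact: hb].
Qed.

Section BlowUp.
Variables (k F : fieldType) (iota : {rmorphism k -> F}) (O K1 : set F) (x : F).
Hypothesis dvr : coefficient_dvr O K1 x.
Let rO := cd_O dvr.
Notation res := (res O K1 x).
Variables (s : F).
Hypothesis Ks : forall r, K1 r <-> exists p q, hs iota s q != 0 /\ r = hs iota s p / hs iota s q.
Hypothesis trans : forall p, hs iota s p = 0 -> p = 0.
Notation h := (hs iota s).
Variables (A : set F) (pi : {poly k}).
Hypothesis ch : chart iota O K1 x s A x.
Hypotheses (ip : monic_irreducible pi) (ad : admissible iota s A pi).
Notation pmax := (place_max iota s pi).
Notation pring := (place_ring iota s pi).

Let P := chart_ring iota O K1 x s A pi.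
Let cp : curve_point iota O K1 x s pi P x := chart_point dvr Ks trans ch ip ad.
Let rP := cp_ring cp.
Let PO := cp_sub cp.
Let eta := h pi.
Let t := x / eta.
Let eta0 : eta != 0 := hs_neq0 trans (irr_neq0 ip).
Let x0 := cd_x0 dvr.
Let Keta : K1 eta. Proof. by apply: (place_ring_sub Ks trans); exact: (hs_place_ring iota s ip). Qed.
Let KetaV : K1 eta^-1. Proof. exact: (cd_inv dvr). Qed.
Let Oeta : O eta^-1. Proof. exact: (cd_sub dvr). Qed.

Lemma maxP f : max_ideal P f <-> P f /\ pmax (res f).
Proof. exact: (chart_max dvr trans ch ip ad). Qed.

Lemma P_unit f : P f -> ~ pmax (res f) -> P f^-1.
Proof.
move=> Pf nf; apply: contrapT => nP; apply: nf.
by apply: (proj2 ((maxP f).1 _)); split=> //; right.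
Qed.

Lemma maxE f : max_ideal P f <-> exists a b, [/\ P a, P b & f = x * a + eta * b].
Proof.
have Peta : P eta by apply: (cp_place cp); exact: (hs_place_ring iota s ip).
split=> [/maxP [Pf [p [q [nq /dvdpP [p' pE] rE]]]]|[a [b [Pa Pb ->]]]]; last first.
  apply/maxP; have Px := cp_gP cp; split.
    by apply: (subringD rP); exact: (subringM rP).
  rewrite (resD dvr); try by apply: PO; exact: (subringM rP).
  rewrite (resx dvr (PO Pa)) add0r (resM dvr); try exact: PO.
  rewrite (res_K1 dvr Keta); apply/(place_maxM trans ip _ (cp_res cp Pb)).
    exact: (hs_place_ring iota s ip).
  by left; apply/(place_max_hs trans ip); exact: dvdpp.
have Pr : P (res f) by apply: (cp_place cp); exact: (cp_res cp).
have [a Pa aE] : exists2 a, P a & f - res f = x * a.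
  apply: (cp_g cp); first exact: (subringB rP).
  rewrite (resB dvr); try exact: PO.
  by rewrite (@res_K1 _ _ _ _ dvr (res f)) ?subrr //; exact: (K1_res dvr (PO Pf)).
exists a, (h p' / h q); split=> //; first by apply: (cp_place cp); exists p', q.
by rewrite -aE -[LHS](subrK (res f)); congr (_ + _); rewrite rE pE hsM /eta; ring.
Qed.

Lemma max_x : max_ideal P x.
Proof. by apply/maxE; exists 1, 0; rewrite mulr1 mulr0 addr0; split=> //; [exact: subring1 rP|exact: subring0 rP]. Qed.

Lemma max_eta : max_ideal P eta.
Proof. by apply/maxE; exists 0, 1; rewrite mulr1 mulr0 add0r; split=> //; [exact: subring0 rP|exact: subring1 rP]. Qed.

Lemma blowup_chart_P g : P `<=` blowup_chart P g.
Proof. by move=> f Pf R _ PR _; exact: PR. Qed.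

Lemma blowup_chart_max g f : max_ideal P f -> blowup_chart P g (f / g).
Proof. by move=> mf R _ _; apply. Qed.

Let A1 := blowup_chart P eta.
Let rA1 := blowup_chart_ring P eta.
Let PA1 := @blowup_chart_P eta.

Lemma A1_t : A1 t. Proof. exact: (@blowup_chart_max _ _ max_x). Qed.

Lemma A1_O : A1 `<=` O.
Proof.
move=> f; apply=> // g /maxP [Pg _].
by apply: (subringM rO) => //; exact: PO.
Qed.

(** The elements of this form are a ring containing [P] and the fractions [m / eta]. *)
Lemma A1_split f : A1 f -> exists o a, [/\ P o, A1 a & f = o + t * a].
Proof.
move=> Af; pose E := [set f | A1 f /\ exists o a, [/\ P o, A1 a & f = o + t * a]].
suff [] : E f by [].
have At := A1_t; have A0 := subring0 rA1.
apply: Af; first split.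
- by split; [exact: subring1 rA1|exists 1, 0; rewrite mulr0 addr0; split=> //; exact: subring1 rP].
- move=> _ _ [_ [o [a [Po Aa ->]]]] [_ [o' [a' [Po' Aa' ->]]]].
  split; last exists (o - o'), (a - a').
    by apply: (subringB rA1); apply: (subringD rA1); try exact: PA1; exact: (subringM rA1).
  by split; [exact: (subringB rP)|exact: (subringB rA1)|ring].
- move=> _ _ [_ [o [a [Po Aa ->]]]] [_ [o' [a' [Po' Aa' ->]]]].
  have Ao := PA1 Po; have Ao' := PA1 Po'.
  split; last exists (o * o'), (o * a' + a * o' + t * a * a').
    by apply: (subringM rA1); apply: (subringD rA1) => //; exact: (subringM rA1).
  split; [exact: (subringM rP)| |ring].
  apply: (subringD rA1); first by apply: (subringD rA1); exact: (subringM rA1).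
  by apply: (subringM rA1) => //; exact: (subringM rA1).
- move=> g Pg; split; first exact: PA1.
  by exists g, 0; rewrite mulr0 addr0.
move=> g mg; split; first exact: blowup_chart_max.
have [a [b [Pa Pb ->]]] := (maxE g).1 mg; exists b, a; split=> //; first exact: PA1.
by rewrite mulrDl [eta * b]mulrC mulfK // addrC /t; ring.
Qed.

Lemma res_split o a : P o -> A1 a -> res (o + t * a) = res o.
Proof.
move=> Po Aa; have Oo := PO Po; have Oa := A1_O Aa.
have e : t * a = x * (eta^-1 * a) by rewrite /t; ring.
have Oea := subringM rO Oeta Oa.
rewrite e (resD dvr) //; first by rewrite (resx dvr Oea) addr0.
by apply: (subringM rO) => //; exact: (cd_x dvr).
Qed.

(** By [A1_split] the residue of an element [o + t * a] is that of [o]: the chart contains the curve,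
    now with equation [t = x / eta]. *)
Lemma blowup_chartP : chart iota O K1 x s A1 t.
Proof.
have Rt : res t = 0 by rewrite /t; exact: (resx dvr Oeta).
split.
- exact: rA1.
- exact: A1_O.
- by move=> p; apply: PA1; apply: (cp_place cp); exact: (hs_place_ring iota s ip).
- move=> _ /A1_split [o [a [Po Aa ->]]]; rewrite res_split //.
  by apply: PA1; apply: (cp_place cp); exact: (cp_res cp).
- move=> _ /A1_split [o [a [Po Aa ->]]]; rewrite res_split //.
  have [p [q [nq e]]] := cp_res cp Po; exists p, q; split=> //; first exact: (hsq0 trans nq).
  apply: PA1; apply: (cp_place cp); exists 1, q; split=> //.
  by rewrite hs1 div1r.
- exact: A1_t.
- by rewrite mulf_neq0 ?invr_eq0.
- exact: Rt.
- move=> _ /A1_split [o [a [Po Aa ->]]]; rewrite res_split // => ro.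
  have [o' Po' ->] := cp_g cp Po ro; exists (eta * o' + a).
    apply: (subringD rA1) => //; apply: PA1; apply: (subringM rP) => //.
    by apply: (cp_place cp); exact: (hs_place_ring iota s ip).
  by rewrite mulrDr mulrA divfK.
move=> f /(ch_frac ch) [a [b [Aa Ab rb e]]]; exists a, b; split=> //; apply: PA1.
  by rewrite /P chart_ringE; exact: (sub_localization (ch_ring ch) (chart_prime dvr trans ch ip ad)).
by rewrite /P chart_ringE; exact: (sub_localization (ch_ring ch) (chart_prime dvr trans ch ip ad)).
Qed.

Lemma blowup_admissible : admissible iota s A1 pi.
Proof.
move=> /A1_split [o [a [Po Aa e]]].
have hr : pring eta^-1.
  by rewrite -(res_K1 dvr KetaV) /eta e res_split //; exact: (cp_res cp).
apply: (place_max1 trans ip); rewrite -(mulVf eta0).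
apply/(place_maxM trans ip hr); first exact: (hs_place_ring iota s ip).
by right; apply/(place_max_hs trans ip); exact: dvdpp.
Qed.

Definition blowup_point := chart_ring iota O K1 x s A1 pi.

Lemma blowup_point_cp : curve_point iota O K1 x s pi blowup_point t.
Proof. exact: (chart_point dvr Ks trans blowup_chartP ip blowup_admissible). Qed.

Lemma blowup_point_Spec : Spec (blowup_chart P eta) blowup_point.
Proof. exact: (chart_ring_Spec dvr trans blowup_chartP ip blowup_admissible). Qed.

(** ** Uniqueness of the point above [P] on the curve *)
(** Let [g = x a + eta b]. In [1 = a (x / g) + b (eta / g)] the quotient [x / g] vanishes on the
    curve, so it is not a unit of [R], and [b] and [eta / g] are units. So [m / eta] is contained in
    [R], and elements of the chart [A1] are units of [R] exactly when they are units at
    [blowup_point]. Here [eta] is not a unit of [R], since otherwise [R] would contain [O]. *)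
Lemma blowup_point_uniq g R : max_ideal P g -> g <> 0 -> Spec (blowup_chart P g) R ->
  R `<=` O -> R <> O -> R = blowup_point.
Proof.
move=> mg /eqP g0 [q [pq RE]] RO nRO.
have rA := blowup_chart_ring P g; have rR : is_subring R by rewrite RE; exact: localization_ring.
have AR : blowup_chart P g `<=` R by rewrite RE; exact: sub_localization.
have PR : P `<=` R by move=> f /(@blowup_chart_P g) /AR.
pose mR := local_max (blowup_chart P g) q.
have [[mRs mR0 mRD mRM] mR1 _] := local_max_prime rA pq; rewrite -RE -/mR in mRs mR0 mRD mRM mR1.
have mRN f : mR f -> mR (- f).
  by move=> mf; rewrite -mulN1r; apply: mRM => //; exact: subringN rR _ (subring1 rR).
have unitR f : R f -> ~ mR f -> R f^-1 by rewrite RE; exact: localization_max_unit.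
have nonunit f : mR f -> R f^-1 -> f != 0 -> False.
  by move=> mf Rf f0; apply: mR1; rewrite -(mulVf f0); exact: mRM.
have resR f : R f -> res f = 0 -> mR f.
  move=> Rf rf; apply: contrapT => nf; have Ri := unitR f Rf nf.
  have f0 : f != 0 by apply/eqP => f0; apply: nf; rewrite f0.
  have := resM dvr (RO _ Rf) (RO _ Ri); rewrite divff // (res1 dvr) rf mul0r => /eqP.
  by rewrite oner_eq0.
have Px := cp_gP cp; have Pring r : pring r -> P r by exact: (cp_place cp).
have mx : mR x by apply: resR; [exact: PR|exact: (cp_resg cp)].
have Peta : P eta by apply: Pring; exact: (hs_place_ring iota s ip).
have meta : mR eta.
  apply: contrapT => neta; apply: nRO; apply/seteqP; split=> // f.
  have Reta := unitR eta (PR _ Peta) neta.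
  have hsu p : p != 0 -> R (h p)^-1.
    move=> p0; have [m [p' [pE np']]] := mu_decomp ip p0.
    rewrite pE hsM hsXn invfM; apply: (subringM rR).
      by rewrite -exprVn; exact: (subringX rR _ Reta).
    by apply: PR; apply: Pring; exists 1, p'; rewrite hs1 div1r.
  move=> /(ch_frac ch) [a [b [Aa Ab rb ->]]].
  have AP : A `<=` P by rewrite /P chart_ringE; exact: (sub_localization (ch_ring ch) (chart_prime dvr trans ch ip ad)).
  apply: (subringM rR); first by apply: PR; exact: AP.
  apply: unitR; first by apply: PR; exact: AP.
  move=> mb; have Arb := ch_res ch Ab; have Rrb := PR _ (AP _ Arb).
  have mrb : mR (res b).
    rewrite -(subKr b (res b)); apply: mRD => //; apply: mRN; apply: resR.
      by apply: (subringB rR) => //; apply: PR; exact: AP.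
    rewrite (resB dvr); try by [exact: (ch_sub ch)].
    by rewrite (@res_K1 _ _ _ _ dvr (res b)) ?subrr //; exact: (K1_res dvr (ch_sub ch Ab)).
  apply: (nonunit _ mrb) => //.
  have [p [q1 [q10 Aq e]]] := ch_num ch Ab.
  have p0 : p != 0 by apply: contraNneq rb => p0; rewrite e p0 hs0 mul0r.
  by rewrite e invf_div; apply: (subringM rR); [apply: PR; apply: AP; exact: (ch_hs ch)|exact: hsu].
have mP f : max_ideal P f -> mR f.
  by move=> /maxE [a [b [Pa Pb ->]]]; apply: mRD; rewrite mulrC; apply: mRM => //; exact: PR.
have [a [b [Pa Pb gE]]] := (maxE g).1 mg.
have Rxg : R (x / g) by apply: AR; exact: (@blowup_chart_max _ _ max_x).
have Reg : R (eta / g) by apply: AR; exact: (@blowup_chart_max _ _ max_eta).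
have Og : O g by apply: PO; exact: ((maxP g).1 mg).1.
have rxg : res (x / g) = 0.
  have [rg|rg] := eqVneq (res g) 0.
    have := resM dvr (RO _ Reg) Og; rewrite divfK // rg mulr0 (res_K1 dvr Keta) => e.
    by move: eta0; rewrite e eqxx.
  have := resM dvr (RO _ Rxg) Og; rewrite divfK // (cp_resg cp) => /esym/eqP.
  by rewrite mulf_eq0 (negbTE rg) orbF => /eqP.
have mxg := resR _ Rxg rxg.
have e1 : a * (x / g) + b * (eta / g) = 1 by rewrite -(divff g0) {3}gE; ring.
have nb : ~ mR b.
  move=> mb; apply: mR1; rewrite -e1; apply: mRD; first by apply: mRM => //; exact: PR.
  by rewrite mulrC; exact: mRM.
have neg : ~ mR (eta / g).
  move=> mb; apply: mR1; rewrite -e1; apply: mRD; first by apply: mRM => //; exact: PR.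
  by apply: mRM => //; exact: PR.
have Rge : R (g / eta) by have := unitR _ Reg neg; rewrite invf_div.
have conv f : R (f / g) -> R (f / eta).
  move=> Rf; have -> : f / eta = (f / g) * (g / eta) by rewrite mulrA divfK.
  exact: (subringM rR).
have A1R : A1 `<=` R.
  by move=> f; apply=> // f' mf'; apply: conv; apply: AR; exact: blowup_chart_max.
have Rt : R t by exact: conv.
have mt : mR t by apply: resR => //; rewrite /t; exact: (resx dvr Oeta).
have npb : ~ pmax (res b) by move=> pb; apply: nb; apply: mP; apply/maxP.
have mA1 f : A1 f -> pmax (res f) -> mR f.
  move=> /A1_split [o [c [Po Ac ->]]]; rewrite res_split // => ro.
  apply: mRD; first by apply: mP; apply/maxP.
  by rewrite mulrC; apply: mRM => //; exact: A1R.
have uA1 f : A1 f -> ~ pmax (res f) -> R f^-1.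
  move=> Af; have [o [c [Po Ac fE]]] := A1_split Af; rewrite fE res_split // => nro.
  apply: unitR; first by rewrite -fE; exact: A1R.
  move=> mf; have o0 : o != 0.
    apply/eqP => o0; apply: nro; rewrite o0 (res0 dvr); exact: (place_max0 trans ip).
  apply: (nonunit o) => //; last by apply: PR; exact: P_unit.
  rewrite -(addrK (t * c) o); apply: mRD => //; apply: mRN.
  by rewrite mulrC; apply: mRM => //; exact: A1R.
have cpR := blowup_point_cp; have rB := cp_ring cpR.
have A1B : A1 `<=` blowup_point.
  rewrite /blowup_point chart_ringE.
  exact: (sub_localization rA1 (chart_prime dvr trans blowup_chartP ip blowup_admissible)).
have uB f : A1 f -> ~ pmax (res f) -> blowup_point f^-1.
  by move=> Af nf; exists 1, f; rewrite div1r; split=> //; exact: subring1 rA1.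
have AB : blowup_chart P g `<=` blowup_point.
  have Beg : blowup_point (eta / g).
    have ge : g / eta = b + t * a.
      by rewrite gE mulrDl [eta * b]mulrC mulfK // addrC /t; ring.
    rewrite -invf_div ge; apply: uB; last by rewrite res_split //; exact: PA1.
    by apply: (subringD rA1); [exact: PA1|apply: (subringM rA1 A1_t); exact: PA1].
  move=> f; apply=> //; first by move=> f' Pf'; apply: A1B; exact: PA1.
  move=> f' mf'; have -> : f' / g = (f' / eta) * (eta / g) by rewrite mulrA divfK.
  by apply: (subringM rB) => //; apply: A1B; exact: blowup_chart_max.
apply/seteqP; split=> f; last first.
  by move=> [a1 [b1 [Aa Ab nb1 ->]]]; apply: (subringM rR); [exact: A1R|exact: uA1].
rewrite RE => -[a1 [b1 [Aa Ab nb1 ->]]]; apply: (subringM rB); first exact: AB.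
have [a0 [b0 [Aa0 Ab0 nb0 b1E]]] := AB _ Ab; rewrite b1E invf_div.
apply: (subringM rB); first exact: A1B.
apply: uB => // pa0; apply: nb1; apply: (local_max_sub pq Ab); rewrite -/mR b1E.
by rewrite mulrC; apply: mRM; [exact: uA1|exact: mA1].
Qed.
End BlowUp.

(** * Characters of a torus *)

Lemma lin_indep_inj (F : fieldType) (C : set F) (M : zmodType) (chi : M -> F) :
  is_subring C -> lin_indep C chi -> injective chi.
Proof.
move=> ringC li a b e; have C1 : C 1 by exact: subring1 ringC.
have := ev_inj ringC li (g := mono 1 a) (h := mono 1 b).
rewrite !evU e => /(_ (Cval_mono ringC _ C1) (Cval_mono ringC _ C1) erefl).
move=> /(congr1 (fun g => mcoef g a)); rewrite !mcoefU eqxx mulr1n; case: eqP => // _ /eqP.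
by rewrite mulr0n oner_eq0.
Qed.

Lemma ev_disjoint (F : fieldType) (C : set F) (M : zmodType) (chi : M -> F) g h :
  is_subring C -> lin_indep C chi -> Cval C g -> Cval C h ->
  (forall m, mcoef g m != 0 -> mcoef h m != 0 -> False) -> ev chi g = ev chi h -> ev chi g = 0.
Proof.
move=> ringC li Cg Ch dis e; have gh := ev_inj ringC li Cg Ch e.
have -> : g = 0; last by rewrite ev0.
apply: mcoefP => m; rewrite mcoef0; apply/eqP; apply: contraT => n0.
by case: (dis m n0); rewrite -gh.
Qed.

Section Base.
Variables (k : fieldType) (d : nat).
Local Notation F := (ratfun k d).
Local Notation M := 'rV[int]_d.
Local Notation mp := (mpoly.mpoly d k).

Definition cstr : {rmorphism k -> F} := (@tofrac mp) \o (@mpoly.mpolyC d k).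

Lemma cstrE c : cstr c = cst d c. Proof. by []. Qed.

Definition constants : set F := range (@cst k d).

Lemma constants_ring : is_subring constants.
Proof.
split; first by exists 1; rewrite // -cstrE rmorph1.
  by move=> _ _ [a _ <-] [b _ <-]; exists (a - b); rewrite // -!cstrE rmorphB.
by move=> _ _ [a _ <-] [b _ <-]; exists (a * b); rewrite // -!cstrE rmorphM.
Qed.

Lemma var_neq0 i : tofrac ('X_i : mp) != 0.
Proof. rewrite tofrac_eq0; apply/eqP => /(congr1 (mpoly.mcoeff U_(i)%MM)).
by rewrite mpoly.mcoeffXU mpoly.mcoeff0 eqxx => /eqP; rewrite oner_eq0. Qed.

Lemma zmon_char : is_char (@zmon k d).
Proof.
split; first by rewrite /zmon /monomial big1 // => i _; rewrite mxE expr0z.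
move=> a b; rewrite /zmon /monomial -big_split; apply: eq_bigr => i _ /=.
by rewrite mxE expfzDr // var_neq0.
Qed.

Lemma zmon_pos (m : 'X_{1..d}) : zmon k (\row_i (m i)%:Z) = tofrac ('X_[m] : mp).
Proof.
rewrite mpolyXE_id rmorph_prod /zmon /monomial; apply: eq_bigr => i _.
by rewrite mxE rmorphXn.
Qed.

(** Multiplication by one character turns finitely many Laurent monomials into ordinary monomials. *)
Lemma zmon_lin_indep : lin_indep constants (@zmon k d).
Proof.
move=> g Cg g0.
have ch m : exists c, mcoef g m = cst d c by have [c _ <-] := Cg m; exists c.
have [c cE] := boolp.choice ch.
pose N := (\max_(m <- monalg.msupp g) \max_(i < d) absz (m 0%R i))%N.
pose e (m : M) : 'X_{1..d} := [multinom absz (m 0 i + N%:Z)%R | i < d].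
have bound m i : m \in monalg.msupp g -> 0 <= m 0 i + N%:Z.
  move=> ms; have h1 := @leq_bigmax_seq _ _ xpredT (fun m : M => \max_(i < d) absz (m 0%R i))%N m ms isT.
  have h2 := @leq_bigmax_cond _ xpredT (fun i => absz (m 0%R i)) i isT.
  have : (absz (m 0%R i) <= N)%N by exact: leq_trans h2 h1.
  lia.
pose nN : M := \row_i N%:Z.
have eE m : m \in monalg.msupp g -> zmon k (m + nN) = tofrac ('X_[e m] : mp).
  move=> ms; rewrite -zmon_pos; congr zmon; apply/rowP => i; rewrite !mxE mnmE.
  by rewrite gez0_abs // bound.
have e_inj m m' : m \in monalg.msupp g -> m' \in monalg.msupp g -> e m = e m' -> m = m'.
  move=> ms ms' /mnmP h; apply/rowP => i; have := h i; rewrite !mnmE.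
  have := bound m i ms; have := bound m' i ms'; move=> h1 h2 h3.
  by apply: (addIr N%:Z); rewrite -[LHS]gez0_abs // -[RHS]gez0_abs // h3.
have s0 : \sum_(m <- monalg.msupp g) c m *: ('X_[e m] : mp) = 0.
  apply/eqP; rewrite -tofrac_eq0 rmorph_sum; apply/eqP.
  have := congr1 (fun z => z * zmon k nN) g0; rewrite mul0r => h; rewrite -[RHS]h.
  rewrite evE mulr_suml; apply: eq_big_seq => m ms.
  rewrite -mpoly.mul_mpolyC rmorphM /= -eE // (proj2 zmon_char) mulrA; congr (_ * _ * _).
  by rewrite cE.
apply: mcoefP => m; rewrite mcoef0.
have [ms|ms] := boolP (m \in monalg.msupp g); last by apply/eqP; rewrite -[_ == _]negbK -mcoef_neq0.
have := congr1 (fun p : mp => mpoly.mcoeff (e m) p) s0; rewrite mpoly.mcoeff0 raddf_sum /=.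
rewrite (bigD1_seq m) ?fset_uniq //= mpoly.mcoeffZ mpoly.mcoeffX eqxx mulr1 big_seq_cond big1 ?addr0.
  by rewrite cE => ->; rewrite -cstrE rmorph0.
move=> m' /andP [ms' mm]; rewrite mpoly.mcoeffZ mpoly.mcoeffX; case: eqP => [/e_inj h|]; rewrite ?mulr0 //.
by move: mm; rewrite h ?eqxx.
Qed.

Lemma cst_inj : injective (@cst k d).
Proof. by move=> a b; rewrite -!cstrE => /fmorph_inj. Qed.

Lemma zmon_inj (a b : M) : zmon k a = zmon k b -> a = b.
Proof. exact: (lin_indep_inj constants_ring zmon_lin_indep). Qed.

Lemma kspanP (S : set M) f : kspan (@cst k d) (@zmon k d) S f <->
  exists g, [/\ Cval constants g, forall m, mcoef g m != 0 -> S m & f = ev (@zmon k d) g].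
Proof.
split=> [[s [hS ->]]|[g [Cg gS ->]]].
  exists (\sum_(x <- s) mono (cst d x.1) x.2); split.
  - by apply: Cval_sum; [exact: constants_ring|move=> x _; apply: Cval_mono; [exact: constants_ring|exists x.1]].
  - move=> m; rewrite mcoef_sum => h; apply: contrapT => nS; move/eqP: h; apply.
    rewrite big_seq big1 // => x xs; apply/eqP; apply: contraT => /mcoefU_neq0 e.
    by case: nS; rewrite e; exact: hS.
  - by rewrite ev_sum; apply: eq_bigr => x _; rewrite evU.
have ch m : exists c, mcoef g m = cst d c by have [c _ <-] := Cg m; exists c.
have [c cE] := boolp.choice ch.
exists [seq (c m, m) | m <- monalg.msupp g]; split.
  by move=> x /mapP [m ms ->] /=; apply: gS; rewrite -mcoef_neq0.
by rewrite /lincomb big_map evE; apply: eq_bigr => m _; rewrite cE.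
Qed.

Lemma kspan_disjoint (S S' : set M) f : (forall u, S u -> S' u -> False) ->
  kspan (@cst k d) (@zmon k d) S f -> kspan (@cst k d) (@zmon k d) S' f -> f = 0.
Proof.
move=> dis /kspanP [g [Cg gS ->]] /kspanP [h [Ch hS e]].
apply: (ev_disjoint constants_ring zmon_lin_indep Cg Ch _ e) => m gm hm.
exact: (dis m (gS m gm) (hS m hm)).
Qed.
End Base.

(** * The local ring of a toric divisor *)

Section Charts.
Variables (k F : fieldType) (iota : {rmorphism k -> F}) (chi : Z2 -> F).
Hypothesis hc : is_char chi.
Notation ks := (kspan iota chi).
Hypothesis disj : forall (S S' : set Z2) f, (forall u, S u -> S' u -> False) ->
  ks S f -> ks S' f -> f = 0.

Lemma chi0 : chi 0 = 1. Proof. by case: hc. Qed.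
Lemma chiD a b : chi (a + b) = chi a * chi b. Proof. by case: hc => _; apply. Qed.
Lemma chiZ (c : int) a : chi (c *: a) = chi a ^ c.
Proof. by rewrite -charZ // -scaler_int intz. Qed.

Lemma ks_ind (S : set Z2) (Q : set F) : Q 0 -> (forall f g, Q f -> Q g -> Q (f + g)) ->
  (forall c u, S u -> Q (iota c * chi u)) -> forall f, ks S f -> Q f.
Proof.
move=> Q0 QD Qm f [s [sS ->]]; rewrite /lincomb.
elim: s sS => [|a s IH] sS; first by rewrite big_nil.
rewrite big_cons; apply: QD; first by apply: Qm; apply: sS; rewrite mem_head.
by apply: IH => x xs; apply: sS; rewrite inE xs orbT.
Qed.

Lemma ks_mono (S : set Z2) c u : S u -> ks S (iota c * chi u).
Proof.
move=> Su; exists [:: (c, u)]; split; last by rewrite /lincomb big_seq1.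
by move=> x; rewrite inE => /eqP ->.
Qed.

Lemma ks_char (S : set Z2) u : S u -> ks S (chi u).
Proof. by move=> /(ks_mono 1); rewrite rmorph1 mul1r. Qed.

Lemma ks_0 (S : set Z2) : ks S 0.
Proof. by exists [::]; rewrite /lincomb big_nil. Qed.

Lemma ks_D (S : set Z2) f g : ks S f -> ks S g -> ks S (f + g).
Proof.
move=> [s [sS ->]] [t [tS ->]]; exists (s ++ t); split; last by rewrite /lincomb big_cat.
by move=> x; rewrite mem_cat => /orP [/sS|/tS].
Qed.

Lemma ks_shift (S S' : set Z2) c (u : Z2) f : ks S f -> (forall m, S m -> S' (u + m)) ->
  ks S' (iota c * chi u * f).
Proof.
move=> Sf SS'; move: f Sf; apply: ks_ind.
- by rewrite mulr0; exact: ks_0.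
- by move=> f g; rewrite mulrDr; exact: ks_D.
move=> c' m Sm; have -> : iota c * chi u * (iota c' * chi m) = iota (c * c') * chi (u + m).
  by rewrite rmorphM chiD; ring.
by apply: ks_mono; exact: SS'.
Qed.

Lemma ks_sub (S S' : set Z2) f : (forall m, S m -> S' m) -> ks S f -> ks S' f.
Proof.
move=> SS'; have := @ks_shift S S' 1 0 f; rewrite rmorph1 chi0 !mul1r => h /h; apply.
by move=> m Sm; rewrite add0r; exact: SS'.
Qed.

Lemma ks_M (S S1 S2 : set Z2) f g : (forall a b, S1 a -> S2 b -> S (a + b)) ->
  ks S1 f -> ks S2 g -> ks S (f * g).
Proof.
move=> SD S1f; move: f S1f g; apply: ks_ind => [g _|f1 f2 h1 h2 g Sg|c u Su g Sg].
- by rewrite mul0r; exact: ks_0.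
- by rewrite mulrDl; apply: ks_D; [exact: h1|exact: h2].
by apply: (ks_shift c Sg) => m; exact: SD.
Qed.

Lemma ks_ring (S : set Z2) : S 0 -> (forall a b, S a -> S b -> S (a + b)) -> is_subring (ks S).
Proof.
move=> S0 SD; split; first by rewrite -chi0; exact: ks_char.
  move=> f g Sf Sg; apply: ks_D => //; rewrite -mulN1r.
  have := ks_mono (-1) S0; rewrite chi0 mulr1 rmorphN rmorph1 => h.
  by apply: (ks_M _ h Sg); exact: SD.
by move=> f g; exact: ks_M.
Qed.

Lemma chi_neq0 u : chi u != 0. Proof. exact: char_neq0. Qed.

Lemma hs_ks (S : set Z2) u p : S 0 -> (forall a b, S a -> S b -> S (a + b)) -> S u ->
  ks S (hs iota (chi u) p).
Proof.
move=> S0 SD Su; have rS := ks_ring S0 SD.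
elim/poly_ind: p => [|p c IH]; first by rewrite hs0; exact: ks_0.
rewrite hsD hsM hsX hsC; apply: ks_D; first by apply: (subringM rS) => //; exact: ks_char.
by have := ks_mono c S0; rewrite chi0 mulr1.
Qed.

(** The function [wedge b] separates the exponent of the constant term from the other exponents. *)
Lemma hs_trans u b p : wedge b u = 1 -> hs iota (chi u) p = 0 -> p = 0.
Proof.
move=> bu; elim/poly_ind: p => [//|p c IH]; rewrite hsD hsM hsX hsC => e.
have c0 : iota c = 0.
  apply: (disj (S := [set v | wedge b v = 0]) (S' := [set v | 0 < wedge b v])).
  - by move=> v /= ->.
  - by have := @ks_mono [set v | wedge b v = 0] c 0 (wedge0r b); rewrite chi0 mulr1.
  have -> : iota c = hs iota (chi u) (- p) * chi u.
    by rewrite hsN mulNr; apply/eqP; rewrite -addr_eq0 addrC e.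
  apply: (ks_M (S1 := [set v | 0 <= wedge b v]) (S2 := [set v | 0 < wedge b v])).
  - by move=> x z /=; rewrite wedgeDr; lia.
  - apply: hs_ks => /=; rewrite ?wedge0r ?bu //.
    by move=> x z /=; rewrite wedgeDr; lia.
  - by apply: ks_char; rewrite /= bu.
have -> : c = 0 by apply/eqP; rewrite -(fmorph_eq0 iota) c0.
rewrite IH ?mul0r ?add0r //.
by move: e; rewrite c0 addr0 => /eqP; rewrite mulf_eq0 (negbTE (chi_neq0 u)) orbF => /eqP.
Qed.

(** ** The boundary curve of a ray *)
Section Curve.
Variables (v G0 : Z2).
Hypothesis G0v : wedge G0 v = 1.

Let x := chi G0.
Let y := chi v.
Definition torus_fractions : set F :=
  [set r | exists p q, hs iota y q != 0 /\ r = hs iota y p / hs iota y q].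
Definition open_chart := ks [set u | 0 <= wedge u v].
Definition divisor_ideal := ks [set u | 0 < wedge u v].
Definition divisor_ring := localization open_chart divisor_ideal.

Local Notation K1 := torus_fractions.
Local Notation B1 := open_chart.
Local Notation P1 := divisor_ideal.
Local Notation O := divisor_ring.

Lemma y_trans p : hs iota y p = 0 -> p = 0.
Proof. exact: hs_trans G0v. Qed.

Lemma hsy_neq0 p : p != 0 -> hs iota y p != 0.
Proof. by apply: contra => /eqP /y_trans ->. Qed.

Lemma B1_ring : is_subring B1.
Proof. by apply: ks_ring => [|a b] /=; rewrite ?wedge0l ?wedgeDl //; lia. Qed.
Let rB := B1_ring.

Lemma chi_expand u : chi u = x ^ wedge u v * y ^ wedge G0 u.
Proof. by rewrite {1}(wedge_basis u G0v) chiD !chiZ. Qed.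

Lemma B1_x : B1 x. Proof. by apply: ks_char; rewrite /= G0v. Qed.
Lemma B1_y : B1 y. Proof. by apply: ks_char; rewrite /= wedgexx. Qed.
Lemma B1_yV : B1 y^-1.
Proof. by rewrite -(charN v hc); apply: ks_char; rewrite /= wedgeNl wedgexx. Qed.
Lemma B1_hs p : B1 (hs iota y p).
Proof. by apply: hs_ks => [|a b|] /=; rewrite ?wedge0l ?wedgeDl ?wedgexx //; lia. Qed.
Lemma y_neq0 : y != 0. Proof. exact: chi_neq0. Qed.
Lemma x_neq0 : x != 0. Proof. exact: chi_neq0. Qed.

Lemma P1E f : P1 f <-> exists2 c, B1 c & f = x * c.
Proof.
have kx : x = iota 1 * chi G0 by rewrite rmorph1 mul1r.
split=> [Pf|[c Bc ->]].
  exists (chi (- G0) * f); last by rewrite mulrA -chiD subrr chi0 mul1r.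
  have := @ks_shift _ [set u | 0 <= wedge u v] 1 (- G0) f Pf; rewrite rmorph1 mul1r; apply.
  by move=> m /=; rewrite wedgeDl wedgeNl G0v; lia.
rewrite kx; apply: (ks_shift _ Bc) => m /=; rewrite wedgeDl G0v; lia.
Qed.

(** On the left hand side the exponents [u] have [wedge u v = 0], on the right hand side they have
    [wedge u v > 0]. *)
Lemma curve_indep p c : B1 c -> hs iota y p = x * c -> p = 0.
Proof.
move=> Bc e; apply: y_trans; apply: (disj (S := [set u | wedge u v = 0]) (S' := [set u | 0 < wedge u v])).
- by move=> u /= ->.
- by apply: hs_ks => [|a b|] /=; rewrite ?wedge0l ?wedgeDl ?wedgexx //; lia.
- by rewrite e; apply/P1E; exists c.
Qed.

Lemma B1_split f : B1 f -> exists p N c, B1 c /\ f = hs iota y p / y ^+ N + x * c.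
Proof.
move: f; apply: ks_ind.
- by exists 0, 0%N, 0; rewrite hs0 mul0r mulr0 addr0; split=> //; exact: ks_0.
- move=> f g [p [N [c [Bc ->]]]] [q [N' [d [Bd ->]]]].
  exists (p * 'X^N' + q * 'X^N), (N + N')%N, (c + d); split; first exact: (subringD rB).
  rewrite hsD !hsM !hsXn hsX exprD; field.
  by rewrite !expf_neq0 ?y_neq0.
move=> c u /= uv; have [u0|u0] := eqVneq (wedge u v) 0.
  rewrite chi_expand u0 expr0z mul1r; case: (wedge G0 u) => j.
    exists (c *: 'X^j), 0%N, 0; split; first exact: ks_0.
    by rewrite hsZ hsXn hsX expr0 divr1 mulr0 addr0.
  exists c%:P, j.+1, 0; split; first exact: ks_0.
  by rewrite hsC mulr0 addr0 NegzE -exprnN.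
exists 0, 0%N, (iota c * chi (u - G0)); split.
  by apply: ks_mono; rewrite /= wedgeDl wedgeNl G0v; move: uv u0; lia.
by rewrite hs0 mul0r add0r mulrCA -chiD addrC subrK.
Qed.

Lemma not_P1 b : B1 b -> ~ P1 b <-> exists p N c, [/\ p != 0, B1 c & b = hs iota y p / y ^+ N + x * c].
Proof.
move=> Bb; split=> [nP|[p [N [c [p0 Bc bE]]]] /P1E [d Bd e]].
  have [p [N [c [Bc bE]]]] := B1_split Bb; exists p, N, c; split=> //.
  apply/eqP => p0; apply: nP; apply/P1E; exists c => //.
  by rewrite bE p0 hs0 mul0r add0r.
move/eqP: p0; apply; apply: (@curve_indep p (y ^+ N * (d - c))).
  by apply: (subringM rB); [exact: (subringX rB _ B1_y)|exact: (subringB rB)].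
have : hs iota y p / y ^+ N = x * (d - c) by rewrite mulrBr -e bE addrK.
by move=> /(congr1 (fun z => z * y ^+ N)); rewrite divfK ?expf_neq0 ?y_neq0 // => ->; ring.
Qed.

Lemma y_pow_neq0 N : y ^+ N != 0. Proof. by rewrite expf_neq0 ?y_neq0. Qed.

Lemma B1_yVX N : B1 (y ^+ N)^-1.
Proof. by rewrite -exprVn; exact: (subringX rB _ B1_yV). Qed.

Lemma not_P1M a b : B1 a -> B1 b -> ~ P1 a -> ~ P1 b -> ~ P1 (a * b).
Proof.
move=> Ba Bb /(not_P1 Ba) [p [N [c [p0 Bc ->]]]] /(not_P1 Bb) [q [N' [d [q0 Bd ->]]]].
apply/not_P1.
  apply: (subringM rB); apply: (subringD rB); apply: (subringM rB) => //;
    try exact: B1_hs; try exact: B1_yVX; exact: B1_x.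
exists (p * q), (N + N')%N, (hs iota y p / y ^+ N * d + hs iota y q / y ^+ N' * c + x * c * d).
split; first by rewrite mulf_neq0.
  by do 2?[apply: (subringD rB)]; do 3?[apply: (subringM rB) => //];
    try exact: B1_hs; try exact: B1_yVX; exact: B1_x.
by rewrite hsM exprD; field; rewrite !y_pow_neq0.
Qed.

Lemma not_P1_neq0 b : ~ P1 b -> b != 0.
Proof. by apply: contra_notN => /eqP ->; exact: ks_0. Qed.

Lemma not_P1_1 : ~ P1 1.
Proof.
apply/(not_P1 (subring1 rB)); exists 1, 0%N, 0; rewrite oner_neq0 hs1 expr0 divr1 mulr0 addr0.
by split=> //; exact: ks_0.
Qed.

Lemma B1_O : B1 `<=` O.
Proof. by move=> f Bf; exists f, 1; rewrite divr1; split=> //; [exact: subring1 rB|exact: not_P1_1]. Qed.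

Lemma O_ring : is_subring O.
Proof.
split; first by apply: B1_O; exact: subring1 rB.
  move=> _ _ [a [b [Ba Bb nb ->]]] [a' [b' [Ba' Bb' nb' ->]]].
  exists (a * b' - a' * b), (b * b'); split; [|exact: (subringM rB)|exact: not_P1M|].
    by apply: (subringB rB); exact: (subringM rB).
  by field; rewrite !not_P1_neq0.
move=> _ _ [a [b [Ba Bb nb ->]]] [a' [b' [Ba' Bb' nb' ->]]].
exists (a * a'), (b * b'); split; try exact: (subringM rB); first exact: not_P1M.
by field; rewrite !not_P1_neq0.
Qed.

Lemma hs_not_P1 p : p != 0 -> ~ P1 (hs iota y p).
Proof.
move=> p0; apply/(not_P1 (B1_hs p)); exists p, 0%N, 0; rewrite expr0 divr1 mulr0 addr0.
by split=> //; exact: ks_0.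
Qed.

Lemma hs_num_neq0 q : hs iota y q != 0 -> q != 0.
Proof. by apply: contraNneq => ->; rewrite hs0. Qed.

Lemma K1_ring : is_subring K1.
Proof.
split; first by exists 1, 1; rewrite hs1 divr1 oner_neq0.
  move=> _ _ [p [q [q0 ->]]] [p' [q' [q'0 ->]]].
  exists (p * q' - p' * q), (q * q'); rewrite hsM mulf_neq0 //; split=> //.
  by rewrite hsB !hsM; field; rewrite ?q0 ?q'0.
move=> _ _ [p [q [q0 ->]]] [p' [q' [q'0 ->]]].
by exists (p * p'), (q * q'); rewrite !hsM mulf_neq0 // mulf_div.
Qed.

(** The decomposition of an element of [O] into its residue and a multiple of [x] follows from the
    decompositions of its numerator and denominator given by [B1_split]. *)
Lemma divisor_dvr : coefficient_dvr O K1 x.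
Proof.
have KO : K1 `<=` O.
  move=> _ [p [q [q0 ->]]]; exists (hs iota y p), (hs iota y q).
  by split=> //; [exact: B1_hs|exact: B1_hs|apply: hs_not_P1; exact: hs_num_neq0].
have Kl p N : K1 (hs iota y p / y ^+ N).
  by exists p, ('X^N); rewrite hsXn hsX y_pow_neq0.
split.
- exact: O_ring.
- by apply: B1_O; exact: B1_x.
- exact: x_neq0.
- exact: KO.
- exact: K1_ring.
- move=> _ [p [q [q0 ->]]]; have [->|p0] := eqVneq p 0.
    by rewrite hs0 mul0r invr0; exact: subring0 K1_ring.
  by exists q, p; rewrite hsy_neq0 // invf_div.
- move=> _ [a [b [Ba Bb nb ->]]]; have [p [N [c [Bc aE]]]] := B1_split Ba.
  have [q [N' [d [q0 Bd bE]]]] := (not_P1 Bb).1 nb.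
  pose ra := hs iota y p / y ^+ N; pose rb := hs iota y q / y ^+ N'.
  have Bra : B1 ra by apply: (subringM rB); [exact: B1_hs|exact: B1_yVX].
  have Brb : B1 rb by apply: (subringM rB); [exact: B1_hs|exact: B1_yVX].
  have rb0 : rb != 0 by rewrite mulf_neq0 ?invr_eq0 ?y_pow_neq0 ?hsy_neq0.
  have nrb : ~ P1 rb.
    apply/(not_P1 Brb); exists q, N', 0; rewrite mulr0 addr0; split=> //; exact: ks_0.
  exists (ra / rb), ((c * rb - ra * d) / (rb * b)); split.
  + by apply: (subringM K1_ring); [exact: Kl|exists ('X^N'), q; rewrite hsXn hsX hsy_neq0 // /rb invf_div].
  + exists (c * rb - ra * d), (rb * b); split=> //; last exact: not_P1M.
      by apply: (subringB rB); exact: (subringM rB).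
    exact: (subringM rB).
  have b0 := not_P1_neq0 nb; move: b0; rewrite aE bE -/ra -/rb => b0.
  clear nrb Bra Brb; move: rb0 b0; move: ra rb => ra rb rb0 b0.
  by field; rewrite rb0 b0.
- move=> _ _ [p [q [q0 ->]]] [a [b [Ba Bb nb ->]]] e.
  have [q' [N' [d [q'0 Bd bE]]]] := (not_P1 Bb).1 nb; have b0 := not_P1_neq0 nb.
  have : p * q' = 0.
    apply: (@curve_indep _ (y ^+ N' * (a * hs iota y q - hs iota y p * d))).
      apply: (subringM rB); first exact: (subringX rB _ B1_y).
      by apply: (subringB rB); apply: (subringM rB) => //; exact: B1_hs.
    have e1 : hs iota y p * b = x * (a * hs iota y q).
      move: e => /(congr1 (fun z => z * (hs iota y q * b))) => e.
      have <- : hs iota y p / hs iota y q * (hs iota y q * b) = hs iota y p * b by field.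
      by rewrite e; field.
    have e2 : hs iota y q' = y ^+ N' * (b - x * d) by rewrite bE addrK mulrC divfK ?y_pow_neq0.
    rewrite hsM e2; transitivity (y ^+ N' * (hs iota y p * b - x * hs iota y p * d)); first by ring.
    by rewrite e1; ring.
  by move=> /eqP; rewrite mulf_eq0 (negbTE q'0) orbF => /eqP ->; rewrite hs0 mul0r.
move=> _ _ [p [q [q0 ->]]] [a [b [Ba Bb nb ->]]] r0.
have p0 : p != 0 by apply: contraNneq r0 => ->; rewrite hs0 mul0r.
have npb : ~ P1 (hs iota y p * b) by apply: not_P1M => //; [exact: B1_hs|exact: hs_not_P1].
have b0 := not_P1_neq0 nb.
have Bn : B1 (hs iota y p * b + x * a * hs iota y q).
  by apply: (subringD rB); do 2?[apply: (subringM rB) => //]; try exact: B1_hs; exact: B1_x.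
have nn : ~ P1 (hs iota y p * b + x * a * hs iota y q).
  move=> /P1E [c Bc e]; apply: npb; apply/P1E; exists (c - a * hs iota y q).
    by apply: (subringB rB) => //; apply: (subringM rB) => //; exact: B1_hs.
  by rewrite mulrBr -e; ring.
exists (hs iota y q * b), (hs iota y p * b + x * a * hs iota y q); split=> //.
  by apply: (subringM rB) => //; exact: B1_hs.
rewrite -[RHS]invf_div; congr (_^-1).
by field; rewrite q0 b0.
Qed.
End Curve.
End Charts.

(** * Toric charts *)

Section Reversal.
Variables (k F : fieldType) (iota : {rmorphism k -> F}) (s : F).
Hypothesis s0 : s != 0.
Implicit Types p q : {poly k}.

(** The coefficients in the opposite order, so that [p(s)] is [s ^+ deg p] times [reversal p] at [1/s]. *)
Definition reversal p : {poly k} := \poly_(i < size p) p`_((size p).-1 - i).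

Lemma hs_wide (t : F) p N : (size p <= N)%N -> hs iota t p = \sum_(i < N) iota p`_i * t ^+ i.
Proof.
move=> sN; rewrite /hs (@horner_coef_wide _ N) ?size_map_poly //.
by apply: eq_bigr => i _; rewrite coef_map.
Qed.

Lemma hs_reversal p : hs iota s p = s ^+ (size p).-1 * hs iota s^-1 (reversal p).
Proof.
rewrite (hs_wide _ (leqnn _)) (@hs_wide _ (reversal p) (size p)) ?size_poly //.
rewrite mulr_sumr (reindex_inj rev_ord_inj); apply: eq_bigr => i _ /=.
have e : ((size p).-1 = (size p - i.+1) + i)%N /\ ((size p).-1 - i = size p - i.+1)%N.
  by case: i => i /=; move: (size p) => b; lia.
rewrite coef_poly ltn_ord e.2 mulrCA e.1 exprD exprVn; congr (_ * _).
by rewrite mulfK // expf_neq0.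
Qed.

Lemma irr_X : monic_irreducible ('X : {poly k}).
Proof. by rewrite -['X]subr0; exact: irr_XsubC. Qed.

Lemma dvdX p : ('X %| p) = (p`_0 == 0).
Proof. by rewrite -['X]subr0 dvdp_XsubCl -horner_coef0. Qed.

Lemma reversal_ndvd p : p != 0 -> ~~ ('X %| reversal p).
Proof. by move=> p0; rewrite dvdX coef_poly size_poly_gt0 p0 subn0 lead_coef_eq0. Qed.

(** In the coordinate [1/s] the value of [p] is that of [reversal p], which is not divisible by ['X],
    divided by the power [deg p] of the coordinate. *)
Lemma has_val_infinity p q : p != 0 -> q != 0 ->
  has_val iota s^-1 'X (hs iota s p / hs iota s q) (place_val None p - place_val None q).
Proof.
move=> p0 q0; have ix := irr_X; have np := reversal_ndvd p0; have nq := reversal_ndvd q0.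
have rp : reversal p != 0 by apply: contraNneq np => ->; exact: dvdp0.
have rq : reversal q != 0 by apply: contraNneq nq => ->; exact: dvdp0.
exists ('X ^+ (size q).-1 * reversal p), ('X ^+ (size p).-1 * reversal q).
have X0 m : ('X ^+ m : {poly k}) != 0 by rewrite expf_neq0 // (irr_neq0 ix).
split; rewrite ?mulf_neq0 //.
  rewrite (hs_reversal p) (hs_reversal q) !hsM !hsXn !hsX !exprVn.
  move: (hs iota _ _) (hs iota _ _) => a b.
  by rewrite !invfM !invrK; ring.
rewrite !mu_unique // size_polyX /= !mul1n; move: p0 q0; rewrite -!size_poly_gt0.
by move: (size p) (size q) => a b; lia.
Qed.
End Reversal.

Section Toric.
Variables (k F : fieldType) (iota : {rmorphism k -> F}) (chi : Z2 -> F).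
Hypothesis hc : is_char chi.
Notation ks := (kspan iota chi).
Hypothesis disj : forall (S S' : set Z2) f, (forall u, S u -> S' u -> False) ->
  ks S f -> ks S' f -> f = 0.
Variables (v G0 : Z2).
Hypothesis G0v : wedge G0 v = 1.
Let x := chi G0.
Let y := chi v.
Notation O := (divisor_ring iota chi v).
Notation K1 := (torus_fractions iota chi v).
Notation res := (res O K1 x).
Let dvr := divisor_dvr hc disj G0v.
Let rO := cd_O dvr.
Let rB := B1_ring iota hc G0v.
Let y0 : y != 0 := chi_neq0 hc v.
Let ytr p : hs iota y p = 0 -> p = 0 := hs_trans hc disj G0v.

Lemma y_char_inv : chi (- v) = y^-1. Proof. exact: charN. Qed.

Lemma yV_trans p : hs iota y^-1 p = 0 -> p = 0.
Proof. by rewrite -y_char_inv; apply: (hs_trans hc disj (b := - G0)); rewrite wedgeNl wedgeNr opprK. Qed.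

Lemma hs_inv_K1 p : K1 (hs iota y^-1 p).
Proof.
have y'0 : y^-1 != 0 by rewrite invr_eq0.
rewrite (hs_reversal _ y'0) invrK exprVn mulrC.
by exists (reversal p), ('X ^+ (size p).-1); rewrite hsXn hsX expf_neq0.
Qed.

Lemma torus_fractions_inv r :
  K1 r <-> exists p q, hs iota y^-1 q != 0 /\ r = hs iota y^-1 p / hs iota y^-1 q.
Proof.
split=> [[p [q [q0 ->]]]|[p [q [q0 ->]]]]; last first.
  apply: (subringM (cd_K1 dvr)); first exact: hs_inv_K1.
  by apply: (cd_inv dvr); exact: hs_inv_K1.
rewrite (hs_reversal _ y0 p) (hs_reversal _ y0 q).
exists ('X ^+ (size q).-1 * reversal p), ('X ^+ (size p).-1 * reversal q).
move: q0; rewrite (hs_reversal _ y0 q) mulf_eq0 negb_or => /andP [_ q0].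
rewrite !hsM !hsXn !hsX !exprVn mulf_neq0 ?invr_eq0 ?expf_neq0 //; split=> //.
move: (hs iota _ _) (hs iota _ _) q0 => a b b0.
by rewrite !invfM !invrK; ring.
Qed.

Lemma chi_unit_O u : wedge u v = 0 -> O (chi u).
Proof.
move=> u0; apply: (B1_O hc disj G0v); apply: ks_char; by rewrite /= u0.
Qed.

Lemma res_char_pos u : 0 < wedge u v -> O (chi u) /\ res (chi u) = 0.
Proof.
move=> uv; have B : open_chart iota chi v (chi (u - G0)).
  by apply: ks_char; rewrite /= wedgeDl wedgeNl G0v; move: uv; lia.
have -> : chi u = x * chi (u - G0) by rewrite -(chiD hc) addrC subrK.
have OB := B1_O hc disj G0v B.
by split; [apply: (subringM rO) => //; exact: (cd_x dvr)|exact: (resx dvr)].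
Qed.

Lemma char_O u : O (chi u) -> 0 <= wedge u v.
Proof.
move=> Ou; rewrite leNgt; apply/negP => uv.
have [On r0] : O (chi (- u)) /\ res (chi (- u)) = 0.
  by apply: res_char_pos; rewrite wedgeNl; move: uv; lia.
have := resM dvr Ou On; rewrite -(chiD hc) subrr chi0 // (res1 dvr) r0 mulr0 => /eqP.
by rewrite oner_eq0.
Qed.

(** A chart with coordinates [chi G] and [chi v ^ s], the latter invertible if [inv]. *)
Section ToricChart.
Variables (G : Z2) (s : int) (inv : bool).
Hypotheses (Gv : wedge G v = 1) (ss : s = 1 \/ s = -1).
Definition toric_coords := ks [set u | 0 <= wedge u v /\ (inv || (0 <= s * wedge G u))].
Notation A := toric_coords.
Let z := chi (s *: v).

Let sq : s * s = 1. Proof. by case: ss => ->. Qed.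
Let zO : 0 = wedge (s *: v) v. Proof. by rewrite wedgeZl wedgexx mulr0. Qed.
Let zG : s * wedge G (s *: v) = 1. Proof. by rewrite wedgeZr Gv mulr1. Qed.

Lemma tc_ring : is_subring A.
Proof.
apply: (ks_ring iota hc) => [|a b] /=; first by split; rewrite ?wedge0l ?wedge0r ?mulr0 ?lexx ?orbT.
rewrite wedgeDl wedgeDr (mulrDr s (wedge G a)) => -[h1 h2] [h3 h4]; split; first by lia.
by case/orP: h2 => [->//|h2]; case/orP: h4 => [->//|h4]; by rewrite (addr_ge0 h2 h4) orbT.
Qed.
Let rA := tc_ring.

Lemma tc_hs p : A (hs iota z p).
Proof.
apply: (@hs_ks _ _ iota _ hc _ (s *: v) p) => [|a b|] //=; first by split; rewrite ?wedge0l ?wedge0r ?mulr0 ?lexx ?orbT.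
  rewrite wedgeDl wedgeDr (mulrDr s (wedge G a)) => -[h1 h2] [h3 h4]; split; first by lia.
  by case/orP: h2 => [->//|h2]; case/orP: h4 => [->//|h4]; by rewrite (addr_ge0 h2 h4) orbT.
by split; rewrite -?zO ?zG ?orbT.
Qed.

Lemma tc_B1 : A `<=` open_chart iota chi v.
Proof. by move=> f; apply: (ks_sub hc) => u []. Qed.

Lemma tc_sub : A `<=` O.
Proof. by move=> f /tc_B1; exact: (B1_O hc disj G0v). Qed.

Lemma tc_zV : inv -> A z^-1.
Proof.
move=> iv; rewrite -(charN _ hc); apply: ks_char => /=.
by rewrite iv wedgeNl -zO oppr0.
Qed.

Lemma tc_split f : A f -> exists p N a,
  [/\ A a, A (z ^+ N)^-1 & f = hs iota z p / z ^+ N + chi G * a].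
Proof.
have z0 N : z ^+ N != 0 by rewrite expf_neq0 // chi_neq0.
have A1 := subring1 rA; have A0 := subring0 rA.
move: f; apply: ks_ind.
- by exists 0, 0%N, 0; rewrite hs0 mul0r mulr0 addr0 expr0 invr1.
- move=> f g [p [N [c [Bc AN ->]]]] [q [N' [d [Bd AN' ->]]]].
  exists (p * 'X^N' + q * 'X^N), (N + N')%N, (c + d); split; first exact: (subringD rA).
    by rewrite exprD invfM; exact: (subringM rA).
  by rewrite hsD !hsM !hsXn hsX exprD; field; rewrite !z0.
move=> c u [/= uv uG]; have [u0|u0] := eqVneq (wedge u v) 0.
  have -> : chi u = z ^ (s * wedge G u).
    rewrite -(chiZ hc) scalerA mulrAC sq mul1r.
    by rewrite {1}(wedge_basis u Gv) u0 scale0r add0r.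
  move: uG; case: (s * wedge G u) => j uG.
    exists (c *: 'X^j), 0%N, 0; split=> //; first by rewrite expr0 invr1.
    by rewrite hsZ hsXn hsX expr0 divr1 mulr0 addr0.
  exists c%:P, j.+1, 0; split=> //; last by rewrite hsC mulr0 addr0 NegzE -exprnN.
  by rewrite -exprVn; apply: subringX => //; apply: tc_zV; case: (inv) uG.
exists 0, 0%N, (iota c * chi (u - G)); split; last 2 first.
- by rewrite expr0 invr1.
- by rewrite hs0 mul0r add0r mulrCA -(chiD hc) addrC subrK.
apply: ks_mono => /=; rewrite wedgeDl wedgeNl Gv wedgeDr wedgeNr wedgexx subr0; split=> //.
by move: uv u0; lia.
Qed.

Lemma tc_clear f : open_chart iota chi v f -> exists N, A (z ^+ N * f).
Proof.
have Az N : A (z ^+ N) by have := tc_hs ('X^N); rewrite hsXn hsX.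
move: f; apply: ks_ind.
- by exists 0%N; rewrite mulr0; exact: subring0 rA.
- move=> f g [N hN] [N' hN']; exists (N + N')%N; rewrite mulrDr exprD.
  apply: (subringD rA); first by rewrite mulrAC mulrC; exact: (subringM rA).
  by rewrite -mulrA; exact: (subringM rA).
move=> c u /= uv; exists (absz (wedge G u)).
rewrite mulrCA /z -(charMn _ _ hc) -(chiD hc); apply: ks_mono => /=.
rewrite -scaler_nat !wedgeDl !wedgeDr !wedgeZl !wedgeZr wedgexx Gv !mulr0 add0r mulr1; split=> //.
apply/orP; right; rewrite mulrDr mulrCA sq mulr1.
by move: (wedge G u) => w; case: ss => ->; lia.
Qed.

Lemma z_fractions r : K1 r <-> exists p q, hs iota z q != 0 /\ r = hs iota z p / hs iota z q.
Proof.
rewrite /z; case: ss => ->; first by rewrite scale1r.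
by rewrite scaleN1r y_char_inv; exact: torus_fractions_inv.
Qed.

Lemma chi_G_x c : open_chart iota chi v c -> exists2 d, O d & chi G * c = x * d.
Proof.
move=> Bc; exists (chi (G - G0) * c); last first.
  by rewrite mulrA -(chiD hc) [G0 + _]addrC subrK.
apply: (subringM rO); last exact: (B1_O hc disj G0v).
by apply: chi_unit_O; rewrite wedgeDl wedgeNl Gv G0v.
Qed.

(** By [tc_split] an element is a polynomial in the coordinate along the curve, divided by a power of
    this coordinate where that is allowed, plus a multiple of [chi G]. *)
Lemma toric_chartP : chart iota O K1 x z A (chi G).
Proof.
have z0 N : z ^+ N != 0 by rewrite expf_neq0 // chi_neq0.
have num a : A a -> exists p N a', [/\ A a', A (z ^+ N)^-1, res a = hs iota z p / z ^+ N
    & a = res a + chi G * a'].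
  move=> /tc_split [p [N [a' [Aa' AN aE]]]]; exists p, N, a'.
  have [d Od e] := chi_G_x (tc_B1 Aa').
  have r : res a = hs iota z p / z ^+ N.
    rewrite aE e (res_eq dvr) //; apply/z_fractions; exists p, 'X^N.
    by rewrite hsXn hsX z0.
  by split=> //; rewrite r.
split.
- exact: rA.
- exact: tc_sub.
- exact: tc_hs.
- by move=> a /num [p [N [a' [Aa' AN -> _]]]]; apply: (subringM rA) => //; exact: tc_hs.
- by move=> a /num [p [N [a' [Aa' AN -> _]]]]; exists p, 'X^N; rewrite hsXn hsX z0.
- by apply: ks_char; rewrite /= Gv wedgexx mulr0 lexx orbT.
- exact: chi_neq0.
- by apply: (proj2 (res_char_pos _)); rewrite Gv.
- by move=> a /num [p [N [a' [Aa' AN _ aE]]]] r0; exists a' => //; rewrite aE r0 add0r.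
move=> f [a [b [Ba Bb nb ->]]]; have [N AN] := tc_clear Ba; have [N' AN'] := tc_clear Bb.
have Az m : A (z ^+ m) by have := tc_hs ('X^m); rewrite hsXn hsX.
exists (z ^+ N' * (z ^+ N * a)), (z ^+ N * (z ^+ N' * b)); split; try exact: (subringM rA).
  have Kz m : K1 (z ^+ m) by apply/z_fractions; exists 'X^m, 1; rewrite hs1 oner_neq0 hsXn hsX divr1.
  have Oz m := tc_sub (Az m); have Ob := B1_O hc disj G0v Bb.
  rewrite (resM dvr (Oz N) (subringM rO (Oz N') Ob)) (resM dvr (Oz N') Ob).
  rewrite !(res_K1 dvr (Kz _)) mulf_neq0 // mulf_neq0 //.
  have [p [M [c [p0 Bc ->]]]] := (not_P1 hc disj G0v Bb).1 nb.
  rewrite (res_eq dvr); last 2 first.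
  - by exists p, 'X^M; rewrite hsXn hsX expf_neq0.
  - exact: (B1_O hc disj G0v).
  by rewrite mulf_neq0 ?invr_eq0 ?expf_neq0 // (hsy_neq0 hc disj G0v).
by rewrite !mulrA [z ^+ N' * _]mulrC -mulf_div divff ?mul1r // mulf_neq0.
Qed.
End ToricChart.
End Toric.

(** * Boundary curves of the blown-up toric surface *)

Section Surface.
Variables (k F : fieldType) (iota : {rmorphism k -> F}) (chi : Z2 -> F).
Hypothesis hc : is_char chi.
Notation ks := (kspan iota chi).
Hypothesis disj : forall (S S' : set Z2) f, (forall u, S u -> S' u -> False) ->
  ks S f -> ks S' f -> f = 0.
Variable Sigma : {fset {fset Z2}}.
Hypothesis fan : complete_nonsingular_fan Sigma.

Definition cone_chart (S : {fset Z2}) : set F := ks [set u | forall w, w \in S -> 0 <= wedge u w].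
Definition toric_points : set (set F) := [set P | exists2 S, S \in Sigma & Spec (cone_chart S) P].

(** Distinct characters are linearly independent. *)
Lemma ks_char_in (S : set Z2) u : ks S (chi u) -> S u.
Proof.
move=> h; apply: contrapT => nS; have := chi_neq0 hc u.
suff -> : chi u = 0 by rewrite eqxx.
apply: (disj (S := S) (S' := [set w | w = u])) => //; last exact: ks_char.
by move=> w Sw wu; apply: nS; rewrite -wu.
Qed.

Lemma cone_chart_ring (S : {fset Z2}) : is_subring (cone_chart S).
Proof.
apply: (ks_ring iota hc) => [w _|a b ha hb w wS] /=; first by rewrite wedge0l.
by rewrite wedgeDl addr_ge0 ?ha ?hb.
Qed.

Lemma cone_chart_mono (S T : {fset Z2}) : (T `<=` S)%fset -> cone_chart S `<=` cone_chart T.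
Proof. by move=> /fsubsetP TS f; apply: (ks_sub hc) => u h w /TS; exact: h. Qed.

Variable v : Z2.
Hypothesis vS : [fset v]%fset \in Sigma.
Let vp := next Sigma 1 v.
Let vm := next Sigma (-1) v.

Let vpP : [fset v; vp]%fset \in Sigma /\ wedge v vp = 1.
Proof. by apply: nextP => //; left. Qed.
Let vmP : [fset v; vm]%fset \in Sigma /\ wedge v vm = -1.
Proof. by apply: nextP => //; right. Qed.
Let vmv : wedge vm v = 1. Proof. by rewrite wedgeC vmP.2 opprK. Qed.
Let vpv : wedge (- vp) v = 1. Proof. by rewrite wedgeNl wedgeC opprK vpP.2. Qed.

Let x := chi vm.
Let y := chi v.
Notation O := (divisor_ring iota chi v).
Notation K1 := (torus_fractions iota chi v).
Notation res := (res O K1 x).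
Let dvr : coefficient_dvr O K1 x := divisor_dvr hc disj vmv.
Let rO := cd_O dvr.
Let y0 : y != 0 := chi_neq0 hc v.
Let ytr p : hs iota y p = 0 -> p = 0 := hs_trans hc disj vmv.
Let yVtr p : hs iota y^-1 p = 0 -> p = 0 := yV_trans hc disj vmv (p := p).
Let Ky r : K1 r <-> exists p q, hs iota y q != 0 /\ r = hs iota y p / hs iota y q.
Proof. by []. Qed.
Let KyV r : K1 r <-> exists p q, hs iota y^-1 q != 0 /\ r = hs iota y^-1 p / hs iota y^-1 q.
Proof. exact: (torus_fractions_inv hc disj vmv). Qed.

Notation A0 := (cone_chart [fset v]%fset).
Notation Ap := (cone_chart [fset v; vp]%fset).
Notation Am := (cone_chart [fset v; vm]%fset).

Lemma cone_chart1 : A0 = toric_coords iota chi v vm 1 true.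
Proof.
congr ks; apply/seteqP; split=> u /=; first by move=> h; split=> //; apply: h; rewrite inE.
by move=> [h _] w; rewrite inE => /eqP ->.
Qed.

Lemma cone_chartp : Ap = toric_coords iota chi v (- vp) 1 false.
Proof.
congr ks; apply/seteqP; split=> u /=; rewrite mul1r wedgeNl -wedgeC.
  by move=> h; split; apply: h; rewrite !inE eqxx ?orbT.
by move=> [h1 h2] w; rewrite !inE => /orP [] /eqP ->.
Qed.

Lemma cone_chartm : Am = toric_coords iota chi v vm (-1) false.
Proof.
congr ks; apply/seteqP; split=> u /=; rewrite mulN1r -wedgeC.
  by move=> h; split; apply: h; rewrite !inE eqxx ?orbT.
by move=> [h1 h2] w; rewrite !inE => /orP [] /eqP ->.
Qed.

Lemma chart1 : chart iota O K1 x y A0 x.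
Proof.
have := toric_chartP hc disj vmv true vmv (or_introl erefl).
by rewrite scale1r -cone_chart1.
Qed.

Lemma chartp : chart iota O K1 x y Ap (chi (- vp)).
Proof.
have := toric_chartP hc disj vmv false vpv (or_introl erefl).
by rewrite scale1r -cone_chartp.
Qed.

Lemma chartm : chart iota O K1 x y^-1 Am x.
Proof.
have := toric_chartP hc disj vmv false vmv (or_intror erefl).
by rewrite scaleN1r -cone_chartm charN.
Qed.

(** The points of the curve are those of the open chart, where [y] is invertible, and the torus fixed
    points [y = 0] and [y = oo] on it, which are seen in the charts of the cones spanned with the
    two neighbouring rays. *)
Definition point_at (pi : {poly k}) := chart_ring iota O K1 x y A0 pi.
Definition point_zero := chart_ring iota O K1 x y Ap 'X.
Definition point_inf := chart_ring iota O K1 x y^-1 Am 'X.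

Lemma ndvd_pow (pi : {poly k}) N : monic_irreducible pi -> pi != 'X -> ~~ (pi %| 'X^N).
Proof.
move=> ip piX; elim: N => [|N IH]; first exact: one_ndvd.
rewrite exprS irr_mul // negb_or IH andbT; apply: contra piX => h.
by apply/eqP; apply: irr_dvd_irr => //; exact: irr_X.
Qed.

Lemma admissible1 (pi : {poly k}) : monic_irreducible pi -> pi != 'X -> admissible iota y A0 pi.
Proof.
move=> ip piX; rewrite /admissible cone_chart1 => h.
have [p [N [a [Aa AN]]]] := tc_split hc vmv vmv (or_introl erefl) h.
rewrite !scale1r => e; apply: (negP (ndvd_pow N ip piX)).
have h0 := hs_neq0 ytr (irr_neq0 ip).
suff : 'X^N - p * pi = 0 by move/eqP; rewrite subr_eq0 => /eqP ->; exact: dvdp_mull.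
apply: (curve_indep hc disj vmv (c := y ^+ N * a * hs iota y pi)).
  have rB := B1_ring iota hc vmv; apply: (subringM rB); last exact: (B1_hs iota hc vmv).
  by apply: (subringM rB); [exact: (subringX rB _ (B1_y iota chi v))|exact: (tc_B1 hc) Aa].
have e2 : hs iota (chi v) p = y ^+ N * ((hs iota y pi)^-1 - x * a).
  by rewrite e addrK mulrC divfK // expf_neq0.
rewrite hsB hsM hsXn hsX e2 -/y -/x; move: (hs iota y pi) h0 => b b0.
by field.
Qed.

Lemma admissiblep : admissible iota y Ap 'X.
Proof.
rewrite /admissible hsX -(charN v hc) => /ks_char_in /(_ vp).
by rewrite !inE eqxx orbT wedgeNl vpP.2 => /(_ isT).
Qed.

Lemma admissiblem : admissible iota y^-1 Am 'X.
Proof.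
rewrite /admissible hsX invrK => /ks_char_in /(_ vm).
by rewrite !inE eqxx orbT vmP.2 => /(_ isT).
Qed.

Lemma point_at_cp (pi : {poly k}) : monic_irreducible pi -> pi != 'X -> curve_point iota O K1 x y pi (point_at pi) x.
Proof. by move=> ip piX; apply: (chart_point dvr Ky ytr chart1) => //; exact: admissible1. Qed.

Lemma point_zero_cp : curve_point iota O K1 x y 'X point_zero (chi (- vp)).
Proof. by apply: (chart_point dvr Ky ytr chartp); [exact: irr_X|exact: admissiblep]. Qed.

Lemma point_inf_cp : curve_point iota O K1 x y^-1 'X point_inf x.
Proof. by apply: (chart_point dvr KyV yVtr chartm); [exact: irr_X|exact: admissiblem]. Qed.

Lemma point_at_spec (pi : {poly k}) : monic_irreducible pi -> pi != 'X -> Spec A0 (point_at pi).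
Proof. by move=> ip piX; apply: (chart_ring_Spec dvr ytr chart1) => //; exact: admissible1. Qed.

Lemma point_at_toric (pi : {poly k}) : monic_irreducible pi -> pi != 'X -> toric_points (point_at pi).
Proof. by move=> ip piX; exists [fset v]%fset => //; exact: point_at_spec. Qed.

Lemma point_zero_toric_spec : [fset v; vp]%fset \in Sigma /\ Spec Ap point_zero.
Proof.
split; first exact: vpP.1.
by apply: (chart_ring_Spec dvr ytr chartp); [exact: irr_X|exact: admissiblep].
Qed.

Lemma point_inf_toric_spec : [fset v; vm]%fset \in Sigma /\ Spec Am point_inf.
Proof.
split; first exact: vmP.1.
by apply: (chart_ring_Spec dvr yVtr chartm); [exact: irr_X|exact: admissiblem].
Qed.

(** The characters in the dual cone are regular at [P], so [fan_dual] applies. *)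
Lemma toric_cone (S : {fset Z2}) P w : S \in Sigma -> [fset w]%fset \in Sigma -> Spec (cone_chart S) P ->
  (forall u, P (chi u) -> 0 <= wedge u w) -> w \in S.
Proof.
move=> SS wS [p [pp PE]] h; apply: (fan_dual fan) => // u uS; apply: h.
by rewrite PE; apply: (sub_localization (cone_chart_ring S) pp); exact: ks_char.
Qed.

Lemma cone_chart1_B1 : open_chart iota chi v = A0.
Proof.
congr ks; apply/seteqP; split=> u /=; first by move=> h w; rewrite inE => /eqP ->.
by apply; rewrite inE.
Qed.

Lemma open_point P : Spec A0 P -> P `<=` O -> P <> O ->
  exists pi, [/\ monic_irreducible pi, pi != 'X & P = point_at pi].
Proof.
move=> sP PO nPO; have [pi [ip ad ->]] := chart_classify dvr ytr chart1 sP PO nPO.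
exists pi; split=> //; apply: contraPneq ad => -> h; apply: h.
by rewrite hsX -(charN v hc); apply: ks_char => w; rewrite inE => /eqP ->; rewrite wedgeNl wedgexx.
Qed.

(** A point of the curve lies in the chart of a cone containing [v]. In the charts of the two cones of
    dimension two all points of the curve but one belong to the open chart. *)
Lemma toric_classify P : toric_points P -> P `<=` O -> P <> O ->
  [\/ P = point_inf, P = point_zero
    | exists pi, [/\ monic_irreducible pi, pi != 'X & P = point_at pi]].
Proof.
move=> [S SS sP] PO nPO.
have vinS : v \in S.
  by apply: (toric_cone SS vS sP) => u /PO; exact: (char_O hc disj vmv).
case: (cone_of_ray fan SS vinS) => SE; rewrite SE in sP.
- by constructor 3; exact: open_point.
- have [pi [ip ad PE]] := chart_classify dvr ytr chartp sP PO nPO.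
  have [piX|piX] := eqVneq pi 'X; first by constructor 2; rewrite PE piX.
  constructor 3; apply: open_point => //; rewrite PE chart_ringE.
  apply: (Spec_between (ch_ring chartp) (chart_prime dvr ytr chartp ip ad) (ch_ring chart1)).
    by apply: cone_chart_mono; rewrite fsubsetUl.
  move=> a; rewrite -cone_chart1_B1 => /(tc_clear hc vmv false vpv (or_introl erefl)) [N].
  rewrite -cone_chartp scale1r => AN; exists (y ^+ N * a), (y ^+ N); split=> //.
  + by have := ch_hs chartp ('X^N); rewrite hsXn hsX.
  + have -> : y ^+ N = hs iota y 'X^N by rewrite hsXn hsX.
    case=> _; rewrite (res_K1 dvr); last by apply: (place_ring_sub Ky ytr); exact: (hs_place_ring iota y ip).
    by move=> /(place_max_hs ytr ip); apply/negP; exact: ndvd_pow.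
  by rewrite mulrAC divff ?mul1r // expf_neq0.
have [pi [ip ad PE]] := chart_classify dvr yVtr chartm sP PO nPO.
have [piX|piX] := eqVneq pi 'X; first by constructor 1; rewrite PE piX.
constructor 3; apply: open_point => //; rewrite PE chart_ringE.
apply: (Spec_between (ch_ring chartm) (chart_prime dvr yVtr chartm ip ad) (ch_ring chart1)).
  by apply: cone_chart_mono; rewrite fsubsetUl.
move=> a; rewrite -cone_chart1_B1 => /(tc_clear hc vmv false vmv (or_intror erefl)) [N].
rewrite -cone_chartm scaleN1r charN // => AN; exists (y^-1 ^+ N * a), (y^-1 ^+ N); split=> //.
- by have := ch_hs chartm ('X^N); rewrite hsXn hsX.
- have -> : y^-1 ^+ N = hs iota y^-1 'X^N by rewrite hsXn hsX.
  case=> _; rewrite (res_K1 dvr); last by apply: (place_ring_sub KyV yVtr); exact: (hs_place_ring iota _ ip).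
  by move=> /(place_max_hs yVtr ip); apply/negP; exact: ndvd_pow.
by rewrite mulrAC divff ?mul1r // expf_neq0 // invr_eq0.
Qed.

(** ** Centers and the blown-up surface *)
Section Centers.
Variables (n : nat) (w : 'I_n -> Z2) (tau : 'I_n -> k).
Hypotheses (wS : forall i, [fset w i]%fset \in Sigma) (tau0 : forall i, tau i != 0).
Let f0 i := 1 + iota (tau i) * chi (w i).

Definition curve_ring i : set F := localization (cone_chart fset0)
  [set f | exists2 g, cone_chart fset0 g & f = (1 + iota (tau i) * chi (w i)) * g].
Definition centers i : set (set F) := [set P | [/\ toric_points P,
  P `<=` divisor_ring iota chi (w i) & P `<=` curve_ring i]].

Let iota0 i : iota (tau i) != 0. Proof. by rewrite fmorph_eq0. Qed.

Lemma f0_neq0 i : f0 i != 0.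
Proof.
apply/eqP => e; have w0 := ray_neq0 fan (wS i); have := oner_neq0 F.
suff -> : (1 : F) = 0 by rewrite eqxx.
apply: (disj (S := [set u | u = 0]) (S' := [set u | u = w i])).
- by move=> u /= -> e0; rewrite -e0 eqxx in w0.
- by rewrite -(chi0 hc); exact: ks_char.
have -> : 1 = iota (- tau i) * chi (w i); last exact: ks_mono.
by rewrite rmorphN mulNr; apply/eqP; rewrite -subr_eq0 opprK; apply/eqP; exact: e.
Qed.

(** The inverse of [f0 i] is not regular along the curve [f0 i = 0]. *)
Lemma curve_ring_nonunit i : ~ curve_ring i (f0 i)^-1.
Proof.
move=> [a [b [Aa Ab nb e]]]; apply: nb; exists a => //; rewrite -/(f0 i).
have b0 : b != 0.
  by apply/eqP => b0; have := f0_neq0 i; rewrite -invr_eq0 e b0 invr0 mulr0 eqxx.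
by apply: (mulIf (_ : (f0 i)^-1 != 0)); rewrite ?invr_eq0 ?f0_neq0 // mulrAC divff ?f0_neq0 // mul1r e mulrC divfK.
Qed.

Lemma center_ray (S : {fset Z2}) P i : S \in Sigma -> Spec (cone_chart S) P ->
  P `<=` divisor_ring iota chi (w i) -> w i \in S.
Proof.
move=> SS sP PD; apply: (toric_cone SS (wS i) sP) => u /PD.
have [_ e] : [fset w i; next Sigma (-1) (w i)]%fset \in Sigma /\ wedge (w i) (next Sigma (-1) (w i)) = -1.
  by apply: nextP => //; right.
by apply: (char_O hc disj (G0 := next Sigma (-1) (w i))); rewrite wedgeC e opprK.
Qed.

(** The root of [1 + tau i * 'X]. *)
Definition center_value i : k := - (tau i)^-1.
Notation pi_ i := ('X - (center_value i)%:P).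

Lemma center_value_neq0 i : center_value i != 0.
Proof. by rewrite oppr_eq0 invr_eq0. Qed.

Lemma pi_X i : pi_ i != 'X.
Proof.
rewrite -subr_eq0 addrAC subrr sub0r oppr_eq0 polyC_eq0; exact: center_value_neq0.
Qed.

Lemma f0_hs i : w i = v -> f0 i = hs iota y (1 + (tau i)%:P * 'X).
Proof. by move=> wi; rewrite hsD hs1 hsM hsC hsX /f0 wi. Qed.

Lemma f0_pi i : w i = v -> f0 i = iota (tau i) * hs iota y (pi_ i).
Proof.
move=> wi; rewrite hsB hsX hsC /f0 wi /center_value rmorphN fmorphV opprK mulrDr mulfV //.
by rewrite addrC.
Qed.

Lemma place_cp_unit s pi P g p : (forall q, hs iota s q = 0 -> q = 0) -> monic_irreducible pi ->
  curve_point iota O K1 x s pi P g -> ~~ (pi %| p) -> P (hs iota s p)^-1.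
Proof.
move=> tr ip cp np; apply: (cp_place cp); exists 1, p; split=> //.
by rewrite hs1 div1r.
Qed.

Lemma chart_unit s A g pi f p q : chart iota O K1 x s A g -> A f -> res f = iota q ->
  q != 0 -> p = f^-1 -> (forall r, hs iota s r = 0 -> r = 0) -> monic_irreducible pi ->
  chart_ring iota O K1 x s A pi p.
Proof.
move=> ch Af rf q0 -> tr ip; exists 1, f; rewrite div1r; split=> //.
  exact: subring1 (ch_ring ch).
rewrite rf -(hsC iota s) => /(place_max_hs tr ip); apply/negP.
apply/negP => /dvdp_leq; rewrite polyC_eq0 q0 => /(_ isT).
by rewrite size_polyC q0; have := irr_size ip; case: (size pi) => [|[]].
Qed.

Lemma curve_ring_O i : w i = v -> ~ O `<=` curve_ring i.
Proof.
move=> wi h; apply: (@curve_ring_nonunit i); apply: h; apply: (cd_sub dvr).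
rewrite (f0_hs wi); apply: (cd_inv dvr); exists (1 + (tau i)%:P * 'X), 1.
by rewrite hs1 divr1 oner_neq0.
Qed.

Lemma ndvd_X c d : c != 0 -> ~~ ('X %| (c%:P + d%:P * 'X : {poly k})).
Proof. by move=> c0; rewrite dvdX coefD coefC coefMX /= addr0. Qed.

(** By [curve_ring_nonunit] the inverse of [f0 i] is not regular at a center. If [w i = v] then
    [f0 i] is a polynomial in [y] of degree one, so the center is its zero. Otherwise the point lies
    on two boundary curves, so it is one of the fixed points, where the inverse of [f0 i] is regular
    because [f0 i] is a unit or has a pole. *)
Lemma center_on_curve i P : centers i P -> P `<=` O -> w i = v /\ P = point_at (pi_ i).
Proof.
move=> [tP PD PC] PO.
have nu := @curve_ring_nonunit i.
have [PE|nPO] := boolp.pselect (P = O).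
  have wi : w i = v.
    have [S SS sP] := tP.
    have : w i \in [fset v]%fset; last by rewrite inE => /eqP.
    apply: (fan_dual fan) => // u uv.
    have [_ e] : [fset w i; next Sigma (-1) (w i)]%fset \in Sigma /\ wedge (w i) (next Sigma (-1) (w i)) = -1.
      by apply: nextP => //; right.
    apply: (char_O hc disj (G0 := next Sigma (-1) (w i))); first by rewrite wedgeC e opprK.
    apply: PD; rewrite PE; apply: (ch_sub chart1); exact: ks_char.
  by case: (curve_ring_O wi); rewrite -PE.
have [PE|PE|[pi [ip piX PE]]] := toric_classify tP PO nPO.
- have [cs rs] := point_inf_toric_spec.
  have : w i \in [fset v; vm]%fset by apply: (center_ray cs) PD; rewrite PE.
  rewrite !inE => /orP [] /eqP wi; case: nu; apply: PC; rewrite PE.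
    rewrite (f0_hs wi).
    have -> : hs iota y (1 + (tau i)%:P * 'X) = hs iota y^-1 ((tau i)%:P + 1%:P * 'X) / hs iota y^-1 'X.
      by rewrite (hsD _ y) (hsD _ y^-1) !hsM !hsC !hsX rmorph1 mul1r mulrDl divff ?invr_eq0 // invrK addrC.
    rewrite invf_div; apply: (cp_place point_inf_cp).
    by exists 'X, ((tau i)%:P + 1%:P * 'X); split=> //; exact: ndvd_X.
  have Ax : Am (chi (w i)) by rewrite wi; exact: (ch_g chartm).
  have At c : Am (iota c) by rewrite -(hsC iota y^-1); exact: (ch_hs chartm).
  have rA := ch_ring chartm.
  have Oi : O (iota (tau i)) by apply: (ch_sub chartm).
  apply: (chart_unit (f := f0 i) (q := 1) chartm) => //.
  + by apply: (subringD rA); [exact: subring1 rA|exact: (subringM rA)].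
  + rewrite /f0 wi [_ * chi _]mulrC (res_eq dvr) ?rmorph1 //; exact: subring1 (cd_K1 dvr).
  + exact: oner_neq0.
  + exact: irr_X.
- have [cs rs] := point_zero_toric_spec.
  have : w i \in [fset v; vp]%fset by apply: (center_ray cs) PD; rewrite PE.
  rewrite !inE => /orP [] /eqP wi; case: nu; apply: PC; rewrite PE.
    rewrite (f0_hs wi); apply: (place_cp_unit ytr (irr_X k) point_zero_cp).
    by rewrite -[1]/(1%:P); exact: ndvd_X (oner_neq0 k).
  have rA := ch_ring chartp; have gp := ch_g chartp.
  have At c : Ap (iota c) by rewrite -(hsC iota y); exact: (ch_hs chartp).
  have -> : (f0 i)^-1 = chi (- vp) * (iota (tau i) + chi (- vp))^-1.
    rewrite /f0 wi -/vp charN //; have := f0_neq0 i; rewrite /f0 wi.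
    have := chi_neq0 hc vp; move: (chi vp) => z z0 f00.
    have -> : iota (tau i) + z^-1 = (1 + iota (tau i) * z) / z by field.
    by rewrite invf_div mulrA mulVf // mul1r.
  have Kt : K1 (iota (tau i)) by exists (tau i)%:P, 1; rewrite hs1 hsC divr1 oner_neq0.
  apply: (subringM (cp_ring point_zero_cp)); first exact: (cp_gP point_zero_cp).
  apply: (chart_unit (f := iota (tau i) + chi (- vp)) (q := tau i) chartp) => //.
  + exact: (subringD rA).
  + rewrite (resD dvr); [|exact: (cd_sub dvr)|exact: (ch_sub chartp)].
    by rewrite (ch_resg chartp) addr0 (res_K1 dvr).
  + exact: irr_X.
have [cs rs] := (conj vS (point_at_spec ip piX)).
have : w i \in [fset v]%fset by apply: (center_ray cs) PD; rewrite PE.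
rewrite inE => /eqP wi; split=> //; rewrite PE; congr point_at.
apply: contrapT => npi; case: nu; apply: PC; rewrite PE f0_pi // invfM.
have cp := point_at_cp ip piX.
apply: (subringM (cp_ring cp)).
  rewrite -(hsC iota y); apply: (place_cp_unit ytr ip cp).
  apply/negP => /dvdp_leq; rewrite polyC_eq0 tau0 => /(_ isT).
  by rewrite size_polyC tau0; have := irr_size ip; case: (size pi) => [|[]].
apply: (place_cp_unit ytr ip cp); apply/negP => h; apply: npi.
by apply: irr_dvd_irr => //; exact: irr_XsubC.
Qed.

(** As [f0 i] does not vanish on the whole curve, a function of the open chart that is divisible by
    [f0 i] on the torus is so in the chart, and vanishes at the point. *)
Lemma center_point i : w i = v -> centers i (point_at (pi_ i)).
Proof.
move=> wi; have ip := irr_XsubC (center_value i); have piX := pi_X i.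
have cp := point_at_cp ip piX; split; first exact: point_at_toric.
  by rewrite wi; exact: (cp_sub cp).
have rA := ch_ring chart1.
have sub0 : A0 `<=` cone_chart fset0 by apply: cone_chart_mono; rewrite fsub0set.
move=> _ [a [b [Aa Ab nb ->]]]; exists a, b; split=> //; try exact: sub0.
move=> [c Tc bE]; apply: nb; rewrite -/(f0 i) in bE.
have [N AN] : exists N, A0 (x ^+ N * c).
  move: c Tc {bE}; apply: ks_ind.
  - by exists 0%N; rewrite mulr0; exact: subring0 rA.
  - move=> f g [N hN] [N' hN']; exists (N + N')%N; rewrite mulrDr exprD.
    have Ax m : A0 (x ^+ m) by apply: (subringX rA); exact: (ch_g chart1).
    apply: (subringD rA); first by rewrite mulrAC mulrC; exact: (subringM rA).
    by rewrite -mulrA; exact: (subringM rA).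
  move=> c u _; exists (absz (wedge u v)).
  rewrite mulrCA /x -(charMn _ _ hc) -(chiD hc); apply: ks_mono => z; rewrite inE => /eqP ->.
  rewrite -scaler_nat wedgeDl wedgeZl vmv.
  by move: (wedge u v) => d; lia.
have Af : A0 (f0 i) by rewrite (f0_hs wi); exact: (ch_hs chart1).
have OA := ch_sub chart1.
have rf : res (f0 i) = f0 i.
  rewrite (f0_hs wi) (res_K1 dvr) //; exists (1 + (tau i)%:P * 'X), 1.
  by rewrite hs1 divr1 oner_neq0.
have Ac : A0 c.
  elim: N AN => [|N IH]; rewrite ?expr0 ?mul1r // exprS -mulrA => AN; apply: IH.
  have Ax : A0 x := ch_g chart1.
  have e : x * (x ^+ N * b) = f0 i * (x * (x ^+ N * c)) by rewrite bE; ring.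
  have r0 : res (x * (x ^+ N * c)) = 0.
    have := congr1 res e; rewrite (resx dvr); last first.
      by apply: (subringM rO); [apply: (subringX rO); exact: (cd_x dvr)|exact: OA].
    rewrite (resM dvr (OA _ Af) (OA _ AN)) rf => /esym/eqP.
    by rewrite mulf_eq0 (negbTE (f0_neq0 i)) => /eqP.
  have [a' Aa'] := ch_div chart1 AN r0.
  by move=> /(mulfI (chi_neq0 hc vm)) ->.
rewrite bE (resM dvr (OA _ Af) (OA _ Ac)) rf (f0_pi wi) -mulrA.
have hr := chart_place_ring chart1 (admissible1 ip piX) Ac.
rewrite -(hsC iota y); apply/(place_maxM ytr ip).
- exact: (hs_place_ring iota y ip).
- by apply: (subringM (place_ring_ring ytr ip)) => //; exact: (hs_place_ring iota y ip).
right; apply/(place_maxM ytr ip) => //; first exact: (hs_place_ring iota y ip).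
by left; apply/(place_max_hs ytr ip); exact: dvdpp.
Qed.

Definition fibre : set (set F) := blowup toric_points (\bigcup_(i in [set: 'I_n]) centers i).

(** ** Closed points of the curve on the blown-up surface *)
Definition is_center (pi : {poly k}) : bool := [exists i, (w i == v) && (pi == pi_ i)].

(** The point of the proper transform at a place: over a center it lies on the blown-up chart. *)
Definition curve_place (pl : place k) : set F :=
  if pl is Some pi then
    if pi == 'X then point_zero
    else if is_center pi then blowup_point iota O K1 x y A0 pi else point_at pi
  else point_inf.

Definition place_coord (pl : place k) : F := if pl is Some _ then y else y^-1.
Definition place_poly (pl : place k) : {poly k} := if pl is Some pi then pi else 'X.
Definition place_equation (pl : place k) : F :=
  if pl is Some pi then
    if pi == 'X then chi (- vp) else if is_center pi then x / hs iota y pi else x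
  else x.

Lemma is_centerP pi : is_center pi -> exists2 i, w i = v & pi = pi_ i.
Proof. by move=> /existsP [i /andP [/eqP wi /eqP pE]]; exists i. Qed.

Lemma is_center_pi i : w i = v -> is_center (pi_ i).
Proof. by move=> wi; apply/existsP; exists i; rewrite wi !eqxx. Qed.

Lemma place_coord_K pl r :
  K1 r <-> exists p q, hs iota (place_coord pl) q != 0 /\ r = hs iota (place_coord pl) p / hs iota (place_coord pl) q.
Proof. by case: pl => [pi|]; [exact: Ky|exact: KyV]. Qed.

Lemma place_coord_trans pl p : hs iota (place_coord pl) p = 0 -> p = 0.
Proof. by case: pl => [pi|]; [exact: ytr|exact: yVtr]. Qed.

Lemma place_poly_irr pl : is_place pl -> monic_irreducible (place_poly pl).
Proof. by case: pl => [pi|_] //; exact: irr_X. Qed.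

Lemma curve_place_cp pl : is_place pl ->
  curve_point iota O K1 x (place_coord pl) (place_poly pl) (curve_place pl) (place_equation pl).
Proof.
case: pl => [pi ip|_]; last exact: point_inf_cp.
rewrite /= ; case: eqVneq => [->|piX]; first exact: point_zero_cp.
case: ifP => _; last exact: point_at_cp.
exact: (blowup_point_cp dvr Ky ytr chart1 ip (admissible1 ip piX)).
Qed.

Lemma curve_point_inv s pi P g p : (forall q, hs iota s q = 0 -> q = 0) ->
  (forall r, K1 r <-> exists p q, hs iota s q != 0 /\ r = hs iota s p / hs iota s q) ->
  monic_irreducible pi -> curve_point iota O K1 x s pi P g -> p != 0 ->
  P (hs iota s p)^-1 <-> ~~ (pi %| p).
Proof.
move=> tr Ks ip cp p0; split; last exact: (place_cp_unit tr ip cp).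
have h0 := hs_neq0 tr p0.
have Kp : K1 (hs iota s p)^-1 by apply/Ks; exists 1, p; rewrite hs1 div1r.
move=> /(curve_point_place_ring dvr ip cp Kp) hr; apply/negP => dv.
apply: (place_max1 tr ip); rewrite -(mulVf h0); apply/(place_maxM tr ip hr).
  exact: (hs_place_ring iota s ip).
by right; apply/(place_max_hs tr ip).
Qed.

Lemma point_inf_y : ~ point_inf y.
Proof.
have X0 : ('X : {poly k}) != 0 by exact: irr_neq0 (irr_X k).
have := curve_point_inv yVtr KyV (irr_X k) point_inf_cp X0.
by rewrite hsX invrK dvdpp => -[h _] /h.
Qed.

Lemma curve_place_y pi : monic_irreducible pi -> curve_place (Some pi) y.
Proof.
move=> ip; apply: (cp_place (@curve_place_cp (Some pi) ip)).
by rewrite /= -{2}(hsX iota y); exact: (hs_place_ring iota y ip).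
Qed.

Lemma curve_place_inj pl pl' : is_place pl -> is_place pl' -> curve_place pl = curve_place pl' -> pl = pl'.
Proof.
case: pl => [pi|] ip; case: pl' => [pi'|] ip' e //; last 2 first.
- by case: point_inf_y; move: (curve_place_y ip); rewrite e.
- by case: point_inf_y; move: (curve_place_y ip'); rewrite -e.
congr Some; apply: contrapT => npi.
have h := curve_point_inv ytr Ky ip (@curve_place_cp (Some pi) ip) (irr_neq0 ip).
have h' := curve_point_inv ytr Ky ip' (@curve_place_cp (Some pi') ip') (irr_neq0 ip).
have : ~~ (pi %| pi).
  apply/h; rewrite e; apply/h'; apply/negP => dv; apply: npi.
  by rewrite (irr_dvd_irr ip' ip dv).
by rewrite dvdpp.
Qed.

Lemma point_at_y (pi : {poly k}) : monic_irreducible pi -> pi != 'X -> point_at pi y /\ point_at pi y^-1.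
Proof.
move=> ip piX; have cp := point_at_cp ip piX; split.
  by apply: (cp_place cp); rewrite -{2}(hsX iota y); exact: (hs_place_ring iota y ip).
have X0 : ('X : {poly k}) != 0 by exact: irr_neq0 (irr_X k).
have := curve_point_inv ytr Ky ip cp X0; rewrite hsX => -[_]; apply.
by have := ndvd_pow 1 ip piX; rewrite expr1.
Qed.

(** The blow-up replaces a center on the curve by the only point of the exceptional curve whose local
    ring is contained in that of the curve, by [blowup_point_uniq]. *)
Lemma closed_pointsP P : closed_points_on fibre O P <-> exists2 pl, is_place pl & P = curve_place pl.
Proof.
split=> [[fP PO nPO]|[pl ipl ->]]; last first.
  have cp := curve_place_cp ipl; split; last 2 first.
  - exact: (cp_sub cp).
  - exact: (curve_point_neq dvr (@place_coord_K pl) (@place_coord_trans pl) (place_poly_irr ipl) cp).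
  case: pl ipl cp => [pi ip|_] /=; last first.
    move=> cp; left; split.
      by have [cs rs] := point_inf_toric_spec; exists [fset v; vm]%fset.
    move=> [i _] /center_on_curve /(_ (cp_sub cp)) [wi e].
    by apply: point_inf_y; rewrite e; have [] := point_at_y (irr_XsubC (center_value i)) (pi_X i).
  case: eqVneq => [pE|piX] cp.
    left; split; first by have [cs rs] := point_zero_toric_spec; exists [fset v; vp]%fset.
    move=> [i _] /center_on_curve /(_ (cp_sub cp)) [wi e].
    have X0 : ('X : {poly k}) != 0 by exact: irr_neq0 (irr_X k).
    have := curve_point_inv ytr Ky (irr_X k) point_zero_cp X0.
    rewrite hsX dvdpp e => -[h _]; have [_ h'] := point_at_y (irr_XsubC (center_value i)) (pi_X i).
    by have := h h'.
  move: cp; case: ifP => ic cp.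
    right; have [i wi pE] := is_centerP ic; exists (point_at pi), (hs iota y pi); split.
    - by exists i => //; rewrite pE; exact: center_point.
    - exact: (max_eta dvr Ky ytr chart1 ip (admissible1 ip piX)).
    - by apply/eqP; exact: hs_neq0 (irr_neq0 ip).
    - exact: (blowup_point_Spec dvr Ky ytr chart1 ip (admissible1 ip piX)).
  left; split; first exact: point_at_toric.
  move=> [i _] /center_on_curve /(_ (cp_sub cp)) [wi e].
  suff pE : pi = pi_ i by move: ic; rewrite pE (is_center_pi wi).
  apply: contrapT => npi.
  have ii := irr_XsubC (center_value i); have cpi := point_at_cp ii (pi_X i).
  have h := curve_point_inv ytr Ky ip cp (irr_neq0 ip).
  have h' := curve_point_inv ytr Ky ii cpi (irr_neq0 ip).
  have : ~~ (pi %| pi).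
    apply/h; rewrite e; apply/h'; apply/negP => dv; apply: npi.
    by rewrite (irr_dvd_irr ii ip dv).
  by rewrite dvdpp.
case: fP => [[tP ncP]|[P0 [g [[i _ cP0] mg g0 sR]]]].
  have [->|->|[pi [ip piX PE]]] := toric_classify tP PO nPO.
  - by exists None.
  - by exists (Some 'X); [exact: irr_X|rewrite /= eqxx].
  exists (Some pi) => //=; rewrite (negbTE piX).
  case: ifP => // ic; case: ncP; have [i wi pE] := is_centerP ic; exists i => //.
  by rewrite PE pE; exact: center_point.
have P0R : P0 `<=` P.
  have [q [pq ->]] := sR.
  move=> f Pf; apply: (sub_localization (blowup_chart_ring _ _) pq).
  by move=> R rR PR _; exact: PR.
have [wi P0E] := center_on_curve cP0 (subset_trans P0R PO).
have ip := irr_XsubC (center_value i); have piX := pi_X i.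
exists (Some (pi_ i)) => //=; rewrite (negbTE piX).
rewrite (is_center_pi wi).
rewrite P0E in mg sR.
exact: (blowup_point_uniq dvr Ky ytr chart1 ip (admissible1 ip piX) mg g0 sR PO nPO).
Qed.

(** ** The self-intersection number *)
Section Degree.
Variable dv : int.
Hypothesis dvP : vp + vm = dv *: v.

Definition place_cofactor (pl : place k) : F :=
  if pl is Some pi then
    if pi == 'X then y ^ dv else if is_center pi then hs iota y pi else 1
  else 1.

Lemma place_cofactorE pl : is_place pl -> x = place_equation pl * place_cofactor pl.
Proof.
case: pl => [pi ip|_] /=; last by rewrite mulr1.
case: eqP => [_|_]; last first.
  by case: ifP => _; rewrite ?mulr1 // divfK // (hs_neq0 ytr (irr_neq0 ip)).
by rewrite -(chiZ hc) -dvP -(chiD hc) addKr.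
Qed.

(** The order at a place of [x], compared with the local equation of the proper transform. *)
Definition place_excess (pl : place k) : int :=
  (if pl == Some 'X then dv else 0) + (\sum_(i < n | w i == v) (pl == Some (pi_ i)))%N%:Z.

Hypothesis distinct : forall i j, w i = v -> w j = v -> i != j -> tau i != tau j.

Lemma center_value_inj i j : w i = v -> w j = v -> pi_ i = pi_ j -> i = j.
Proof.
move=> wi wj /(congr1 (fun p : {poly k} => p.[0])); rewrite !hornerXsubC !sub0r => /oppr_inj.
move=> /oppr_inj /invr_inj e; apply/eqP; apply: contraT => /(distinct wi wj).
by rewrite e eqxx.
Qed.

Lemma place_excess_val pl : is_place pl ->
  [/\ O (place_cofactor pl), res (place_cofactor pl) != 0
    & has_val iota (place_coord pl) (place_poly pl) (res (place_cofactor pl)) (place_excess pl)].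
Proof.
move=> ipl; have trp := @place_coord_trans pl; have irp := place_poly_irr ipl.
suff [Kc c0 hv] : [/\ K1 (place_cofactor pl), place_cofactor pl != 0
    & has_val iota (place_coord pl) (place_poly pl) (place_cofactor pl) (place_excess pl)].
  by rewrite (res_K1 dvr Kc); split=> //; exact: (cd_sub dvr).
have val1 : has_val iota (place_coord pl) (place_poly pl) 1 0.
  by exists 1, 1; rewrite !oner_neq0 hs1 divr1 subrr.
have K11 := subring1 (cd_K1 dvr).
case: pl ipl trp irp val1 => [pi ip|_] /= trp irp val1; last first.
  by rewrite /place_excess big1 ?addr0 ?oner_neq0.
case: eqP => [piX|/eqP piX]; last first.
  rewrite /place_excess (_ : (Some pi == Some 'X) = false) ?add0r; last first.
    by apply/eqP => -[] /eqP; rewrite (negbTE piX).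
  case: ifP => [ic|nic]; last first.
    rewrite big1 ?oner_neq0 // => i /eqP wi; case: eqP => // -[pE].
    by rewrite pE (is_center_pi wi) in nic.
  have [i wi pE] := is_centerP ic.
  rewrite (bigD1 i) /= ?wi ?eqxx // pE eqxx big1 => [|j /andP [/eqP wj ji]]; last first.
    by case: eqP => // -[/(center_value_inj wi wj) e]; rewrite e eqxx in ji.
  have pn : pi_ i != 0 by exact: irr_neq0 (irr_XsubC _).
  split; [by exists (pi_ i), 1; rewrite hs1 divr1 oner_neq0|exact: hs_neq0 pn|].
  exists (pi_ i), 1; rewrite pn oner_neq0 hs1 divr1; split=> //.
  rewrite (mu_irr (irr_XsubC _) (irr_XsubC _)) eqxx size_XsubC mu_ndvd; last 2 first.
  - exact: irr_XsubC.
  - exact: one_ndvd (irr_XsubC _).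
  by [].
rewrite piX /place_excess eqxx big1 ?addr0; last first.
  by move=> i /eqP wi; case: eqP => // -[e]; move: (pi_X i); rewrite -e eqxx.
have X0 m : 'X^m != 0 :> {poly k} by rewrite expf_neq0 // (irr_neq0 (irr_X k)).
have muX m : mu 'X ('X^m : {poly k}) = m.
  by rewrite -['X^m]mulr1 mu_unique ?oner_neq0 //; [exact: irr_X|exact: one_ndvd (irr_X k)].
have mu1 : mu 'X (1 : {poly k}) = 0%N by rewrite mu_ndvd //; [exact: irr_X|exact: one_ndvd (irr_X k)].
split; last 2 first.
- by rewrite expfz_neq0.
- case: dv => m.
    exists ('X^m), 1; rewrite X0 oner_neq0 hs1 divr1 hsXn hsX muX mu1 size_polyX /=; split=> //.
    by rewrite muln0 mul1n subr0.
  exists 1, 'X^(m.+1); rewrite X0 oner_neq0 hs1 div1r hsXn hsX muX mu1 size_polyX /=; split=> //.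
  by rewrite muln0 mul1n sub0r NegzE.
case: dv => m; first by exists ('X^m), 1; rewrite hs1 divr1 oner_neq0 hsXn hsX.
by exists 1, 'X^(m.+1); rewrite hs1 div1r hsXn hsX NegzE exprnN expf_neq0.
Qed.

Lemma place_val_has_val pl p q : is_place pl -> p != 0 -> q != 0 ->
  has_val iota (place_coord pl) (place_poly pl) (hs iota y p / hs iota y q)
    (place_val pl p - place_val pl q).
Proof.
case: pl => [pi ip|_] p0 q0 /=; first by exists p, q.
exact: has_val_infinity.
Qed.

(** Adding a place to a list that already gives the sum 0 does not change the sum. *)
Lemma place_val_support p (L : seq (place k)) pl : uniq L -> (forall z, z \in L -> is_place z) ->
  (forall L' : seq (place k), uniq L' -> (forall z, z \in L' -> is_place z) -> {subset L <= L'} ->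
     \sum_(z <- L') place_val z p = 0) ->
  is_place pl -> pl \notin L -> place_val pl p = 0.
Proof.
move=> uL pL h ip nL; have h1 := h L uL pL (fun _ => id).
have := h (pl :: L); rewrite /= nL big_cons h1 addr0; apply=> //.
  by move=> z; rewrite inE => /orP [/eqP ->|/pL].
by move=> z; rewrite inE orbC => ->.
Qed.

(** The conormal bundle of the curve has degree 2. Its section given by a uniformizer [h] has at each
    place the order of the residue of [h / x] plus [place_excess]. The orders of the residue, a
    rational function of [y], have sum 0 by [place_sum]; the excess is [dv] at [y = 0] and 1 at each
    of the centers on the curve. *)
Theorem degree_relation : self_intersection iota fibre O (-2) ->
  dv = 2 - (\sum_(i < n) (w i == v))%N%:Z.
Proof.
move=> [h [[mh uh] [ord [ordP _ dE]]]].
have [Oh rh] := (max_idealP dvr h).1 mh.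
have [wh Ow hE] := res_eq0 dvr Oh rh.
have rw : res wh != 0.
  have mx : max_ideal O x.
    apply/(max_idealP dvr); split; first exact: (cd_x dvr).
    by have := resx dvr (subring1 rO); rewrite mulr1.
  have [g' Og' xE] := uh x mx.
  have e : wh * g' = 1.
    by apply: (mulfI (cd_x0 dvr)); rewrite mulrA -hE -xE mulr1.
  apply/eqP => r0; have := resM dvr Ow Og'; rewrite e (res1 dvr) r0 mul0r => /eqP.
  by rewrite oner_eq0.
have [p [q [q0 rE]]] := (Ky _).1 (K1_res dvr Ow).
have qn : q != 0 by apply: contraNneq q0 => ->; rewrite hs0.
have pn : p != 0 by apply: contraNneq rw => p0; rewrite rE p0 hs0 mul0r.
have ordE pl : is_place pl -> ord (curve_place pl) = place_val pl p - place_val pl q + place_excess pl.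
  move=> ipl; have cp := curve_place_cp ipl; have [Oc rc vc] := place_excess_val ipl.
  have irp := place_poly_irr ipl; have trp := @place_coord_trans pl.
  have cl := (closed_pointsP _).2 (ex_intro2 _ _ pl ipl erefl).
  have [d [d' [v1 v2 ->]]] := conormal_order_val dvr (@place_coord_K pl) trp irp cp
    (place_cofactorE ipl) Oc rc hE Ow rw (ordP _ cl).
  rewrite (has_val_unique trp irp v2 vc); congr (_ + _).
  apply: (has_val_unique trp irp v1); rewrite rE; exact: place_val_has_val.
have [Fp [Fpp sp]] := place_sum pn; have [Fq [Fqp sq]] := place_sum qn.
pose L := undup (None :: Some 'X :: [seq Some (pi_ i) | i <- enum 'I_n] ++ Fp ++ Fq).
have uL : uniq L := undup_uniq _.
have LP pl : pl \in L -> is_place pl.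
  rewrite mem_undup !inE !mem_cat => /or4P [/eqP ->|/eqP ->|/mapP [i _ ->]|/orP [/Fpp|/Fqp]] //.
    exact: irr_X.
  exact: irr_XsubC.
have L0 : None \in L by rewrite mem_undup inE.
have LX : Some 'X \in L by rewrite mem_undup !inE eqxx.
have Li i : Some (pi_ i) \in L.
  by rewrite mem_undup !inE mem_cat map_f ?mem_enum // orbT.
have Lp z : z \in Fp -> z \in L by rewrite mem_undup !inE !mem_cat => ->; rewrite !orbT.
have Lq z : z \in Fq -> z \in L by rewrite mem_undup !inE !mem_cat => ->; rewrite !orbT.
have valp pl : is_place pl -> pl \notin L -> place_val pl p = 0.
  apply: place_val_support => // L' uL' pL' sL'; apply: sp => //; first exact: sL'.
  by move=> z /Lp /sL'.
have valq pl : is_place pl -> pl \notin L -> place_val pl q = 0.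
  apply: place_val_support => // L' uL' pL' sL'; apply: sq => //; first exact: sL'.
  by move=> z /Lq /sL'.
have exc pl : pl \notin L -> place_excess pl = 0.
  move=> nL; rewrite /place_excess; case: eqP => [e|_]; first by rewrite e LX in nL.
  by rewrite add0r big1 // => i _; case: eqP => // e; rewrite e Li in nL.
have sum : \sum_(P \in closed_points_on fibre O) ord P = \sum_(pl <- L) ord (curve_place pl).
  have uPL : uniq (map curve_place L).
    by rewrite map_inj_in_uniq // => a b /LP ia /LP ib; exact: curve_place_inj.
  rewrite -(big_map curve_place xpredT ord) (fsbig_seq _ _ uPL); apply/esym/fsbig_widen.
    by move=> P /= /mapP [pl pL ->]; apply/closed_pointsP; exists pl => //; exact: LP.
  move=> P [/closed_pointsP [pl ipl ->]] /= nP.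
  have nL : pl \notin L by apply: contra_notN nP => pL; exact: map_f.
  by rewrite ordE // valp // valq // exc // subrr addr0.
have exc_sum : \sum_(pl <- L) place_excess pl = dv + (\sum_(i < n) (w i == v))%N%:Z.
  rewrite big_split /=; congr (_ + _).
    rewrite (bigD1_seq _ LX uL) /= eqxx big1 ?addr0 // => pl /negbTE ->; by [].
  rewrite -(big_morph Posz PoszD (erefl : Posz 0%N = 0)) exchange_big /= big_mkcond /=.
  congr Posz; apply: eq_bigr => i _; case: eqP => // _.
  rewrite (bigD1_seq _ (Li i) uL) /= eqxx big1 // => pl /negbTE ->; by [].
have := dE; rewrite sum (eq_big_seq (fun pl => place_val pl p - place_val pl q + place_excess pl)).
  rewrite big_split /= sumrB sp // ?sq //; try by [move=> z /Lp|move=> z /Lq].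
  rewrite exc_sum subrr add0r => /eqP; rewrite eqr_opp => /eqP ->; by rewrite addrK.
by move=> pl /LP; exact: ordE.
Qed.
End Degree.
End Centers.
End Surface.

(** * Sections over glued tori *)

(** An ideal that is maximal among those that contain [I] and not 1 is prime. *)
Lemma prime_containing (F : fieldType) (A I : set F) : is_subring A -> is_ideal A I -> ~ I 1 ->
  exists2 P, is_prime_ideal A P & I `<=` P.
Proof.
move=> rA idI nI.
pose T := {J : set F | is_ideal A J /\ ~ J 1 /\ I `<=` J}.
pose R (J K : T) := `[< sval J `<=` sval K >].
have [||||[P hP] Pmax] := @Zorn T R.
- by move=> J; apply/asboolP.
- by move=> J K L /asboolP h1 /asboolP h2; apply/asboolP; exact: subset_trans h2.
- move=> [J hJ] [K hK] /asboolP /= h1 /asboolP /= h2; apply: eq_exist.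
  by apply/seteqP.
- move=> Ch tot; have [[J0 CJ0]|ne] := boolp.pselect (exists J, Ch J); last first.
    exists (exist _ I (conj idI (conj nI (@subset_refl _ I)))) => J CJ.
    by case: ne; exists J.
  pose U := [set f | exists2 J, Ch J & sval J f].
  have hU : is_ideal A U /\ ~ U 1 /\ I `<=` U.
    split; last split.
    + split.
      * by move=> f [[J [[h _ _ _] _]] _ /h].
      * by exists J0 => //; have [[]] := svalP J0.
      * move=> f g [J CJ Jf] [K CK Kg].
        have [/asboolP JK|/asboolP KJ] := tot _ _ CJ CK.
          exists K => //; have [[_ _ h _] _] := svalP K.
          by apply: (h _ _) => //; exact: JK.
        exists J => //; have [[_ _ h _] _] := svalP J.
        by apply: (h _ _) => //; exact: KJ.
      * move=> a f Aa [J CJ Jf]; exists J => //; have [[_ _ _ h] _] := svalP J; exact: h.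
    + by move=> [[J [h1 [h2 h3]]] _ /h2].
    + by move=> f If; exists J0 => //; have [_ [_ h]] := svalP J0; exact: h.
  by exists (exist _ U hU) => J CJ; apply/asboolP => f Jf; exists J.
have [[PA P0 PD PM] [P1 IP]] := hP.
exists P => //; split=> // a b Aa Ab Pab.
have big c : A c -> ~ P c -> exists p d, [/\ P p, A d & 1 = p + c * d].
  move=> Ac nPc; apply: contrapT => hn.
  pose J := [set f | exists p d, [/\ P p, A d & f = p + c * d]].
  have hJ : is_ideal A J /\ ~ J 1 /\ I `<=` J.
    have PJ f : P f -> J f by move=> Pf; exists f, 0; rewrite mulr0 addr0; split=> //; exact: subring0 rA.
    split; last split=> //; last by move=> f /IP /PJ.
    split.
    + by move=> _ [p [d [Pp Ad ->]]]; apply: (subringD rA); [exact: PA|exact: (subringM rA)].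
    + exact: PJ.
    + move=> _ _ [p [d [Pp Ad ->]]] [p' [d' [Pp' Ad' ->]]]; exists (p + p'), (d + d').
      by split; [exact: PD|exact: (subringD rA)|ring].
    + move=> r _ Ar [p [d [Pp Ad ->]]]; exists (r * p), (r * d).
      by split; [exact: PM|exact: (subringM rA)|ring].
  have RJ : R (exist _ P hP) (exist _ J hJ).
    by apply/asboolP => f Pf; exists f, 0; rewrite mulr0 addr0; split=> //; exact: subring0 rA.
  have e : J = P := congr1 sval (Pmax _ RJ).
  apply: nPc; rewrite -e; exists 0, 1; rewrite mulr1 add0r; split=> //.
  exact: subring1 rA.
have [Pa|nPa] := boolp.pselect (P a); [by left|right].
apply: contrapT => nPb; apply: P1.
have [p [c [Pp Ac e1]]] := big a Aa nPa; have [q [d [Pq Ad e2]]] := big b Ab nPb.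
have -> : 1 = (q + b * d) * p + (a * c) * q + (c * d) * (a * b).
  by rewrite -[LHS]mulr1 {1}e1 e2; ring.
apply: (PD _ _); first apply: (PD _ _).
- by apply: (PM _ _) => //; rewrite -e2; exact: subring1 rA.
- by apply: (PM _ _) => //; exact: (subringM rA).
- by apply: (PM _ _) => //; exact: (subringM rA).
Qed.

(** The possible denominators of [f] form an ideal that is contained in no prime ideal. *)
Lemma sections_Spec (F : fieldType) (A : set F) : is_subring A -> global_sections (Spec A) = A.
Proof.
move=> rA; apply/seteqP; split=> f; last first.
  move=> Af O [P [[[PA P0 PD PM] P1 _] ->]]; exists f, 1; rewrite divr1; split=> //.
  exact: subring1 rA.
move=> Gf; pose I := [set a | A a /\ A (a * f)].
have idI : is_ideal A I.
  split.
  + by move=> a [].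
  + by rewrite /I /= mul0r; split; exact: subring0 rA.
  + by move=> a b [Aa Af] [Ab Bf]; split; rewrite ?mulrDl; exact: (subringD rA).
  + by move=> r a Ar [Aa Af]; split; rewrite -?mulrA; exact: (subringM rA).
have [[_]|nI] := boolp.pselect (I 1); first by rewrite mul1r.
have [P Pp IP] := prime_containing rA idI nI.
have [a [b [Aa Ab nb fE]]] := Gf _ (ex_intro _ P (conj Pp erefl)).
case: nb; apply: IP; split=> //; rewrite fE mulrC divfK //.
by apply/eqP => b0; move: nI fE; rewrite b0 invr0 mulr0 => nI fE; apply: nI; split; rewrite ?mul1r ?fE; [exact: subring1 rA|exact: subring0 rA].
Qed.

(** ** Pull-backs of characters *)
Section Pulled.
Variables (k F : fieldType) (iota : {rmorphism k -> F}) (n : nat) (B : 'M[int]_n).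
Variables (T : 'rV[int]_n -> F) (chi0 : 'rV[int]_n * 'rV[int]_n -> F) (chi : 'rV[int]_n -> F).
Hypothesis chi0E : forall mx, chi0 mx = chi mx.1 * T mx.2.

Lemma pulled_charE s w mx : pulled_char B chi0 s w mx = word_char B T chi s w mx.1 * T mx.2.
Proof.
elim: w s chi0 chi chi0E mx => [|j w IH] s c0 c cE mx /=; first exact: cE.
by apply: IH => -[m x] /=; rewrite !cE /= /mut /mutated mulrAC (mulrC (T _)).
Qed.
End Pulled.

(** ** Coefficient rings *)
Section Coefficients.
Variables (k F : fieldType) (iota : {rmorphism k -> F}).

Lemma kspan_cat (G : eqType) (chi : G -> F) (S : set G) f g :
  kspan iota chi S f -> kspan iota chi S g -> kspan iota chi S (f + g).
Proof.
move=> [s [sS ->]] [t [tS ->]]; exists (s ++ t); split; last by rewrite /lincomb big_cat.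
by move=> x; rewrite mem_cat => /orP [/sS|/tS].
Qed.

Lemma kspan1 (G : eqType) (chi : G -> F) c u : kspan iota chi setT (iota c * chi u).
Proof. by exists [:: (c, u)]; split=> //; rewrite /lincomb big_seq1. Qed.

Lemma kspan_nil (G : eqType) (chi : G -> F) S : kspan iota chi S 0.
Proof. by exists [::]; rewrite /lincomb big_nil. Qed.

Section Ring.
Variables (N : zmodType) (T : N -> F).
Hypothesis Tchar : is_char T.
Definition coefficients : set F := kspan iota T setT.

Lemma coefficients_ring : is_subring coefficients.
Proof.
have [T0 TD] := Tchar.
have cM f g : coefficients f -> coefficients g -> coefficients (f * g).
  move=> [s [_ ->]] hg; rewrite /lincomb mulr_suml.
  elim: s => [|[c u] s IH]; first by rewrite big_nil; exact: kspan_nil.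
  rewrite big_cons; apply: kspan_cat => //=.
  case: hg => t [_ ->]; rewrite /lincomb mulr_sumr.
  elim: t => [|[d z] t IHt]; first by rewrite big_nil; exact: kspan_nil.
  rewrite big_cons; apply: kspan_cat => //=.
  have -> : iota c * T u * (iota d * T z) = iota (c * d) * T (u + z) by rewrite rmorphM TD; ring.
  exact: kspan1.
have c1 c : coefficients (iota c) by rewrite -[iota c]mulr1 -T0; exact: kspan1.
split=> //; first by rewrite -(rmorph1 iota).
by move=> f g hf hg; apply: kspan_cat => //; rewrite -mulN1r -(rmorph1 iota) -rmorphN; exact: cM.
Qed.

Lemma coefficients_T x : coefficients (T x).
Proof. by rewrite -[T x]mul1r -(rmorph1 iota); exact: kspan1. Qed.

Lemma coefficients_iota c : coefficients (iota c).
Proof. by rewrite -[iota c]mulr1 -(proj1 Tchar); exact: kspan1. Qed.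
End Ring.

Lemma span_coefficients (M N : zmodType) (T : N -> F) (chi : M -> F) (f : M * N -> F) :
  is_char T -> is_char chi -> (forall mx, f mx = chi mx.1 * T mx.2) ->
  kspan iota f setT = span (coefficients T) chi.
Proof.
move=> Tchar hc fE; have rC := coefficients_ring Tchar; apply/seteqP; split=> g.
  move=> [s [_ ->]]; have rS := span_ring rC hc; apply: (subring_sum rS) => -[c [m x]] _ /=.
  rewrite fE mulrCA; apply: (subringM rS); first exact: (span_char rC).
  apply: (span_scalar rC) => //; apply: (subringM rC); first exact: coefficients_iota.
  exact: coefficients_T.
apply: span_ind; first exact: kspan_nil.
  by move=> a b; exact: kspan_cat.
move=> c m [s [_ ->]]; rewrite /lincomb mulr_suml.
elim: s => [|[d x] s IH]; first by rewrite big_nil; exact: kspan_nil.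
rewrite big_cons; apply: kspan_cat => //=.
have -> : iota d * T x * chi m = iota d * f (m, x) by rewrite fE; ring.
exact: kspan1.
Qed.

(** A relation with these coefficients is a relation between the characters [chiL], and the terms with
    different first index [m] do not interfere. *)
Lemma lin_indep_coefficients (M N L : zmodType) (T : N -> F) (chi : M -> F) (chiL : L -> F)
  (j : M -> N -> L) (l : L -> M) : (forall m x, l (j m x) = m) -> is_subring (range iota) ->
  lin_indep (range iota) chiL -> (forall m, chi m != 0) ->
  (forall m x, chiL (j m x) = chi m * T x) -> lin_indep (coefficients T) chi.
Proof.
move=> lj rI li chi0 jE g Cg eg0.
have ch m : exists s : seq (k * N), mcoef g m = lincomb iota T s by have [s [_ ->]] := Cg m; exists s.
have [s sE] := boolp.choice ch.
pose G m := \sum_(a <- s m) mono (iota a.1) (j m a.2).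
have evG m : ev chiL (G m) = mcoef g m * chi m.
  rewrite ev_sum sE /lincomb mulr_suml; apply: eq_bigr => a _.
  by rewrite evU jE; ring.
have CG m : Cval (range iota) (G m).
  by apply: Cval_sum => // a _; apply: Cval_mono => //; exists a.1.
have Gl m u : mcoef (G m) u != 0 -> l u = m.
  rewrite mcoef_sum => h; apply: contrapT => nl; move/eqP: h; apply.
  rewrite big1_seq // => a _; apply/eqP; apply: contraT => /mcoefU_neq0 e.
  by case: nl; rewrite e lj.
have G0 : \sum_(m <- monalg.msupp g) G m = 0.
  apply: li; first by apply: Cval_sum => // m _; exact: CG.
  by rewrite ev_sum -[RHS]eg0 evE; apply: eq_bigr => m _; exact: evG.
apply: mcoefP => m; rewrite mcoef0.
have [ms|] := boolP (m \in monalg.msupp g); last first.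
  by rewrite mcoef_neq0 negbK => /eqP.
have Gm : G m = 0.
  apply: mcoefP => u; rewrite mcoef0; have := congr1 (fun h => mcoef h u) G0.
  rewrite mcoef_sum mcoef0 (bigD1_seq m) ?fset_uniq //=.
  have [lu|lu] := eqVneq (l u) m.
    rewrite big1 ?addr0 // => m' mm'; apply/eqP; apply: contraT => /Gl e.
    by rewrite -lu e eqxx in mm'.
  by move=> _; apply/eqP; apply: contraT => /Gl e; rewrite e eqxx in lu.
have := evG m; rewrite Gm ev0 => /esym/eqP.
by rewrite mulf_eq0 (negbTE (chi0 m)) orbF => /eqP.
Qed.
End Coefficients.

(** The points of each torus are all the prime ideals of its ring, so [sections_Spec] applies to each
    seed. *)
Lemma sections_glued (k F : fieldType) (iota : {rmorphism k -> F}) (n : nat) (B e : 'M[int]_n)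
  (T chi : 'rV[int]_n -> F) (chi0 : 'rV[int]_n * 'rV[int]_n -> F) :
  is_char T -> is_char chi -> (forall mx, chi0 mx = chi mx.1 * T mx.2) ->
  (forall w, is_char (word_char B T chi e w)) ->
  global_sections (glued_tori B iota chi0 e) = sections (coefficients iota T) B e T chi.
Proof.
move=> Tc hc cE hw.
have E w : kspan iota (pulled_char B chi0 e w) setT = span (coefficients iota T) (word_char B T chi e w).
  by apply: span_coefficients => // mx; exact: pulled_charE.
have rS w : is_subring (span (coefficients iota T) (word_char B T chi e w)).
  by apply: span_ring => //; exact: coefficients_ring.
apply/seteqP; split=> f.
  move=> Gf w; rewrite -(sections_Spec (rS w)) => O sO; apply: Gf.
  by exists w => //; rewrite /= E.
by move=> Sf O [w _]; rewrite E => sO; have := Sf w; rewrite -{1}(sections_Spec (rS w)); apply.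
Qed.

(** * General points, and the theorem *)

(** There are infinitely many natural numbers in [R], but finitely many roots of [p * 'X]. *)
Lemma natr_nonroot (R : idomainType) (p : {poly R}) :
  (forall m, (m%:R == 0 :> R) = (m == 0%N)) -> p != 0 -> exists2 m : nat, m%:R != 0 :> R & p.[m%:R] != 0.
Proof.
move=> char0 p0; pose q := p * 'X.
have q0 : q != 0 by rewrite mulf_neq0 // polyX_eq0.
have inj : injective (fun m : nat => m%:R : R).
  move=> a b; wlog ab : a b / (a <= b)%N => [h e|].
    by case: (leqP a b) => [/h ->//|/ltnW /h ->].
  move=> /esym/eqP; rewrite -subr_eq0 -natrB // char0 subn_eq0 => ba.
  by apply/eqP; rewrite eqn_leq ab.
have : ~~ all (root q) [seq m%:R | m <- iota 0 (size q)].
  apply/negP => /(max_poly_roots q0); rewrite size_map size_iota ltnn => h.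
  by have := h (etrans (map_inj_uniq inj _) (iota_uniq _ _)).
move=> /allPn [_ /mapP [m _ ->]]; rewrite /root hornerM hornerX mulf_eq0 negb_or => /andP [h1 h2].
by exists m.
Qed.

(** The vectors [(1, m, m ^+ 2, ..)] leave every finite union of hyperplanes. *)
Lemma generic_direction n (D : seq 'rV[int]_n) : (forall d, d \in D -> d != 0) ->
  exists a : 'rV[int]_n, forall d, d \in D -> pairing d a != 0.
Proof.
move=> D0; pose p := \prod_(d <- D) rVpoly d.
have p0 : p != 0.
  rewrite prodf_seq_neq0; apply/allP => d /D0 d0 /=; apply: contra d0 => /eqP e.
  by rewrite -[d]rVpolyK e linear0.
have [m _ pm] := natr_nonroot (fun m => pnatr_eq0 int m) p0.
exists (\row_i (m%:R ^+ i)) => d dD.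
have := pm; rewrite horner_prod prodf_seq_neq0 => /allP /(_ d dD) /=.
rewrite (horner_coef_wide _ (size_poly _ _)) pairingE => h.
apply: contra h => /eqP e; apply/eqP; rewrite -[RHS]e; apply: eq_bigr => i _.
by rewrite coef_rVpoly_ord mxE.
Qed.

Lemma monomial_curve (k : fieldType) n (a d : 'rV[int]_n) (l : k) : l != 0 ->
  monomial (fun i => l ^ a 0 i) d = l ^ pairing d a.
Proof.
move=> l0; rewrite /monomial pairingE.
rewrite (big_morph (fun z : int => l ^ z) (fun x y => expfzDr x y l0) (expr0z l)).
by apply: eq_bigr => i _; rewrite -exprz_exp [RHS]exprz_exp mulrC -exprz_exp.
Qed.

(** A formal sum may contain an exponent several times; only the sum of its coefficients matters. *)
Lemma laurent_coef (k : fieldType) n (p : laurent k n) : laurent_fun p <> 0 ->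
  exists2 m, m \in map snd p & \sum_(x <- p | x.2 == m) x.1 != 0.
Proof.
move=> p0; apply: contrapT => hn; apply: p0; rewrite /laurent_fun /lincomb.
pose ms := undup (map snd p).
transitivity (\sum_(x <- p) \sum_(m <- ms | x.2 == m) cst n x.1 * zmon k x.2).
  apply: eq_big_seq => x xp; have xm : x.2 \in ms by rewrite mem_undup map_f.
  by rewrite big_mkcond (bigD1_seq x.2) ?undup_uniq //= eqxx big1 ?addr0 // => m mx; rewrite eq_sym (negbTE mx).
rewrite (exchange_big_dep xpredT) //= big_seq big1 // => m; rewrite mem_undup => mp.
have c0 : \sum_(x <- p | x.2 == m) x.1 = 0.
  by apply/eqP; apply: contraT => h; case: hn; exists m.
transitivity (cstr k n (\sum_(x <- p | x.2 == m) x.1) * zmon k m); last by rewrite c0 rmorph0 mul0r.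
by rewrite rmorph_sum mulr_suml; apply: eq_bigr => x /eqP ->.
Qed.

(** On the curve [l |-> (l ^ a 0 i)_i] with [a] from [generic_direction] the exponents of [p] remain
    distinct, so the conditions become the nonvanishing of one polynomial at [l]. *)
Lemma generic_point (k : fieldType) n (p : laurent k n) (D : seq 'rV[int]_n) :
  [pchar k] =i pred0 -> laurent_fun p <> 0 -> (forall d, d \in D -> d != 0) ->
  exists t : 'I_n -> k, [/\ forall i, t i != 0, laurent_eval id t p != 0
    & forall d, d \in D -> monomial t d != 1].
Proof.
move=> /pcharf0P char0 /laurent_coef [m0 m0p c0] D0.
pose ms := map snd p.
have [a aP] : exists a : 'rV[int]_n, forall d, d \in D ++ [seq d <- [seq x - y | x <- ms, y <- ms] | d != 0] -> pairing d a != 0.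
  by apply: generic_direction => d; rewrite mem_cat mem_filter => /orP [/D0|/andP []].
have aD d : d \in D -> pairing d a != 0 by move=> dD; apply: aP; rewrite mem_cat dD.
have ainj x y : x \in ms -> y \in ms -> pairing x a = pairing y a -> x = y.
  move=> xm ym e; apply/eqP; rewrite -subr_eq0; apply: contraT => xy.
  have xyp : x - y \in [seq u - z | u <- ms, z <- ms] by apply/allpairsP; exists (x, y).
  have := aP (x - y); rewrite mem_cat mem_filter xy xyp orbT => /(_ isT).
  by rewrite pairingDl pairingNl e subrr eqxx.
pose K := (\sum_(x <- ms) absz (pairing x a))%N.
pose ex x := absz (pairing x a + K%:Z).
have exE x : x \in ms -> (ex x)%:Z = pairing x a + K%:Z.
  move=> xm; rewrite /ex gez0_abs //.
  have aux (b : int) (L : nat) : (absz b <= L)%N -> 0 <= b + L%:Z by lia.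
  by apply: aux; rewrite /K (big_rem x) //= leq_addr.
pose P : {poly k} := \sum_(x <- p) x.1 *: 'X^(ex x.2).
have P0 : P != 0.
  apply: contra c0 => /eqP /(congr1 (fun q : {poly k} => q`_(ex m0))).
  rewrite coef0 coef_sum => e; apply/eqP; rewrite -[RHS]e big_mkcond; apply: eq_big_seq => x xp.
  rewrite coefZ coefXn; have xm : x.2 \in ms by rewrite map_f.
  case: (eqVneq x.2 m0) => [->|ne]; first by rewrite eqxx mulr1.
  case: eqP => [e1|_]; last by rewrite mulr0.
  move/eqP: ne; case; apply: ainj => //; have := exE _ xm; rewrite -e1 exE //.
  by move/addIr.
pose Q := P * \prod_(d <- D) ('X^(absz (pairing d a)) - 1).
have Q0 : Q != 0.
  rewrite mulf_neq0 // prodf_seq_neq0; apply/allP => d dD /=.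
  by rewrite -size_poly_eq0 size_XnsubC // absz_gt0 aD.
have [m l0 Qm] := natr_nonroot char0 Q0; pose l : k := m%:R.
move: Qm; rewrite hornerM mulf_eq0 negb_or => /andP [Pl].
rewrite horner_prod prodf_seq_neq0 => /allP Dl.
exists (fun i => l ^ a 0 i); split.
- by move=> i; rewrite expfz_neq0.
- apply: contra Pl => /eqP e; apply/eqP.
  rewrite /P horner_sum -[RHS](mul0r (l ^ K%:Z)) -[in RHS]e /laurent_eval /lincomb mulr_suml.
  apply: eq_big_seq => x xp; rewrite hornerZ hornerXn monomial_curve //.
  by rewrite -mulrA -expfzDr // -exE ?map_f.
move=> d dD; rewrite monomial_curve //; have := Dl d dD; rewrite /= !hornerE.
apply: contra; rewrite subr_eq0; case: (pairing d a) => j //= /eqP.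
by rewrite NegzE -exprnN => /(congr1 GRing.inv); rewrite invrK invr1 => ->.
Qed.

Section Assembly.
Variables (k : fieldType) (n : nat) (B : 'M[int]_n) (e : 'M[int]_n)
  (psi : 'M[int]_(n, 2)) (Sigma : {fset {fset 'rV[int]_2}}).

Lemma boundary_divisorE v : @boundary_divisor k v = divisor_ring (cstr k 2) (@zmon k 2) v.
Proof.
by rewrite /divisor_ring (cone_chart1_B1 (cstr k 2) (@zmon k 2) v).
Qed.

Lemma fibre_surfaceE (t : 'I_n -> k) : fibre_surface psi e Sigma t =
  fibre (cstr k 2) (@zmon k 2) Sigma (wray psi e) (fun i => monomial t (row i e)).
Proof.
rewrite /fibre_surface /fibre; congr blowup; apply: eq_bigcupr => i _.
by apply/seteqP; split=> P [h1 h2 h3]; split=> //; move: h2; rewrite boundary_divisorE.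
Qed.

Hypothesis char0 : [pchar k] =i pred0.
Hypothesis e_basis : e \in unitmx.
Hypothesis Sigma_fan : complete_nonsingular_fan Sigma.
Hypothesis Sigma_rays : forall i, [fset wray psi e i]%fset \in Sigma.
Hypothesis D_minus2 : for_general_fibre B
     (fun t : 'I_n -> k => boundary_self_intersections psi e Sigma t (- 2)).

Lemma monomial_neq0 (t : 'I_n -> k) d : (forall i, t i != 0) -> monomial t d != 0.
Proof.
by move=> t0; rewrite /monomial prodf_seq_neq0; apply/allP => i _ /=; rewrite expfz_neq0.
Qed.

Lemma monomialB (t : 'I_n -> k) a b : (forall i, t i != 0) -> monomial t a = monomial t b ->
  monomial t (a - b) = 1.
Proof.
move=> t0 eab; have := divff (monomial_neq0 b t0); rewrite -{1}eab => <-.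
rewrite /monomial -prodf_div; apply: eq_bigr => i _.
by rewrite !mxE expfzDr // -invr_expz.
Qed.

(** It is enough to consider one fibre over a sufficiently general point [t]. There the centers on the
    curve are distinct, as [t ^ (e_i - e_j) <> 1], and [degree_relation] applies. *)
Lemma neighbour_relation v : [fset v]%fset \in Sigma ->
  next Sigma 1 v + next Sigma (-1) v = (2 - (\sum_(i < n) (wray psi e i == v))%N%:Z) *: v.
Proof.
move=> vS.
have [[pS pw] [qS qw]] := (nextP Sigma_fan vS (or_introl erefl), nextP Sigma_fan vS (or_intror erefl)).
have [dv dvP] : exists dv, next Sigma 1 v + next Sigma (-1) v = dv *: v.
  have h : wedge (next Sigma 1 v + next Sigma (-1) v) v = 0.
    by rewrite wedgeC wedgeDr pw qw subrr oppr0.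
  by exists (wedge (next Sigma 1 v + next Sigma (-1) v) (next Sigma 1 v)); exact: wedge_line.
have [Z [_ [p Zp p0] ZQ]] := D_minus2.
pose D := [seq d <- [seq row i e - row j e | i <- enum 'I_n, j <- enum 'I_n] | d != 0].
have [t [t0 tp tD]] : exists t : 'I_n -> k, [/\ forall i, t i != 0, laurent_eval id t p != 0
    & forall d, d \in D -> monomial t d != 1].
  by apply: generic_point => // d; rewrite mem_filter => /andP [].
have nZ : ~ in_closed id Z t by move=> h; move/eqP: tp; apply; exact: h.
have := ZQ t t0 nZ v vS; rewrite fibre_surfaceE boundary_divisorE => si.
rewrite dvP; congr (_ *: _).
have tau0 i : monomial t (row i e) != 0 by exact: monomial_neq0.
apply: (@degree_relation k (ratfun k 2) (cstr k 2) (@zmon k 2) (zmon_char k 2)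
  (@kspan_disjoint k 2) Sigma Sigma_fan v vS n _ _ Sigma_rays tau0 dv dvP _ si).
move=> i j _ _ ij; apply/eqP => /(monomialB t0) e1.
have d0 : row i e - row j e != 0.
  rewrite subr_eq0; apply: contra ij => /eqP /(congr1 (mulmx^~ (invmx e))).
  rewrite -!row_mul mulmxV // => /rowP /(_ i); rewrite !mxE eqxx (eq_sym j).
  by case: (i == j) => // /eqP; rewrite oner_eq0.
have := tD (row i e - row j e); rewrite e1 eqxx mem_filter d0 => h.
have : false; last by []; apply: h.
by apply/allpairsP; exists (i, j); rewrite !mem_enum.
Qed.

Lemma fan_ray_cycle : ray_cycle (wray psi e) (rays Sigma) (next Sigma 1) (next Sigma (-1)).
Proof.
have h1 : (1 : int) = 1 \/ (1 : int) = -1 by left.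
have h2 : (-1 : int) = 1 \/ (-1 : int) = -1 by right.
split=> [|i|v|v|v|v|v|v|v v'|v v'|v v']; rewrite ?mem_rays.
- exact: rays_uniq.
- exact: Sigma_rays.
- by move=> vS; exact: next_ray.
- by move=> vS; exact: next_ray.
- by move=> vS; have := nextK Sigma_fan vS h1.
- by move=> vS; have := nextK Sigma_fan vS h2; rewrite opprK.
- by move=> vS; have [] := nextP Sigma_fan vS h1.
- exact: neighbour_relation.
- move=> vS v'S pos; have [pS pw] := nextP Sigma_fan vS h1.
  by have := fan_separate Sigma_fan pS pw h1 v'S; rewrite !mul1r; apply.
- move=> vS v'S pos; have [pS pw] := nextP Sigma_fan vS h2.
  by have := fan_separate Sigma_fan pS pw h2 v'S; rewrite !mulN1r -!wedgeC; apply.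
- exact: rays_collinear.
Qed.

Hypothesis B_skew : B^T = - B.
Hypothesis B_rank2 : \rank (map_mx (intr : int -> rat) B) = 2%N.
Hypothesis psi_quotient : quotient_map B psi.

Lemma index_exists : inhabited 'I_n.
Proof.
case: n B B_rank2 => [|m] B' rk; last by constructor; exact: ord0.
by have := rank_leq_row (map_mx (intr : int -> rat) B'); rewrite rk.
Qed.

Lemma glued_sections_not_noetherian (L F : fieldType) (iota : {rmorphism L -> F})
  (T chi : 'rV[int]_n -> F) chi0 : is_char T -> (forall x, T x = 1 -> x = 0) -> is_char chi ->
  lin_indep (coefficients iota T) chi -> (forall mx, chi0 mx = chi mx.1 * T mx.2) ->
  ~ noetherian (global_sections (glued_tori B iota chi0 e)).
Proof.
move=> Tc Ti hc li cE; have [psi_surj _ psi_skew] := psi_quotient.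
have [k0] := index_exists; have rC := coefficients_ring iota Tc.
have CT := coefficients_T iota T.
rewrite (sections_glued iota Tc hc cE).
  exact: (sections_not_noetherian k0 rC Tc CT Ti B_skew psi_surj psi_skew e_basis fan_ray_cycle hc li).
move=> w; apply: (word_char_char rC CT B_skew w).
exact: (initial_good psi_surj psi_skew e_basis fan_ray_cycle hc li).
Qed.
End Assembly.

Lemma monomial_char (L : fieldType) n (t : 'I_n -> L) : (forall i, t i != 0) -> is_char (monomial t).
Proof.
move=> t0; split; first by rewrite /monomial big1 // => i _; rewrite mxE expr0z.
move=> a b; rewrite /monomial -big_split; apply: eq_bigr => i _ /=.
by rewrite mxE expfzDr.
Qed.

Theorem theorem6p2 (k : fieldType) (n : nat) (B : 'M[int]_n) (e : 'M[int]_n)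
  (psi : 'M[int]_(n, 2)) (Sigma : {fset {fset 'rV[int]_2}})
  (char0 : [pchar k] =i pred0)
  (B_skew : B^T = - B)
  (B_rank2 : \rank (map_mx (intr : int -> rat) B) = 2%N)
  (B_unimodular : unimodular_mod_radical B)
  (e_basis : e \in unitmx)
  (psi_quotient : quotient_map B psi)
  (e_primitive : forall i, primitive (wray psi e i))
  (Sigma_fan : complete_nonsingular_fan Sigma)
  (Sigma_rays : forall i, [fset wray psi e i]%fset \in Sigma)
  (D_minus2 : for_general_fibre B
     (fun t : 'I_n -> k => boundary_self_intersections psi e Sigma t (- 2))) :
  ~ noetherian (global_sections (Aprin B k e)) /\
  very_general k
    (fun (L : fieldType) (t : 'I_n -> L) =>
       ~ noetherian (global_sections (A_at B t e))).
Proof.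
have main := glued_sections_not_noetherian char0 e_basis Sigma_fan Sigma_rays D_minus2
  B_skew B_rank2 psi_quotient.
split.
  (* The coefficient ring is [k[N]], spanned by the characters of the second factor. *)
  pose T : 'rV[int]_n -> ratfun k (n + n) := fun x => zmon k (row_mx 0 x).
  pose chi : 'rV[int]_n -> ratfun k (n + n) := fun m => zmon k (row_mx m 0).
  have [z0 zD] := zmon_char k (n + n).
  have Tc : is_char T.
    by split=> [|a b]; rewrite /T ?row_mx0 ?z0 // -zD add_row_mx addr0.
  have hc : is_char chi.
    by split=> [|a b]; rewrite /chi ?row_mx0 ?z0 // -zD add_row_mx addr0.
  have jE m x : zmon k (row_mx m x) = chi m * T x.
    by rewrite /chi /T -zD add_row_mx addr0 add0r.
  apply: (main k (ratfun k (n + n)) (cstr k (n + n)) T chi) => //.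
    move=> x; rewrite -z0 => /zmon_inj h; by rewrite -(row_mxKr (0 : 'rV[int]_n) x) h linear0.
  have chi_n0 m : chi m != 0 by exact: (char_neq0 m hc).
  apply: (@lin_indep_coefficients k (ratfun k (n + n)) (cstr k (n + n)) 'rV[int]_n 'rV[int]_n
    'rV[int]_(n + n) T chi (@zmon k (n + n)) (@row_mx _ 1 n n) (@lsubmx _ 1 n n)
    (fun m x => row_mxKl m x) (constants_ring k (n + n)) (@zmon_lin_indep k (n + n)) chi_n0 jE).
(* The closed sets to be avoided are [t^x = 1], for all [x <> 0]. *)
pose Z (j : nat) : set (laurent k n) :=
  if @choice.unpickle 'rV[int]_n j is Some x then
    (if x == 0 :> 'rV[int]_n then [set [:: (1, 0)]] else [set [:: (1, x); (-1, 0)]])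
  else [set [:: (1, 0)]].
have [z0 zD] := zmon_char k n.
exists Z; split=> [j|L iota t t0 tZ].
  have p1 : proper_closed [set [:: (1 : k, 0 : 'rV[int]_n)]].
    exists [:: (1, 0)] => //; rewrite /laurent_fun /lincomb big_seq1 /= z0 mulr1 -cstrE rmorph1.
    by apply/eqP; exact: oner_neq0.
  rewrite /Z; case: choice.unpickle => [x|//]; case: eqP => // x0.
  exists [:: (1, x); (-1, 0)] => //; rewrite /laurent_fun /lincomb !big_cons big_nil /= z0.
  rewrite -!cstrE rmorphN rmorph1 mul1r mulr1 addr0 => /eqP; rewrite subr_eq0 => /eqP h.
  by apply: x0; apply: (@zmon_inj k n); rewrite h z0.
have tinj x : monomial t x = 1 -> x = 0.
  move=> e1; apply: contrapT => /eqP x0; apply: (tZ (choice.pickle x)) => p; rewrite /Z choice.pickleK (negbTE x0) => ->.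
  rewrite /laurent_eval /lincomb !big_cons big_nil /= e1 (proj1 (monomial_char t0)).
  by rewrite rmorphN rmorph1 !mulr1 addr0 subrr.
pose T : 'rV[int]_n -> ratfun L n := fun x => cst n (monomial t x).
have [m0 mD] := monomial_char t0.
have Tc : is_char T.
  by split=> [|a b]; rewrite /T -!cstrE ?m0 ?rmorph1 // mD rmorphM.
have hc := zmon_char L n.
apply: (main L (ratfun L n) (cstr L n) T (@zmon L n)) => //.
  by move=> x; rewrite /T -(rmorph1 (cstr L n)) => /cst_inj /tinj.
move=> g Cg; apply: zmon_lin_indep => m; have [s [_ ->]] := Cg m.
have cr := constants_ring L n; apply: (subring_sum cr) => a _.
by apply: (subringM cr); eexists.
Qed.
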